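(* Let $n\ge3$ be an integer and $\alpha\in(0,n)$. For constants $\lambda>0$ and $\sigma\ge0$, call $u$ a nonnegative solution (for $(\alpha,\lambda,\sigma)$) if $u$ is a nonnegative function with $u\in C^2(\mathbb{R}^n\setminus\{0\})\cap L^\lambda(\mathbb{R}^n)$ and $$0\le-\Delta u\le(|x|^{-\alpha}*u^\lambda)\,u^\sigma\quad\text{in }B_2(0)\setminus\{0\}.$$ (i) If $0<\lambda<\frac{n-\alpha}{n-2}$ and $\sigma=g_\alpha(\lambda)$, then all nonnegative solutions $u$ are harmonically bounded at $0$, that is (since here $\lambda<\frac{n}{n-2}$), $u(x)=O(|x|^{-(n-2)})$ as $x\to0$. (ii) If $\lambda=\frac{n-\alpha}{n-2}$ and $\sigma=g_\alpha(\lambda)$, then there does not exist a pointwise bound for nonnegative solutions as $x\to0$; that is, there is no continuous function $\varphi:(0,1)\to(0,\infty)$ such that every nonnegative solution $u$ satisfies $u(x)=O(\varphi(|x|))$ as $x\to0$. (iii) If $\alpha\in(2,n)$, $\lambda>\frac{n}{\alpha-2}$ and $\sigma=g_\alpha(\lambda)$, then there does not exist a pointwise bound for nonnegative solutions as $x\to0$; that is, there is no continuous function $\varphi:(0,1)\to(0,\infty)$ such that every nonnegative solution $u$ satisfies $u(x)=O(\varphi(|x|))$ as $x\to0$.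
   Context: $B_r(x)$ is the open ball in $\mathbb{R}^n$ of radius $r$ centered at $x$. The convolution is over $\mathbb{R}^n$: $(|x|^{-\alpha}*u^\lambda)(x)=\int_{\mathbb{R}^n}\frac{u(y)^\lambda}{|x-y|^\alpha}\,dy$. For $\lambda>0$ (including $\lambda<1$), $u\in L^\lambda(\mathbb{R}^n)$ means $\int_{\mathbb{R}^n}|u|^\lambda<\infty$. The differential inequalities hold pointwise. For $\alpha\in(0,n)$ the function $g_\alpha:(0,\infty)\to[0,\infty)$ is defined by $$g_\alpha(\lambda)=\begin{cases}\frac{n}{n-2}&\text{if }0<\lambda<\frac{n-\alpha}{n-2},\\ \frac{2n-\alpha}{n-2}-\lambda&\text{if }\frac{n-\alpha}{n-2}\le\lambda<\frac{n}{n-2},\\ \max\{0,1-\frac{\alpha-2}{n}\lambda\}&\text{if }\lambda\ge\frac{n}{n-2}.\end{cases}$$ A nonnegative solution $u$ is called harmonically bounded at $0$ if, as $x\to 0$, $u(x)=O(|x|^{-(n-2)})$ when $0<\lambda<\frac{n}{n-2}$, and $u(x)=O(1)$ when $\lambda\ge\frac{n}{n-2}$. *)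

(* Defs.v *)
From HB Require Import structures.
From mathcomp Require Import all_boot all_order all_algebra.
From mathcomp Require Import all_classical all_reals all_analysis.

Set Implicit Arguments.
Unset Strict Implicit.
Unset Printing Implicit Defensive.

Import Order.TTheory GRing.Theory Num.Theory.
Import numFieldNormedType.Exports.

Local Open Scope classical_set_scope.
Local Open Scope ring_scope.

(* Lebesgue measure on R^n, carried by n.-tuple R with the sigma-algebra
   generated by the coordinates (the Borel one): the library has binary
   products of measures only, so it is built by induction on n, transporting
   the product of lebesgue_measure and the measure on R^n along consing. It is
   characterized by its values on boxes, see leb_tuple_box. *)
Section LebesgueTuple.
Context {R : realType}.
Let T := measurableTypeR R.

Definition consing n (p : T * n.-tuple T) : n.+1.-tuple T :=
  [the n.+1.-tuple T of p.1 :: p.2].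

Lemma measurable_consing n : measurable_fun setT (@consing n).
Proof. exact: measurable_cons. Qed.

Definition leb_cons n (mu : {measure set (n.-tuple T) -> \bar R}) :
    set (n.+1.-tuple T) -> \bar R :=
  pushforward (@lebesgue_measure R \x^ mu)%E (@consing n).

Section leb_cons_measure.
Variables (n : nat) (mu : {measure set (n.-tuple T) -> \bar R}).

Let mc : measurable_fun setT (@consing n) := @measurable_consing n.

Let leb_cons0 : leb_cons mu set0 = 0%E.
Proof. by rewrite /leb_cons /pushforward preimage_set0 measure0. Qed.

Let leb_cons_ge0 A : (0 <= leb_cons mu A)%E.
Proof. by apply: integral_ge0 => t _; exact: measure_ge0. Qed.

Let leb_cons_sigma_additive : semi_sigma_additive (leb_cons mu).
Proof.
exact: (measure_semi_sigma_additive (s := pushforward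
  ((@lebesgue_measure R \x^ mu)%E : {measure set _ -> \bar R}) (@consing n))).
Qed.

HB.instance Definition _ := isMeasure.Build _ _ _ (leb_cons mu)
  leb_cons0 leb_cons_ge0 leb_cons_sigma_additive.

End leb_cons_measure.

Fixpoint leb_tuple n : {measure set (n.-tuple T) -> \bar R} :=
  match n with
  | 0 => dirac ([tuple] : 0.-tuple T)
  | m.+1 => leb_cons (leb_tuple m)
  end.

Lemma leb_tuple_box n (A : 'I_n -> set T) : (forall i, measurable (A i)) ->
  leb_tuple n [set t | forall i, A i (tnth t i)] =
  (\prod_(i < n) lebesgue_measure (A i))%E.
Proof.
elim: n A => [|n IH] A mA.
  by rewrite big_ord0 /= diracE mem_set//= => -[].
rewrite big_ord_recl /= /leb_cons /pushforward.
have -> : @consing n @^-1` [set t | forall i, A i (tnth t i)] =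
    A ord0 `*` [set t : n.-tuple T | forall i, A (lift ord0 i) (tnth t i)].
  apply/seteqP; split => -[x t] /=.
    move=> H; split; first by have := H ord0; rewrite tnth0.
    by move=> i; have := H (lift ord0 i); rewrite tnthS.
  move=> [Ax At] i; case: (unliftP ord0 i) => [j ->|->].
    by rewrite tnthS.
  by rewrite tnth0.
rewrite product_measure2E//; first by congr (_ * _)%E; exact: IH.
have -> : [set t : n.-tuple T | forall i, A (lift ord0 i) (tnth t i)] =
    \bigcap_(i in [set: 'I_n]) ((@tnth _ T ^~ i) @^-1` A (lift ord0 i)).
  by apply/seteqP; split => t H i /=; [move=> _; exact: H|exact: (H i I)].
apply: fin_bigcap_measurable; first exact: finite_finset.
by move=> i _; rewrite -[X in measurable X]setTI; apply: measurable_tnth.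
Qed.

End LebesgueTuple.

Section Setting.
Context {R : realType} {n : nat}.

(* The library's norm on 'rV[R]_n is the sup norm, hence this one. *)
Definition enorm (x : 'rV[R]_n) : R := Num.sqrt (\sum_i x 0 i ^+ 2).

Definition integral_rV (f : 'rV[R]_n -> \bar R) : \bar R :=
  (\int[leb_tuple n]_t f (\row_i tnth t i))%E.

Definition partial (i : 'I_n) (f : 'rV[R]_n -> R) : 'rV[R]_n -> R :=
  'D_(delta_mx 0 i) f.

Fixpoint Ck (k : nat) (D : set 'rV[R]_n) (f : 'rV[R]_n -> R) : Prop :=
  (forall x, D x -> {for x, continuous f}) /\
  match k with
  | 0 => True
  | k'.+1 => forall i, (forall x, D x -> derivable f x (delta_mx 0 i)) /\
                       Ck k' D (partial i f)
  end.

Definition laplacian (f : 'rV[R]_n -> R) (x : 'rV[R]_n) : R :=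
  \sum_i partial i (partial i f) x.

Definition in_Llambda (lambda : R) (u : 'rV[R]_n -> R) : Prop :=
  (integral_rV (fun x => (`|u x| `^ lambda)%:E) < +oo)%E.

(* (|x|^-alpha * u^lambda)(x); the value 0 that powR gives to |x - y|^-alpha at
   y = x is immaterial, {x} being a null set. *)
Definition riesz_conv (alpha lambda : R) (u : 'rV[R]_n -> R) (x : 'rV[R]_n) :
    \bar R :=
  integral_rV (fun y => (u y `^ lambda * enorm (x - y) `^ (- alpha))%:E).

(* Functions on R^n \ {0} are total functions whose value at 0 is never
   constrained. Since r `^ 0 = 1 for all r, including 0, the factor
   u^sigma is 1 when sigma = 0. *)
Definition nonneg_solution (alpha lambda sigma : R) (u : 'rV[R]_n -> R) : Prop :=
  [/\ forall x, x != 0 -> 0 <= u x,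
      Ck 2 [set x | x != 0] u,
      in_Llambda lambda u &
      forall x, x != 0 -> enorm x < 2 ->
        0 <= - laplacian u x /\
        ((- laplacian u x)%:E <=
          riesz_conv alpha lambda u x * (u x `^ sigma)%:E)%E].

Definition galpha (alpha lambda : R) : R :=
  if lambda < (n%:R - alpha) / (n%:R - 2) then n%:R / (n%:R - 2)
  else if lambda < n%:R / (n%:R - 2) then
    (2 * n%:R - alpha) / (n%:R - 2) - lambda
  else Num.max 0 (1 - (alpha - 2) / n%:R * lambda).

(* The blank in [=O_ (] matters: [=O_(] is a different token, expecting \near. *)
Definition bigO_at0 (u v : 'rV[R]_n -> R) : Prop :=
  (u : 'rV[R]_n -> R^o) =O_ ((0 : 'rV[R]_n)^') (v : 'rV[R]_n -> R^o).

Definition harmonically_bounded (lambda : R) (u : 'rV[R]_n -> R) : Prop :=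
  if lambda < n%:R / (n%:R - 2) then
    bigO_at0 u (fun x => enorm x ^- (n - 2))
  else bigO_at0 u (fun=> 1).

(* phi is a function on (0,1); its values elsewhere play no role. *)
Definition has_pointwise_bound (alpha lambda sigma : R) : Prop :=
  exists phi : R -> R,
    [/\ forall r, 0 < r < 1 -> {for r, continuous phi},
        forall r, 0 < r < 1 -> 0 < phi r &
        forall u : 'rV[R]_n -> R, nonneg_solution alpha lambda sigma u ->
          bigO_at0 u (fun x => phi (enorm x))].

End Setting.

Arguments galpha {R} n alpha lambda.
Arguments has_pointwise_bound {R} n alpha lambda sigma.
Arguments nonneg_solution {R n} alpha lambda sigma u.

(* Main.v *)
(* Part (i). Testing f = -Laplacian u >= 0 against cutoffs vanishing near 0 shows
   that f has finite mass near 0 and that u has mass O(r^2) on the ball of radius r;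
   testing against regularised, cut off fundamental solutions then bounds u(y) by the
   Newtonian potential of f plus C |y|^(2-n). Hence, by Tonelli, |x|^-alpha * u^lambda
   is bounded near 0, so that f <= K u^(n/(n-2)). At a maximum point x1 of
   (R - |x-x0|)^n u(x) with R = |x0|/2, the part of the potential of f coming from
   the scale u(x1)^(-1/(n-2)) is absorbed, and the rest is small because f has small
   mass near 0; this leaves R^n u(x0) <= C R^2.

   Parts (ii) and (iii). The solution is a multiple of a smooth background plus bumps
   eps_j (r_j^2 + |x-x_j|^2)^(-(n-2)/2) cut off to disjoint balls, x_j -> 0. Far from
   x_j the bump is nearly harmonic, and its Laplacian is absorbed by the background.
   Near x_j it is dominated by the convolution of the bump itself: in (iii) by the
   contribution of the core |y-x_j| < r_j, in (ii), where every dyadic scale between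
   r_j and the radius of the ball contributes equally, by that of many scales. The
   heights of the bumps are unbounded, as r_j can be taken arbitrarily small. *)
Require Import Defs.
From HB Require Import structures.
From mathcomp Require Import all_boot all_order all_algebra.
From mathcomp Require Import all_classical all_reals all_analysis.
From mathcomp Require Import measurable_realfun.
From mathcomp Require Import ring lra.

Set Implicit Arguments.
Unset Strict Implicit.
Unset Printing Implicit Defensive.

Import Order.TTheory GRing.Theory Num.Theory.
Import numFieldNormedType.Exports.

Local Open Scope classical_set_scope.
Local Open Scope ring_scope.

(** * Lebesgue measure on row vectors *)

(** In (i) nothing is known about [u] at [0], so test functions must vanish near [0], and an
    ordinary cutoff would leave errors involving [u] there. The subharmonic cutoff [zeta d] leaves
    terms of the good sign instead: the only error lives on a fixed annulus, and [d] can tend to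
    [0]. The hypothesis on [lambda] says [(n - 2) lambda + alpha < n], which is what makes the
    convolution of [|y|^((2 - n) lambda)] with the kernel bounded. For the exponent [n / (n - 2)]
    the maximum point argument is scale invariant: shrinking the scale gains nothing by itself, and
    smallness has to come from the mass of [f]. In (ii) [(n - 2) lambda + alpha = n], so that the
    same convolution diverges logarithmically; this divergence beats the constant in front of the
    Laplacian of a bump. In (iii) [sigma = 0], and the height [r^(-m)] of a bump of core [r] has to
    be large enough for the differential inequality and small enough for the mass of its power
    [lambda] to vanish with [r]; such an [m] exists exactly when [lambda (alpha - 2) > n]. *)

Definition rV_of_tuple {R : realType} {n : nat}
  (t : n.-tuple (measurableTypeR R)) : 'rV[R]_n := \row_i tnth t i.

Definition tuple_of_rV {R : realType} {n : nat} (x : 'rV[R]_n) :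
  n.-tuple (measurableTypeR R) := [tuple x 0 i | i < n].

Lemma rV_of_tupleK {R : realType} {n : nat} :
  cancel (@rV_of_tuple R n) tuple_of_rV.
Proof. by move=> t; apply: eq_from_tnth => i; rewrite tnth_mktuple mxE. Qed.

Lemma tuple_of_rVK {R : realType} {n : nat} :
  cancel (@tuple_of_rV R n) rV_of_tuple.
Proof. by move=> x; apply/rowP => i; rewrite mxE tnth_mktuple. Qed.

Section MeasurableRV.
Context {R : realType} {n : nat}.

(** Transported from tuples, so that measure and integration theory apply directly to functions of
    row vectors. *)
Definition measurable_rV : set (set 'rV[R]_n) :=
  fun A => measurable (@rV_of_tuple R n @^-1` A).

Lemma measurable_rV0 : measurable_rV set0.
Proof. by rewrite /measurable_rV preimage_set0. Qed.

Lemma measurable_rVC A : measurable_rV A -> measurable_rV (~` A).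
Proof. by rewrite /measurable_rV preimage_setC => /measurableC. Qed.

Lemma measurable_rV_bigcup (F : (set 'rV[R]_n)^nat) :
  (forall i, measurable_rV (F i)) -> measurable_rV (\bigcup_i F i).
Proof.
by move=> mF; rewrite /measurable_rV preimage_bigcup; exact: bigcupT_measurable.
Qed.

End MeasurableRV.

Fact rV_display : measure_display. Proof. exact default_measure_display. Qed.

HB.instance Definition _ (R : realType) n :=
  isMeasurable.Build rV_display 'rV[R]_n (@measurable_rV0 R n)
    (@measurable_rVC R n) (@measurable_rV_bigcup R n).

Section Lebesgue.
Context {R : realType} {n : nat}.
Local Notation V := ('rV[R]_n).

Lemma measurable_rV_of_tuple : measurable_fun setT (@rV_of_tuple R n).
Proof. by move=> _ A mA; rewrite setTI. Qed.

Lemma measurable_tuple_of_rV : measurable_fun setT (@tuple_of_rV R n).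
Proof.
move=> _ A mA; rewrite setTI /measurable /= /measurable_rV -comp_preimage.
rewrite (_ : _ \o _ = id) //.
by apply/funext => t /=; exact: rV_of_tupleK.
Qed.

Lemma measurable_fun_rVP d (X : measurableType d) (f : X -> V) :
  measurable_fun setT f <->
  forall i, measurable_fun setT (fun x => f x 0 i : measurableTypeR R).
Proof.
have fE i : (fun x => f x 0 i : measurableTypeR R) =
    @tnth n (measurableTypeR R) ^~ i \o (tuple_of_rV \o f).
  by apply/funext => x /=; rewrite tnth_mktuple.
split=> [mf i|mf].
  rewrite fE; apply: (measurable_fun_tnthP _).1.
  by apply: measurableT_comp => //; exact: measurable_tuple_of_rV.
rewrite (_ : f = rV_of_tuple \o (tuple_of_rV \o f)).
  apply: measurableT_comp; first exact: measurable_rV_of_tuple.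
  by apply/measurable_fun_tnthP => i; rewrite -fE.
by apply/funext => x /=; rewrite tuple_of_rVK.
Qed.

Lemma measurable_coord i :
  measurable_fun setT (fun x : V => x 0 i : measurableTypeR R).
Proof. by apply: (measurable_fun_rVP _).1 => //; exact: measurable_id. Qed.

Definition box (A : 'I_n -> set R) : set V := [set x | forall i, A i (x 0 i)].

Lemma measurable_box (A : 'I_n -> set (measurableTypeR R)) :
  (forall i, measurable (A i)) -> measurable (box A).
Proof.
move=> mA.
have -> : box A = \bigcap_(i in [set: 'I_n])
    ((fun x : V => x 0 i : measurableTypeR R) @^-1` A i).
  by apply/seteqP; split => t H i /=; [move=> _; exact: H|exact: (H i I)].
apply: fin_bigcap_measurable; first exact: finite_finset.
by move=> i _; rewrite -[X in measurable X]setTI; exact: measurable_coord.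
Qed.

Definition leb : set V -> \bar R := pushforward (leb_tuple n) (@rV_of_tuple R n).

Let leb0 : leb set0 = 0%E.
Proof. by rewrite /leb /pushforward preimage_set0 measure0. Qed.

Let leb_ge0 A : (0 <= leb A)%E.
Proof. by rewrite /leb /pushforward; exact: measure_ge0. Qed.

Let leb_sigma_additive : semi_sigma_additive leb.
Proof.
have := measurable_rV_of_tuple => mc.
exact: (measure_semi_sigma_additive
  (s := pushforward (leb_tuple n) (@rV_of_tuple R n))).
Qed.

HB.instance Definition _ := isMeasure.Build _ _ _ leb
  leb0 leb_ge0 leb_sigma_additive.

Lemma leb_box (A : 'I_n -> set (measurableTypeR R)) :
  (forall i, measurable (A i)) ->
  leb (box A) = (\prod_(i < n) lebesgue_measure (A i))%E.
Proof.
move=> mA; rewrite -leb_tuple_box // /leb /pushforward; congr (leb_tuple n _).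
by apply/seteqP; split => t /= H i; move: (H i); rewrite mxE.
Qed.

Lemma ltr_mx_norm (x : V) (r : R) : 0 < r ->
  (`|x| < r) <-> (forall i, `|x 0 i| < r).
Proof.
move=> r0; rewrite [`|x|]/Num.norm /= mx_normrE; split => [/bigmax_ltP[_ H] i|H].
  exact: (H (0, i)).
by apply/bigmax_ltP; split => // -[a i] _ /=; rewrite (ord1 a).
Qed.

Lemma ler_mx_norm (x : V) (r : R) : 0 <= r ->
  (`|x| <= r) <-> (forall i, `|x 0 i| <= r).
Proof.
move=> r0; rewrite [`|x|]/Num.norm /= mx_normrE; split => [/bigmax_leP[_ H] i|H].
  exact: (H (0, i)).
by apply/bigmax_leP; split => // -[a i] _ /=; rewrite (ord1 a).
Qed.

(** Balls of the sup norm are products of intervals, so their measure is explicit. The Euclidean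
    norm is kept for smooth radial functions and the convolution kernel; the two norms are compared
    up to factors of [n]. *)
Definition cube (c : V) (r : R) : set V := [set x | `|x - c| < r].

Lemma cubeE c (r : R) : 0 < r ->
  cube c r = box (fun i => `](c 0 i - r), (c 0 i + r)[%classic).
Proof.
move=> r0; apply/seteqP; split => x.
  by move=> /(ltr_mx_norm _ r0) H i; have := H i;
    rewrite !mxE /= in_itv /= ltr_distl.
move=> H; apply/(ltr_mx_norm _ r0) => i; have := H i.
by rewrite !mxE /= in_itv /= ltr_distl.
Qed.

Lemma measurable_cube c (r : R) : measurable (cube c r).
Proof.
have [r0|r0] := ltP 0 r.
  by rewrite cubeE //; apply: measurable_box => i; exact: measurable_itv.
rewrite (_ : cube c r = set0) //; apply/seteqP; split => // x.
by move=> /= H; have := lt_le_trans H r0; rewrite normr_lt0.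
Qed.

Lemma leb_cube c (r : R) : 0 < r -> leb (cube c r) = ((2 * r) ^+ n)%:E.
Proof.
move=> r0; rewrite cubeE // leb_box; last by move=> i; exact: measurable_itv.
rewrite (eq_bigr (fun=> (2 * r)%:E)).
  by rewrite prodEFin prodr_const card_ord.
move=> i _; rewrite lebesgue_measure_itv /= lte_fin.
have -> : c 0 i - r < c 0 i + r by lra.
by rewrite EFinN; congr (_%:E); lra.
Qed.

Lemma setT_cube : [set: V] = \bigcup_k cube 0 k.+1%:R.
Proof.
apply/seteqP; split => // x _.
by exists (Num.trunc `|x|) => //; rewrite /cube /= subr0 truncnS_gt.
Qed.

Lemma leb_sigma_finite : sigma_finite [set: V] leb.
Proof.
exists (fun k => cube 0 k.+1%:R); first exact: setT_cube.
by move=> k; split; [exact: measurable_cube|rewrite leb_cube // ltry].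
Qed.

HB.instance Definition _ := @Measure_isSigmaFinite.Build _ _ _ leb leb_sigma_finite.

Lemma open_measurable_rV (U : set V) : open U -> measurable U.
Proof.
move=> oU.
(* Cubes with rational centre and radius [1 / (k + 1)]; those not contained in [U] are replaced by
   [set0], which keeps the index type countable. *)
pose F (qk : 'rV[rat]_n * nat) : set V :=
  let C := cube (map_mx ratr qk.1) (qk.2.+1%:R^-1) in
  if `[< C `<=` U >] then C else set0.
rewrite (_ : U = \bigcup_qk F qk).
  apply: countable_bigcupT_measurable; first exact: countableP.
  by move=> qk; rewrite /F; case: ifP => // _; exact: measurable_cube.
apply/seteqP; split => x.
  move=> Ux; have /nbhs_ballP[e /= e0 xeU] := oU _ Ux.
  have [k ke] : exists k, k.+1%:R^-1 < e / 2.
    have e2 : 0 < e / 2 by rewrite divr_gt0.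
    have [k _ /(_ _ (leqnn k))] := near_infty_natSinv_lt (PosNum e2).
    by exists k.
  have [a [aE a0]] : exists a : R, a = k.+1%:R^-1 /\ 0 < a.
    by exists k.+1%:R^-1; split => //; rewrite invr_gt0.
  rewrite -aE in ke.
  have /choice[q qP] i : exists q : rat, ratr q \in `]x 0 i - a, x 0 i + a[.
    by apply: rat_in_itvoo; rewrite ltrD2l gtrN.
  exists (\row_i q i, k) => //; rewrite /F /= -aE.
  have xC : cube (map_mx ratr (\row_i q i)) a x.
    apply/ltr_mx_norm => // i; rewrite !mxE distrC.
    by have := qP i; rewrite in_itv /= ltr_distl.
  rewrite asboolT // => y yC; apply: xeU; rewrite mx_norm_ball /=.
  rewrite -(subrK (map_mx ratr (\row_i q i)) x) -addrA.
  apply: le_lt_trans (ler_normD _ _) _; move: xC yC; rewrite /cube /= => xC yC.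
  by rewrite [`|_ - y|]distrC [e]splitr ltrD // (lt_trans _ ke).
by move=> [qk _]; rewrite /F; case: asboolP => // CU /CU.
Qed.

Lemma continuous_in_measurable_rV (D : set V) (f : V -> R) : open D ->
  (forall x, D x -> {for x, continuous f}) -> measurable_fun D f.
Proof.
move=> oD cf; apply: (measurability _ (measurable_realfun.RGenOpens.measurableE R)).
move=> _ [_ [a [b ->]] <-]; apply: open_measurable_rV.
rewrite openE => x [Dx /= fx]; apply: filterI; first exact: open_nbhs_nbhs.
apply: (cf _ Dx); apply: open_nbhs_nbhs; split => //; exact: interval_open.
Qed.

Lemma continuous_measurable_rV (f : V -> R) :
  continuous f -> measurable_fun setT f.
Proof.
move=> cf; apply: continuous_in_measurable_rV; first exact: (@openT V).
by move=> x _; exact: cf.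
Qed.

Lemma measurable_translate h : measurable_fun setT (fun x : V => x + h).
Proof.
apply/measurable_fun_rVP => i.
rewrite (_ : (fun _ => _) = (fun x : V => x 0 i + h 0 i)); last first.
  by apply/funext => x; rewrite mxE.
by apply: measurable_funD => //; exact: measurable_coord.
Qed.

End Lebesgue.

Lemma lebesgue_measure_translate (R : realType) (h : R)
    (A : set (measurableTypeR R)) : measurable A ->
  lebesgue_measure [set x | A (x + h)] = lebesgue_measure A.
Proof.
move=> mA; apply/esym.
pose g (x : measurableTypeR R) : measurableTypeR R := x + h.
have mg : measurable_fun setT g by exact: measurable_funD.
rewrite -[RHS]/(pushforward lebesgue_measure g A).
apply: lebesgue_measure_unique => //= _ [[a b]] _ <-.
rewrite /pushforward.
have -> : g @^-1` `]a, b] = `](a - h), (b - h)]%classic.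
  by apply/seteqP; split => x /=; rewrite !in_itv /= /g ltrBlDr lerBrDr.
rewrite !lebesgue_measure_itv /= !lte_fin ltrD2r.
by case: ifP => // _; rewrite -!EFinD; congr (_%:E); ring.
Qed.

Section Translation.
Context {R : realType} {n : nat}.
Local Notation V := ('rV[R]_n).

Definition boxes : set (set V) := [set B | exists A : 'I_n -> set (measurableTypeR R),
  (forall i, measurable (A i)) /\ B = box A].

Lemma measurable_rVE : @measurable _ V = <<s boxes >>.
Proof.
apply/seteqP; split => A; last first.
  apply: smallest_sub; first exact: sigma_algebra_measurable.
  by move=> _ [B [mB ->]]; exact: measurable_box.
move=> mA.
pose f (x : g_sigma_algebraType boxes) : n.-tuple (measurableTypeR R) :=
  tuple_of_rV (x : V).
have mf : measurable_fun setT f.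
  apply/measurable_fun_tnthP => i _ B mB; rewrite setTI.
  apply: sub_sigma_algebra; exists (fun j => if j == i then B else setT).
  split => [j|]; first by case: ifP.
  apply/seteqP; split => x /=.
    by rewrite tnth_mktuple => Bx j; case: eqP => // ->.
  by move=> /(_ i); rewrite eqxx tnth_mktuple.
have := mf measurableT _ mA; rewrite setTI.
rewrite (_ : f @^-1` _ = A) //; apply/seteqP; split => x;
  by rewrite /f /= tuple_of_rVK.
Qed.

(** Boxes are stable under intersection, generate the sigma-algebra and include an exhausting
    sequence of cubes of finite measure. Translation invariance on boxes comes from dimension one,
    and uniqueness of measures extends it. *)
Lemma leb_translate (h : V) (A : set V) : measurable A ->
  leb [set x | A (x + h)] = leb A.
Proof.
move=> mA; apply/esym.
pose g (x : V) : V := x + h.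
have mg : measurable_fun setT g by exact: measurable_translate.
rewrite -[RHS]/(pushforward leb g A).
apply: (@measure_unique _ _ _ boxes (fun k => cube 0 k.+1%:R)) => //.
- exact: measurable_rVE.
- move=> _ _ [B [mB ->]] [C [mC ->]]; exists (fun i => B i `&` C i); split.
    by move=> i; exact: measurableI.
  by apply/seteqP; split => x /= => [[? ?]|H]; [split|split => i; case: (H i)].
- move=> k; rewrite cubeE //; eexists; split; last reflexivity.
  by move=> i; exact: measurable_itv.
- by rewrite -setT_cube.
- move=> _ [B [mB ->]]; change (leb (box B) = leb (g @^-1` box B)); rewrite leb_box //.
  have -> : g @^-1` box B = box (fun i => [set y | B i (y + h 0 i)]).
    by apply/seteqP; split => x /= H i; move: (H i); rewrite /= mxE.
  rewrite leb_box; first by apply: eq_bigr => i _; rewrite lebesgue_measure_translate.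
  move=> i; rewrite -[X in measurable X]setTI.
  have mh : measurable_fun setT
      (fun y : measurableTypeR R => y + h 0 i : measurableTypeR R).
    exact: measurable_funD.
  exact: mh.
- by move=> k; rewrite [X in (X < _)%E]leb_cube // ltry.
Qed.

Local Open Scope ereal_scope.

Lemma ge0_integral_translate (h : V) (f : V -> \bar R) :
  measurable_fun setT f -> (forall x, 0 <= f x) ->
  \int[leb]_x f (x + h)%R = \int[leb]_x f x.
Proof.
move=> mf f0; have mg := measurable_translate h.
rewrite -[LHS](@ge0_integral_pushforward _ _ _ _ _ _ mg leb setT f) //.
by apply: eq_measure_integral => A mA _; exact: (leb_translate h mA).
Qed.

Lemma integrable_translate (h : V) (f : V -> \bar R) :
  leb.-integrable setT f -> leb.-integrable setT (fun x => f (x + h)%R).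
Proof.
move=> /integrableP[mf fi]; apply/integrableP; split.
  by apply: measurableT_comp => //; exact: measurable_translate.
rewrite (ge0_integral_translate h (f := fun x => `|f x|)) //.
by apply: measurableT_comp.
Qed.

Lemma integral_translate (h : V) (f : V -> \bar R) : measurable_fun setT f ->
  \int[leb]_x f (x + h)%R = \int[leb]_x f x.
Proof.
move=> mf; rewrite -[LHS]/(\int[leb]_x (f \o (fun y : V => (y + h)%R)) x).
rewrite integralE [RHS]integralE funepos_comp funeneg_comp; congr (_ - _).
  exact: (ge0_integral_translate h (measurable_funepos mf) (funepos_ge0 f)).
exact: (ge0_integral_translate h (measurable_funeneg mf) (funeneg_ge0 f)).
Qed.

Lemma integral_rVE (f : V -> \bar R) : measurable_fun setT f ->
  (forall x, 0 <= f x) -> integral_rV f = \int[leb]_x f x.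
Proof.
move=> mf f0; apply/esym.
exact: (@ge0_integral_pushforward _ _ _ _ _ _ measurable_rV_of_tuple
  (leb_tuple n) setT f).
Qed.

End Translation.

Section Lines.
Context {R : realType} {V : normedModType R}.

(** Reduces directional derivatives to one real variable, where the mean value theorem and the chain
    rule apply. *)
Lemma is_derive_lineP (f : V -> R) (x v : V) (t d : R) :
  is_derive (x + t *: v) v f d <->
  is_derive t 1 (fun s : R => f (x + s *: v)) d.
Proof.
have E : (fun h : R => h^-1 *: ((f \o shift (x + t *: v)) (h *: v) - f (x + t *: v)))
   = (fun h : R => h^-1 *: (((fun s : R => f (x + s *: v)) \o shift t) (h *: (1 : R))
        - f (x + t *: v))).
  apply/funext => h /=; congr (_ *: (f _ - _)).
  by rewrite [h *: (1 : R)]mulr1 scalerDl addrCA.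
split => -[df fd]; (split; [move: df | move: fd]);
  rewrite /derivable /derive E //.
Qed.

End Lines.

Section IntegralPartial.
Context {R : realType} {n : nat}.
Local Notation V := ('rV[R]_n).

Lemma compact_closed_cube (M : R) : compact [set x : V | `|x| <= M].
Proof.
apply: bounded_closed_compact.
  exists M; split; first exact: num_real.
  by move=> y My x /= xM; rewrite (le_trans xM) // ltW.
rewrite (_ : mkset _ = (fun x : V => `|x|) @^-1` [set y | y <= M]) //.
apply: closed_comp; last exact: closed_le.
by move=> x _; exact: norm_continuous.
Qed.

Lemma continuous_bounded_support (f : V -> R) (M : R) : continuous f ->
  (forall x, M < `|x| -> f x = 0) ->
  exists2 B : R, 0 <= B & forall x, `|f x| <= B.
Proof.
move=> cf f0; have [M0|M0] := leP 0 M; last first.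
  by exists 0 => // x; rewrite f0 ?normr0 // (lt_le_trans M0).
have cK := @compact_closed_cube M.
have K0 : [set x : V | `|x| <= M] !=set0 by exists 0; rewrite /= normr0.
have cn : continuous (fun x => `|f x|).
  by move=> x; apply: continuous_comp; [exact: cf|exact: norm_continuous].
have [c _ Hc] := EVT_max_rV K0 cK (continuous_subspaceT cn).
exists `|f c| => // x; have [xM|xM] := leP `|x| M; last by rewrite f0 ?normr0.
by apply: Hc; rewrite inE.
Qed.

Lemma normr_delta_mx (i : 'I_n) : `|delta_mx 0 i : V| = 1.
Proof.
apply/eqP; rewrite eq_le; apply/andP; split.
  apply/(ler_mx_norm _ (ler01)) => j; rewrite mxE eqxx /=.
  by case: eqP => _; rewrite ?normr1 ?normr0.
have := (ler_mx_norm (delta_mx 0 i : V) (normr_ge0 (delta_mx 0 i : V))).1 (lexx _) i.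
by rewrite mxE !eqxx normr1.
Qed.

Lemma integrable_cst_cube (c : V) (B r : R) : 0 < r ->
  leb.-integrable setT (EFin \o (fun x => B * \1_(cube c r) x)).
Proof.
move=> r0.
apply: (@eq_integrable _ _ _ leb _ measurableT
  (fun x => B%:E * (EFin \o \1_(cube c r)) x)%E) => //.
apply: integrableZl => //; have mC := measurable_cube c r.
apply/integrableP; split; first exact/measurable_EFinP.
rewrite (eq_integral (fun x => (\1_(cube c r) x)%:E)) => [|x _]; last first.
  by rewrite gee0_abs // lee_fin.
by rewrite integral_indic // setIT [X in (X < _)%E]leb_cube // ltry.
Qed.

Lemma integrable_bounded_support (f : V -> R) (M B : R) :
  measurable_fun setT f -> (forall x, M < `|x| -> f x = 0) ->
  (forall x, `|f x| <= B) -> leb.-integrable setT (EFin \o f).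
Proof.
move=> mf f0 fB.
apply: (@le_integrable _ _ _ leb _ measurableT _
  (EFin \o (fun x => B * \1_(cube (0 : V) (`|M| + 1)) x))).
- exact/measurable_EFinP.
- move=> x _; rewrite /= lee_fin.
  have B0 : 0 <= B := le_trans (normr_ge0 _) (fB 0).
  rewrite [leRHS]ger0_norm ?mulr_ge0 // indicE.
  have [xM|xM] := boolP (x \in _); first by rewrite mulr1.
  rewrite f0 ?normr0 ?mulr_ge0 //.
  move: xM; rewrite notin_setE /cube /= subr0 => /negP; rewrite -leNgt.
  by apply: lt_le_trans; rewrite ltr_pwDr // ler_norm.
- by apply: integrable_cst_cube; rewrite ltr_wpDl.
Qed.

Lemma MVT_partial (F : V -> R) (i : 'I_n) (B : R) :
  (forall x, derivable F x (delta_mx 0 i)) ->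
  (forall x, `|partial i F x| <= B) ->
  forall x h, 0 < h -> `|F (x + h *: delta_mx 0 i) - F x| <= h * B.
Proof.
move=> dF BF x h h0.
have dl t : is_derive t (1 : R) (fun s : R => F (x + s *: delta_mx 0 i))
    (partial i F (x + t *: delta_mx 0 i)).
  by apply: (is_derive_lineP _ _ _ _ _).1; exact: DeriveDef.
have [|t _ E] := MVT h0 (fun t _ => dl t).
  apply: derivable_within_continuous => t _; exact: (@ex_derive _ _ _ _ _ _ _ (dl t)).
move: E; rewrite scale0r addr0 subr0 => ->.
by rewrite normrM (gtr0_norm h0) mulrC ler_wpM2l // ltW.
Qed.

(** By translation invariance the difference quotients have integral [0]. The mean value theorem
    dominates them by a multiple of the indicator of a cube, and dominated convergence yields the
    partial derivative. *)
Lemma integral_partial0 (F : V -> R) (i : 'I_n) (M : R) :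
  (forall x, derivable F x (delta_mx 0 i)) -> continuous F ->
  continuous (partial i F) -> (forall x, M < `|x| -> F x = 0) ->
  (\int[leb]_x (partial i F x)%:E = 0)%E.
Proof.
move=> dF cF cdF F0.
have dF0 x : M < `|x| -> partial i F x = 0.
  move=> Mx; rewrite /partial (near_eq_derive (g := cst 0)); first exact: derive_cst.
  have : \forall y \near x, M < `|y|.
    exact: (cvgr_gt _ (@norm_continuous _ V x)).
  by apply: filterS => y; exact: F0.
have [B B0 FB] := continuous_bounded_support cdF dF0.
pose g k x := k.+1%:R * (F (x + k.+1%:R^-1 *: delta_mx 0 i) - F x).
have mF := continuous_measurable_rV cF.
have iF : leb.-integrable setT (EFin \o F).
  have [C C0 FC] := continuous_bounded_support cF F0.
  exact: integrable_bounded_support mF F0 FC.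
have ig k : leb.-integrable setT (EFin \o g k).
  apply: (@eq_integrable _ _ _ leb _ _ (fun x => k.+1%:R%:E *
     (((EFin \o F) (x + k.+1%:R^-1 *: delta_mx 0 i))%R - (EFin \o F) x))%E) => //.
  apply: integrableZl => //; apply: integrableB => //.
  exact: integrable_translate iF.
have g0 k : (\int[leb]_x (g k x)%:E = 0)%E.
  rewrite -[LHS]/(\int[leb]_x (k.+1%:R%:E *
     (((EFin \o F) (x + k.+1%:R^-1 *: delta_mx 0 i))%R - (EFin \o F) x)))%E.
  have it := integrable_translate (k.+1%:R^-1 *: delta_mx 0 i : V) iF.
  rewrite integralZl //; last exact: integrableB.
  rewrite integralB // (integral_translate _ (f := EFin \o F)) //; last first.
    exact/measurable_EFinP.
  rewrite subee ?mule0 //; exact: integrable_fin_num.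
(* In the radius [|M| + 2], one unit covers the step of length at most [1], the other makes the
   inequality strict. *)
have gB k x : `|g k x| <= B * \1_(cube (0 : V) (`|M| + 2)) x.
  have k0 : (0 : R) < k.+1%:R^-1 by rewrite invr_gt0.
  rewrite indicE; have [xM|xM] := boolP (x \in _).
    rewrite mulr1 /g normrM gtr0_norm //.
    rewrite mulrC -ler_pdivlMr // mulrC; exact: MVT_partial.
  move: xM; rewrite notin_setE /cube /= subr0 => /negP; rewrite -leNgt => xM.
  rewrite /g !F0 ?subrr ?mulr0 ?normr0 //.
    by apply: lt_le_trans xM; rewrite ltr_pwDr // ler_norm.
  rewrite -[x in _ + x]opprK; apply: lt_le_trans (lerB_dist _ _).
  rewrite normrN normrZ normr_delta_mx mulr1 gtr0_norm // ltrBrDr.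
  apply: lt_le_trans xM; apply: (@le_lt_trans _ _ (`|M| + 1)); last by rewrite ltrD2l ltr1n.
  by apply: lerD; [exact: ler_norm|rewrite invf_le1 // ler1n].
have [] := @dominated_convergence _ _ R leb setT measurableT
   (fun k => EFin \o g k) (EFin \o partial i F)
   (EFin \o (fun x => B * \1_(cube (0 : V) (`|M| + 2)) x)).
- by move=> k; exact: (measurable_int leb (ig k)).
- by apply/measurable_EFinP; exact: continuous_measurable_rV cdF.
- apply: aeW => x _; apply: cvg_EFin; first exact: nearW.
  have dx := dF x; rewrite /derivable in dx.
  have h0 : (k.+1%:R^-1 : R) @[k --> \oo] --> 0^'.
    move=> A A0.
    have : \forall k \near \oo, (harmonic k : R) != 0 -> A (harmonic k).
      exact: (@cvg_harmonic R _ A0).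
    by apply: filterS => k; apply; rewrite /harmonic invr_neq0.
  have := cvg_comp _ _ h0 dx.
  apply: cvg_trans; apply: near_eq_cvg; apply: nearW => k.
  by rewrite /g /= invrK [_ *: _ + x]addrC.
- by apply: integrable_cst_cube; rewrite ltr_wpDl.
- by apply: aeW => x k _; rewrite lee_fin.
move=> _ _; rewrite (_ : (fun _ => _) = cst 0%E); last first.
  by apply/funext => k; exact: g0.
by move=> H; apply: (cvg_unique (@ereal_hausdorff R) H); exact: cvg_cst.
Qed.

End IntegralPartial.

(** * Green's formula *)

Section ContinuousAt.
Context {R : realType} {T : topologicalType}.
Implicit Types (f g : T -> R) (x : T).

Lemma continuous_atM f g x : {for x, continuous f} ->
  {for x, continuous g} -> {for x, continuous (fun y => f y * g y)}.
Proof. by move=> cf cg; exact: (continuousM cf cg). Qed.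

Lemma continuous_atD f g x : {for x, continuous f} ->
  {for x, continuous g} -> {for x, continuous (fun y => f y + g y)}.
Proof. by move=> cf cg; exact: (continuousD cf cg). Qed.

Lemma continuous_atB f g x : {for x, continuous f} ->
  {for x, continuous g} -> {for x, continuous (fun y => f y - g y)}.
Proof. by move=> cf cg; exact: (continuousB cf cg). Qed.

End ContinuousAt.

Section Green.
Context {R : realType} {n : nat}.
Local Notation V := ('rV[R]_n).
Implicit Types (f g v psi : V -> R) (D : set V).

Lemma sube0_eq (a b : \bar R) : a \is a fin_num -> b \is a fin_num ->
  (a - b = 0)%E -> a = b.
Proof. by case: a => [a||] //; case: b => [b||] // _ _ [] /subr0_eq ->. Qed.

Lemma Ck2P D f : Ck 2 D f <->
  (forall x, D x -> {for x, continuous f}) /\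
  forall i, [/\ forall x, D x -> derivable f x (delta_mx 0 i),
    forall x, D x -> {for x, continuous (partial i f)} &
    forall j, (forall x, D x -> derivable (partial i f) x (delta_mx 0 j)) /\
      (forall x, D x -> {for x, continuous (partial j (partial i f))})].
Proof.
split => -[cf H]; split; [exact: cf| |exact: cf|] => i.
  have [df [cdf Hi]] := H i; split; [exact: df|exact: cdf|move=> j].
  by have [ddf [cddf _]] := Hi j; split; [exact: ddf|exact: cddf].
have [df cdf Hi] := H i; split; first exact: df.
split; [exact: cdf|move=> j]; have [ddf cddf] := Hi j.
by split; [exact: ddf|split; [exact: cddf|]].
Qed.

Lemma near_neq0 (x : V) : x != 0 -> \forall y \near x, y != 0.
Proof.
move=> x0; have : \forall y \near x, 0 < `|y|.
  by apply: (cvgr_gt _ (@norm_continuous _ V x)); rewrite normr_gt0.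
by apply: filterS => y; rewrite normr_gt0.
Qed.

Lemma near_norm_lt (x : V) (d : R) : `|x| < d -> \forall y \near x, `|y| < d.
Proof. exact: (cvgr_lt _ (@norm_continuous _ V x)). Qed.

Lemma near_norm_gt (x : V) (d : R) : d < `|x| -> \forall y \near x, d < `|y|.
Proof. exact: (cvgr_gt _ (@norm_continuous _ V x)). Qed.

Lemma near_eq_continuous f g (x : V) : (\forall y \near x, f y = g y) ->
  {for x, continuous g} -> {for x, continuous f}.
Proof.
move=> fg cg; have fx : f x = g x := nbhs_singleton fg.
change (f y @[y --> x] --> f x); rewrite fx.
have fg' : \forall y \near x, g y = f y by apply: filterS fg => y ->.
exact: (cvg_trans (near_eq_cvg fg') cg).
Qed.

Lemma continuous_vanishing f (d : R) : 0 < d ->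
  (forall x, x != 0 -> {for x, continuous f}) ->
  (forall x, `|x| < d -> f x = 0) -> continuous f.
Proof.
move=> d0 cf f0 x; have [->|x0] := eqVneq x 0; last exact: cf.
have c0 : {for (0 : V), continuous (cst (0 : R) : V -> R)} by exact: cst_continuous.
apply: near_eq_continuous c0.
by have := near_norm_lt (x := 0); rewrite normr0 => /(_ _ d0);
  apply: filterS => y; exact: f0.
Qed.

Lemma partial_near0 f i (x : V) : (\forall y \near x, f y = 0) -> partial i f x = 0.
Proof.
move=> fx; rewrite /partial (near_eq_derive (g := cst 0)) //.
exact: derive_cst.
Qed.

Lemma partial_vanishing f i (d : R) :
  (forall x, `|x| < d -> f x = 0) -> forall x, `|x| < d -> partial i f x = 0.
Proof.
move=> f0 x xd; apply: partial_near0.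
by apply: filterS (near_norm_lt xd) => y; exact: f0.
Qed.

Lemma partial_support f i (M : R) :
  (forall x, M < `|x| -> f x = 0) -> forall x, M < `|x| -> partial i f x = 0.
Proof.
move=> f0 x xd; apply: partial_near0.
by apply: filterS (near_norm_gt xd) => y; exact: f0.
Qed.

(** For each coordinate, [v D_i D_i psi - psi D_i D_i v] is the [i]-th derivative of
    [v D_i psi - psi D_i v], a compactly supported function to which [integral_partial0] applies. As
    [psi] vanishes near [0], the singularity of [v] there is harmless. *)
Lemma green v psi (d M : R) : 0 < d ->
  Ck 2 [set x | x != 0] v -> Ck 2 setT psi ->
  (forall x, `|x| < d -> psi x = 0) -> (forall x, M < `|x| -> psi x = 0) ->
  [/\ leb.-integrable setT (EFin \o (fun x => v x * laplacian psi x)),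
      leb.-integrable setT (EFin \o (fun x => psi x * laplacian v x)) &
      (\int[leb]_x (v x * laplacian psi x)%:E =
      \int[leb]_x (psi x * laplacian v x)%:E)%E].
Proof.
move=> d0 /Ck2P[cv Hv] /Ck2P[cpsi Hpsi] psid psiM.
have intg f : (forall x, x != 0 -> {for x, continuous f}) ->
    (forall x, `|x| < d -> f x = 0) -> (forall x, M < `|x| -> f x = 0) ->
    leb.-integrable setT (EFin \o f).
  move=> cf f0 fM; have cf' := continuous_vanishing d0 cf f0.
  have [B B0 fB] := continuous_bounded_support cf' fM.
  exact: integrable_bounded_support (continuous_measurable_rV cf') fM fB.
have dpsi i := @partial_vanishing _ i _ psid.
have ddpsi i := @partial_vanishing _ i _ (dpsi i).
have mpsi i := @partial_support _ i _ psiM.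
have mmpsi i := @partial_support _ i _ (mpsi i).
have iA i : leb.-integrable setT (EFin \o (fun x => v x * partial i (partial i psi) x)).
  have [_ _ /(_ i)[_ c2]] := Hpsi i.
  apply: intg => x x0; [|by rewrite ddpsi ?mulr0|by rewrite mmpsi ?mulr0].
  by apply: continuous_atM; [exact: cv|exact: c2].
have iB i : leb.-integrable setT (EFin \o (fun x => psi x * partial i (partial i v) x)).
  have [_ _ /(_ i)[_ c2]] := Hv i.
  apply: intg => x x0; [|by rewrite psid ?mul0r|by rewrite psiM ?mul0r].
  by apply: continuous_atM; [exact: cpsi|exact: c2].
have AB i : (\int[leb]_x (v x * partial i (partial i psi) x)%:E =
    \int[leb]_x (psi x * partial i (partial i v) x)%:E)%E.
  pose F x := v x * partial i psi x - psi x * partial i v x.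
  have F0 x : `|x| < d -> F x = 0 by move=> xd; rewrite /F dpsi ?psid // mulr0 mul0r subrr.
  have FM x : M < `|x| -> F x = 0 by move=> xd; rewrite /F mpsi ?psiM // mulr0 mul0r subrr.
  have [dv cdv /(_ i)[ddv cddv]] := Hv i.
  have [dp cdp /(_ i)[ddp cddp]] := Hpsi i.
  have cF : continuous F.
    apply: (continuous_vanishing d0) => // x x0.
    by apply: continuous_atB; apply: continuous_atM; [exact: cv|exact: cdp|exact: cpsi|exact: cdv].
  pose G x := v x * partial i (partial i psi) x - psi x * partial i (partial i v) x.
  have G0 x : `|x| < d -> G x = 0 by move=> xd; rewrite /G ddpsi ?psid // mulr0 mul0r subrr.
  have dF x : is_derive x (delta_mx 0 i) F (G x).
    (* At [0] the function [v] need not be differentiable, but [F] vanishes on a neighbourhood. *)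
    have [->|x0] := eqVneq x 0.
      rewrite G0 ?normr0 //.
      have nF : {near (0 : V), cst 0 =1 F}.
        have := near_norm_lt (x := 0); rewrite normr0 => /(_ _ d0).
        by apply: filterS => y /F0 ->.
      apply: DeriveDef; first by apply: near_eq_derivable nF _; exact: derivable_cst.
      by rewrite -(near_eq_derive _ nF); exact: derive_cst.
    have h1 : is_derive x (delta_mx 0 i) v (partial i v x) by apply: DeriveDef; [exact: dv|].
    have h2 : is_derive x (delta_mx 0 i) (partial i v) (partial i (partial i v) x).
      by apply: DeriveDef; [exact: ddv|].
    have h3 : is_derive x (delta_mx 0 i) psi (partial i psi x) by apply: DeriveDef; [exact: dp|].
    have h4 : is_derive x (delta_mx 0 i) (partial i psi) (partial i (partial i psi) x).
      by apply: DeriveDef; [exact: ddp|].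
    apply: (is_derive_eq (is_deriveB (is_deriveM h1 h4) (is_deriveM h3 h2))).
    change (v x * partial i (partial i psi) x + partial i psi x * partial i v x -
      (psi x * partial i (partial i v) x + partial i v x * partial i psi x) = G x).
    rewrite /G; move: (v x) (psi x) (partial i psi x) (partial i v x)
      (partial i (partial i psi) x) (partial i (partial i v) x) => a b c e f g.
    by ring.
  have pF : partial i F = G by apply/funext => x; exact: derive_val.
  have : (\int[leb]_x (partial i F x)%:E = 0)%E.
    apply: (integral_partial0 (M := M)) . 
    - by move=> x; case: (dF x).
    - exact: cF.
    - rewrite pF; apply: (continuous_vanishing d0) => [x x0|]; last exact: G0.
      by apply: continuous_atB; apply: continuous_atM; [exact: cv|exact: cddp|exact: cpsi|exact: cddv].
    - exact: FM.
  rewrite pF; have -> : (fun x => (G x)%:E) = (fun x =>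
      (EFin \o (fun x => v x * partial i (partial i psi) x)%R) x -
      (EFin \o (fun x => psi x * partial i (partial i v) x)%R) x)%E by [].
  rewrite (integralB measurableT (iA i) (iB i)).
  exact: sube0_eq (integrable_fin_num measurableT (iA i))
    (integrable_fin_num measurableT (iB i)).
have EA : EFin \o (fun x => v x * laplacian psi x) =
    (fun x => \sum_(i < n) (EFin \o (fun x => (v x * partial i (partial i psi) x)%R)) x)%E.
  by apply/funext => x /=; rewrite /laplacian mulr_sumr sumEFin.
have EB : EFin \o (fun x => psi x * laplacian v x) =
    (fun x => \sum_(i < n) (EFin \o (fun x => (psi x * partial i (partial i v) x)%R)) x)%E.
  by apply/funext => x /=; rewrite /laplacian mulr_sumr sumEFin.
split.
- by rewrite EA; apply: integrable_sum => // i _; exact: iA.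
- by rewrite EB; apply: integrable_sum => // i _; exact: iB.
change (\int[leb]_x (EFin \o (fun x => (v x * laplacian psi x)%R)) x =
  \int[leb]_x (EFin \o (fun x => (psi x * laplacian v x)%R)) x)%E.
apply: (etrans (congr1 (fun h => integral leb setT h) EA)).
apply: (etrans _ (esym (congr1 (fun h => integral leb setT h) EB))).
apply: (etrans (integral_sum measurableT iA (index_enum _) xpredT)).
apply: (etrans _ (esym (integral_sum measurableT iB (index_enum _) xpredT))).
by apply: eq_bigr => i _; exact: AB.
Qed.

End Green.

Section Local.
Context {R : realType} {n : nat}.
Local Notation V := ('rV[R]_n).
Implicit Types (f g : V -> R) (x : V).

Lemma partial_near_eq f g i x : (\forall y \near x, f y = g y) ->
  \forall y \near x, partial i f y = partial i g y.
Proof.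
move=> /nbhs_interior; apply: filterS => y fg.
exact: near_eq_derive.
Qed.

Lemma laplacian_near_eq f g x : (\forall y \near x, f y = g y) ->
  laplacian f x = laplacian g x.
Proof.
move=> fg; apply: eq_bigr => i _.
exact: (nbhs_singleton (partial_near_eq i (partial_near_eq i fg))).
Qed.

(** Meant for the glued solution, which near each point other than [0] coincides with the background
    plus a single bump, a function of class [C^2] everywhere. *)
Lemma Ck2_local (D : set V) f :
  (forall x, D x -> exists2 g, Ck 2 setT g & \forall y \near x, f y = g y) ->
  Ck 2 D f.
Proof.
move=> H; apply/Ck2P; split => [x Dx|i].
  have [g /Ck2P[cg _] fg] := H x Dx.
  exact: near_eq_continuous fg (cg x I).
have sw f1 f2 (x : V) : (\forall y \near x, f1 y = f2 y) -> {near x, f2 =1 f1}.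
  by apply: filterS => y ->.
split => [x Dx|x Dx|j]; last split => x Dx;
  have [g /Ck2P[_ /(_ i)[d1 c1 H2]] fg] := H x Dx.
- exact: near_eq_derivable (sw _ _ _ fg) (d1 x I).
- exact: near_eq_continuous (partial_near_eq i fg) (c1 x I).
- have [d2 _] := H2 j.
  exact: near_eq_derivable (sw _ _ _ (partial_near_eq i fg)) (d2 x I).
- have [_ c2] := H2 j.
  exact: near_eq_continuous (partial_near_eq j (partial_near_eq i fg)) (c2 x I).
Qed.

Lemma Ck2_add f g : Ck 2 setT f -> Ck 2 setT g -> Ck 2 setT (fun x => f x + g x) /\
  forall x, laplacian (fun x => f x + g x) x = laplacian f x + laplacian g x.
Proof.
move=> /Ck2P[cf Hf] /Ck2P[cg Hg].
have E1 i : partial i (fun x => f x + g x) = (fun x => partial i f x + partial i g x).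
  have [df _ _] := Hf i; have [dg _ _] := Hg i.
  by apply/funext => x; exact: deriveD (df x I) (dg x I).
have E2 i j : partial j (partial i (fun x => f x + g x)) =
    (fun x => partial j (partial i f) x + partial j (partial i g) x).
  have [_ _ /(_ j)[df _]] := Hf i; have [_ _ /(_ j)[dg _]] := Hg i.
  by rewrite E1; apply/funext => x; exact: deriveD (df x I) (dg x I).
split; last first.
  by move=> x; rewrite /laplacian -big_split; apply: eq_bigr => i _; rewrite E2.
apply/Ck2P; split => [x _|i]; first exact: continuous_atD (cf x I) (cg x I).
have [df1 cf1 Hf2] := Hf i; have [dg1 cg1 Hg2] := Hg i.
split => [x _|x _|j].
- exact: derivableD (df1 x I) (dg1 x I).
- by rewrite E1; exact: continuous_atD (cf1 x I) (cg1 x I).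
- have [df2 cf2] := Hf2 j; have [dg2 cg2] := Hg2 j; split => x _.
    by rewrite E1; exact: derivableD (df2 x I) (dg2 x I).
  by rewrite E2; exact: continuous_atD (cf2 x I) (cg2 x I).
Qed.

End Local.

(** * Radial functions *)

Section OneVariable.
Context {R : realType}.
Implicit Types (F G : R -> R) (D E : set R).

(* Radial functions are written [F (sq (x - a))], with [F] twice continuously
   differentiable on [s >= 0], so that smoothness at the center is automatic. *)
Definition C2on D F F1 F2 := forall s, D s ->
  [/\ is_derive s 1 F (F1 s), is_derive s 1 F1 (F2 s) & {for s, continuous F2}].

Lemma is_derive_continuous F (s d : R) :
  is_derive s 1 F d -> {for s, continuous F}.
Proof. by case=> /derivable1_diffP/differentiable_continuous. Qed.

Lemma C2on_sub D E F F1 F2 : (forall s, D s -> E s) ->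
  C2on E F F1 F2 -> C2on D F F1 F2.
Proof. by move=> DE H s /DE/H. Qed.

Lemma C2on_comp D E F F1 F2 G G1 G2 : C2on E F F1 F2 -> C2on D G G1 G2 ->
  (forall s, D s -> E (G s)) ->
  C2on D (fun s => F (G s)) (fun s => F1 (G s) * G1 s)
    (fun s => F2 (G s) * G1 s ^+ 2 + F1 (G s) * G2 s).
Proof.
move=> HF HG DE s Ds.
have [f1 f2 cf2] := HF _ (DE _ Ds); have [g1 g2 cg2] := HG _ Ds.
have h1 : is_derive s 1 (fun s => F (G s)) (F1 (G s) * G1 s).
  exact: (is_derive1_comp f1 g1).
have h2 : is_derive s 1 (fun s => F1 (G s)) (F2 (G s) * G1 s).
  exact: (is_derive1_comp f2 g1).
split => //.
  apply: (is_derive_eq (is_deriveM h2 g2)).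
  change (F1 (G s) * G2 s + G1 s * (F2 (G s) * G1 s) =
    F2 (G s) * G1 s ^+ 2 + F1 (G s) * G2 s).
  by move: (F1 (G s)) (G2 s) (G1 s) (F2 (G s)) => a b c d; ring.
have cG := is_derive_continuous g1; have cG1 := is_derive_continuous g2.
have cF1G := is_derive_continuous h2.
have cF2G : {for s, continuous (fun s => F2 (G s))}.
  by apply: continuous_comp.
apply: continuous_atD.
  apply: continuous_atM => //.
  exact: (continuousM cG1 cG1).
exact: (continuousM cF1G cg2).
Qed.

Lemma C2on_mul D F F1 F2 G G1 G2 : C2on D F F1 F2 -> C2on D G G1 G2 ->
  C2on D (fun s => F s * G s) (fun s => F1 s * G s + F s * G1 s)
    (fun s => F2 s * G s + 2 * (F1 s * G1 s) + F s * G2 s).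
Proof.
move=> HF HG s Ds; have [f1 f2 cf2] := HF _ Ds; have [g1 g2 cg2] := HG _ Ds.
split.
- apply: (is_derive_eq (is_deriveM f1 g1)).
  change (F s * G1 s + G s * F1 s = F1 s * G s + F s * G1 s).
  by move: (F1 s) (G s) (G1 s) (F s) => a b c d; ring.
- apply: (is_derive_eq (is_deriveD (is_deriveM f2 g1) (is_deriveM f1 g2))).
  change (F1 s * G1 s + G s * F2 s + (F s * G2 s + G1 s * F1 s) =
    F2 s * G s + 2 * (F1 s * G1 s) + F s * G2 s).
  by move: (F1 s) (G s) (G1 s) (F s) (F2 s) (G2 s) => a b c d e f; ring.
have cF := is_derive_continuous f1; have cF1 := is_derive_continuous f2.
have cG := is_derive_continuous g1; have cG1 := is_derive_continuous g2.
apply: continuous_atD; last exact: (continuousM cF cg2).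
apply: continuous_atD.
  exact: (continuousM cf2 cG).
apply: continuous_atM.
  exact: cst_continuous.
exact: (continuousM cF1 cG1).
Qed.

Lemma C2on_affine D (a b : R) : C2on D (fun s => a + b * s) (fun=> b) (fun=> 0).
Proof.
move=> s _; split; [|exact: is_derive_cst|exact: cst_continuous].
have h := is_deriveD (is_derive_cst a s (1 : R))
  (is_deriveM (is_derive_cst b s (1 : R)) (is_derive_id s (1 : R))).
apply: (is_derive_eq h).
change (0 + (b * 1 + s * 0) = b); ring.
Qed.

Lemma C2on_scale D F F1 F2 (a b : R) : C2on D F F1 F2 ->
  C2on D (fun s => a + b * F s) (fun s => b * F1 s) (fun s => b * F2 s).
Proof.
move=> HF.
have -> : (fun s => b * F2 s) = (fun s => 0 * F1 s ^+ 2 + b * F2 s).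
  by apply/funext => s; rewrite mul0r add0r.
exact: (C2on_comp (@C2on_affine setT a b) HF (fun _ _ => I)).
Qed.

Lemma C2on_powR (b : R) : C2on [set s | 0 < s] (fun s => s `^ b)
  (fun s => b * s `^ (b - 1)) (fun s => b * ((b - 1) * s `^ (b - 1 - 1))).
Proof.
move=> s /= s0.
have P c : is_derive s (1 : R) (fun s : R => s `^ c) (c * s `^ (c - 1)).
  exact: is_derive1_powR.
have S (c d : R) F : is_derive s 1 F d -> is_derive s 1 (fun s => c * F s) (c * d).
  move=> Fd; apply: (is_derive_eq (is_deriveM (is_derive_cst c s (1 : R)) Fd)).
  by change (c * d + F s * 0 = c * d); rewrite mulr0 addr0.
split; [exact: P|exact: S _ _ _ (P _)|].
exact: is_derive_continuous (S _ _ _ (S _ _ _ (P _))).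
Qed.

(** The regularity of all cutoffs at their kinks rests on this: at [0] the difference quotient is
    [|h|], which tends to [0]. *)
Lemma is_derive_mul_norm (t : R) : is_derive t 1 (fun s : R => s * `|s|) (2 * `|t|).
Proof.
have P : is_derive t (1 : R) (fun s : R => s * s) (2 * t).
  apply: (is_derive_eq (is_deriveM (is_derive_id t (1 : R)) (is_derive_id t (1 : R)))).
  by change (t * 1 + t * 1 = 2 * t); ring.
have N : is_derive t (1 : R) (fun s : R => - (s * s)) (- (2 * t)).
  exact: is_deriveN.
have near_is_derive f g d : {near t, f =1 g} -> is_derive t (1 : R) f d ->
    is_derive t (1 : R) g d.
  move=> fg [df dfE]; apply: DeriveDef; first exact: near_eq_derivable fg df.
  by rewrite -dfE; apply/esym/near_eq_derive.
have [t0|t0|->] := ltrgt0P t.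
- apply: near_is_derive P; near=> s; rewrite gtr0_norm //; near: s.
  exact: lt_nbhsr.
- rewrite mulrN; apply: near_is_derive N; near=> s; rewrite ltr0_norm ?mulrN //.
  by near: s; exact: lt_nbhsl.
rewrite mulr0.
have H : (fun h : R => `|h|) @ (0 : R)^' --> (0 : R).
  have := @norm_continuous _ R 0; rewrite /continuous_at normr0.
  exact: cvg_within_filter.
have E : (fun h : R => h^-1 *: (((fun s : R => s * `|s|) \o shift 0) (h *: (1 : R)) -
    0 * `|(0 : R)|)) @ (0 : R)^' --> (0 : R).
  apply: cvg_trans H; apply: near_eq_cvg; near=> h.
  have h0 : h != 0 by near: h; exact: nbhs_dnbhs_neq.
  rewrite /= addr0 mul0r subr0 [h *: (1 : R)]mulr1.
  by change (`|h| = h^-1 * (h * `|h|)); rewrite mulKf.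
by split; [apply/cvg_ex; exists 0|exact: (cvg_lim (@norm_hausdorff _ _) E)].
Unshelve. all: by end_near. Qed.

(* [cubep t] is [max t 0 ^+ 3], written so as to differentiate only [t * `|t|]. *)
Definition cubep (t : R) := (t * (t * t) + t * (t * `|t|)) / 2.
Definition cubep1 (t : R) := 3 / 2 * (t * t + t * `|t|).
Definition cubep2 (t : R) := 3 * (t + `|t|).

Lemma C2on_cubep : C2on setT cubep cubep1 cubep2.
Proof.
move=> t _; have D1 := is_derive_id t (1 : R); have D2 := is_deriveM D1 D1.
have N := is_derive_mul_norm t.
have h1 : is_derive t 1 cubep (cubep1 t).
  have := is_deriveM (is_deriveD (is_deriveM D1 D2) (is_deriveM D1 N))
    (is_derive_cst (2^-1 : R) t (1 : R)).
  move/is_derive_eq; apply.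
  change ((t * (t * t) + t * (t * `|t|)) * 0 + 2^-1 *
    (t * (t * 1 + t * 1) + t * t * 1 + (t * (2 * `|t|) + t * `|t| * 1)) = cubep1 t).
  by rewrite /cubep1; move: `|t| => u; field.
have h2 : is_derive t 1 cubep1 (cubep2 t).
  have := is_deriveM (is_derive_cst (3 / 2 : R) t (1 : R)) (is_deriveD D2 N).
  move/is_derive_eq; apply.
  change (3 / 2 * (t * 1 + t * 1 + 2 * `|t|) + (t * t + t * `|t|) * 0 = cubep2 t).
  by rewrite /cubep2; move: `|t| => u; field.
split => //.
apply: continuous_atM.
  exact: cst_continuous.
apply: continuous_atD; first exact: cvg_id.
exact: norm_continuous.
Qed.

Lemma cubep_le0 t : t <= 0 -> [/\ cubep t = 0, cubep1 t = 0 & cubep2 t = 0].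
Proof.
by move=> t0; rewrite /cubep /cubep1 /cubep2 ler0_norm //; split; ring.
Qed.

Lemma cubep_ge0 t : 0 <= t ->
  [/\ cubep t = t ^+ 3, cubep1 t = 3 * t ^+ 2 & cubep2 t = 6 * t].
Proof.
by move=> t0; rewrite /cubep /cubep1 /cubep2 ger0_norm //; split; field.
Qed.

End OneVariable.

Lemma continuous_at_sum (R : realType) (T : topologicalType) (I : Type) (r : seq I)
    (F : I -> T -> R) (x : T) : (forall i, {for x, continuous (F i)}) ->
  {for x, continuous (fun y => \sum_(i <- r) F i y)}.
Proof.
move=> cF; elim: r => [|i r IH].
  have -> : (fun y => \sum_(i <- [::]) F i y) = cst (0 : R).
    by apply/funext => y; rewrite big_nil.
  exact: cst_continuous.
have -> : (fun y => \sum_(j <- i :: r) F j y) =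
    (fun y => F i y + \sum_(j <- r) F j y).
  by apply/funext => y; rewrite big_cons.
exact: continuous_atD.
Qed.

Section Radial.
Context {R : realType} {n : nat}.
Local Notation V := ('rV[R]_n).

Definition sq (x : V) : R := \sum_i x 0 i ^+ 2.

Lemma sq_ge0 x : 0 <= sq x.
Proof. by apply: sumr_ge0 => i _; exact: sqr_ge0. Qed.

Lemma coord_le_norm (x : V) i : `|x 0 i| <= `|x|.
Proof. exact: (ler_mx_norm x (normr_ge0 x)).1. Qed.

Lemma norm_le_sq (x : V) : `|x| ^+ 2 <= sq x.
Proof.
rewrite -[leRHS]sqr_sqrtr ?sq_ge0 // ler_sqr ?nnegrE ?sqrtr_ge0 //.
apply/ler_mx_norm => [|i]; first exact: sqrtr_ge0.
rewrite -sqrtr_sqr ler_sqrt ?sq_ge0 // /sq (bigD1 i) //= lerDl.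
by apply: sumr_ge0 => j _; exact: sqr_ge0.
Qed.

Lemma sq_le_norm (x : V) : sq x <= n%:R * `|x| ^+ 2.
Proof.
apply: (@le_trans _ _ (\sum_(i < n) `|x| ^+ 2)); last first.
  by rewrite sumr_const card_ord mulr_natl.
apply: ler_sum => i _; rewrite -(real_normK (num_real (x 0 i))).
by rewrite ler_sqr ?nnegrE // coord_le_norm.
Qed.

Lemma norm_le_enorm (x : V) : `|x| <= enorm x.
Proof.
by rewrite -ler_sqr ?nnegrE ?sqrtr_ge0 // sqr_sqrtr ?sq_ge0 // norm_le_sq.
Qed.

Lemma enorm_le_norm (x : V) : enorm x <= n%:R * `|x|.
Proof.
rewrite -ler_sqr ?nnegrE ?sqrtr_ge0 ?mulr_ge0 // sqr_sqrtr ?sq_ge0 //.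
apply: le_trans (sq_le_norm x) _; rewrite exprMn ler_wpM2r ?sqr_ge0 //.
rewrite -natrX ler_nat -{1}(expn1 n).
by case: (posnP n) => [-> //|n0]; rewrite leq_pexp2l.
Qed.

Lemma sq_continuous : continuous sq.
Proof.
move=> x; apply: continuous_at_sum => i.
have c : {for x, continuous (fun y : V => y 0 i)} by exact: coord_continuous.
exact: (continuous_atM c c).
Qed.

Lemma is_derive_line (f : V -> R) (x v : V) (d : R) :
  is_derive x v f d <-> is_derive (0 : R) 1 (fun s : R => f (x + s *: v)) d.
Proof. by have := is_derive_lineP f x v 0 d; rewrite scale0r addr0. Qed.

Lemma is_derive_comp (F : R -> R) (g : V -> R) (x v : V) (d e : R) :
  is_derive (g x) 1 F d -> is_derive x v g e ->
  is_derive x v (fun y => F (g y)) (d * e).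
Proof.
move=> Fd /is_derive_line ge; apply/is_derive_line.
apply: (is_derive1_comp (f := F) (g := fun s => g (x + s *: v)) _ ge).
by rewrite scale0r addr0.
Qed.

Lemma is_derive_coord (a x : V) i j :
  is_derive x (delta_mx 0 j) (fun y : V => (y - a) 0 i) (i == j)%:R.
Proof.
apply/is_derive_line.
have -> : (fun s : R => (x + s *: delta_mx 0 j - a) 0 i) =
    (fun s => (x - a) 0 i + (i == j)%:R * s).
  by apply/funext => s; rewrite !mxE eqxx /=; ring.
by have [] := @C2on_affine R setT ((x - a) 0 i) (i == j)%:R 0 I.
Qed.

Lemma is_derive_sq (a x : V) i :
  is_derive x (delta_mx 0 i) (fun y => sq (y - a)) (2 * (x - a) 0 i).
Proof.
apply/is_derive_line.
have -> : (fun s : R => sq (x + s *: delta_mx 0 i - a)) =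
    (fun s => sq (x - a) + s * (2 * (x - a) 0 i + 1 * s)).
  apply/funext => s; rewrite /sq (bigD1 i) //= [in RHS](bigD1 i) //=.
  rewrite (eq_bigr (fun j => (x - a) 0 j ^+ 2)) => [|j ji].
    by rewrite !mxE !eqxx /=; ring.
  by rewrite !mxE (negPf ji) andbF /=; ring.
have D : is_derive (0 : R) 1 (fun s : R => 2 * (x - a) 0 i + 1 * s) 1.
  by have [] := @C2on_affine R setT (2 * (x - a) 0 i) 1 0 I.
have C := is_derive_cst (sq (x - a)) (0 : R) (1 : R).
apply: (is_derive_eq (is_deriveD C (is_deriveM (is_derive_id (0 : R) (1 : R)) D))).
change (0 + (0 * 1 + (2 * (x - a) 0 i + 1 * 0) * 1) = 2 * (x - a) 0 i).
by move: ((x - a) 0 i) => y; ring.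
Qed.

Section Profile.
Variables (F F1 F2 : R -> R) (a : V).
Hypothesis HF : C2on [set s | 0 <= s] F F1 F2.

Lemma is_derive_radial x i : is_derive x (delta_mx 0 i)
  (fun x => F (sq (x - a))) (F1 (sq (x - a)) * (2 * (x - a) 0 i)).
Proof.
have [h _ _] := HF (sq_ge0 (x - a)).
exact: (@is_derive_comp F (fun y => sq (y - a)) x _ _ _ h (is_derive_sq a x i)).
Qed.

Lemma partial_radial i : partial i (fun x => F (sq (x - a))) =
  (fun x => F1 (sq (x - a)) * (2 * (x - a) 0 i)).
Proof. by apply/funext => x; apply: derive_val; exact: is_derive_radial. Qed.

Lemma is_derive2_radial x i j : is_derive x (delta_mx 0 j)
  (fun x => F1 (sq (x - a)) * (2 * (x - a) 0 i))
  (F2 (sq (x - a)) * (4 * (x - a) 0 i * (x - a) 0 j) +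
   F1 (sq (x - a)) * (2 * (i == j)%:R)).
Proof.
have [_ h _] := HF (sq_ge0 (x - a)).
have D1 := @is_derive_comp F1 (fun y => sq (y - a)) x _ _ _ h (is_derive_sq a x j).
have D2 := is_deriveM (is_derive_cst (2 : R) x (delta_mx 0 j : V)) (is_derive_coord a x i j).
apply: (is_derive_eq (is_deriveM D1 D2)).
change (F1 (sq (x - a)) * (2 * (i == j)%:R + (x - a) 0 i * 0) +
  2 * (x - a) 0 i * (F2 (sq (x - a)) * (2 * (x - a) 0 j)) =
  F2 (sq (x - a)) * (4 * (x - a) 0 i * (x - a) 0 j) +
  F1 (sq (x - a)) * (2 * (i == j)%:R)).
move: (F1 _) (F2 _) ((x - a) 0 i) ((x - a) 0 j) ((i == j)%:R : R) => A B C D E.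
ring.
Qed.

Lemma partial2_radial i j : partial j (fun x => F1 (sq (x - a)) * (2 * (x - a) 0 i)) =
  (fun x => F2 (sq (x - a)) * (4 * (x - a) 0 i * (x - a) 0 j) +
   F1 (sq (x - a)) * (2 * (i == j)%:R)).
Proof. by apply/funext => x; apply: derive_val; exact: is_derive2_radial. Qed.

Lemma laplacian_radial x : laplacian (fun x => F (sq (x - a))) x =
  2 * n%:R * F1 (sq (x - a)) + 4 * sq (x - a) * F2 (sq (x - a)).
Proof.
rewrite /laplacian (eq_bigr (fun i => F1 (sq (x - a)) * 2 +
    4 * F2 (sq (x - a)) * (x - a) 0 i ^+ 2)).
  rewrite big_split /= sumr_const card_ord -mulr_sumr -/(sq (x - a)).
  move: (sq (x - a)) => s; rewrite -[_ *+ n]mulr_natr; move: (F1 s) (F2 s) => A B.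
  ring.
move=> i _; rewrite partial_radial partial2_radial eqxx.
move: (F1 _) (F2 _) ((x - a) 0 i) => A B C; rewrite /= ; ring.
Qed.

Lemma Ck2_radial : Ck 2 setT (fun x => F (sq (x - a))).
Proof.
have csq x : {for x, continuous (fun x : V => sq (x - a))}.
  have c1 : {for x, continuous (fun x : V => x - a)}.
    by apply: continuousB; [exact: cvg_id|exact: cst_continuous].
  by apply: (continuous_comp c1); exact: sq_continuous.
have cc x i : {for x, continuous (fun x : V => (x - a) 0 i)}.
  have -> : (fun x : V => (x - a) 0 i) = (fun x : V => x 0 i - a 0 i).
    by apply/funext => z; rewrite !mxE.
  by apply: continuous_atB; [exact: coord_continuous|exact: cst_continuous].
have cF x : {for x, continuous (fun x : V => F (sq (x - a)))}.
  have [h _ _] := HF (sq_ge0 (x - a)).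
  by apply: (continuous_comp (csq x)); exact: is_derive_continuous h.
have cF1 x : {for x, continuous (fun x : V => F1 (sq (x - a)))}.
  have [_ h _] := HF (sq_ge0 (x - a)).
  by apply: (continuous_comp (csq x)); exact: is_derive_continuous h.
have cF2 x : {for x, continuous (fun x : V => F2 (sq (x - a)))}.
  have [_ _ h] := HF (sq_ge0 (x - a)).
  by apply: (continuous_comp (csq x)).
have ck x (k : R) : {for x, continuous (fun _ : V => k)} by exact: cst_continuous.
apply/Ck2P; split; first by move=> x _; exact: cF.
move=> i; split.
- by move=> x _; case: (is_derive_radial x i).
- move=> x _; rewrite partial_radial.
  by apply: (continuous_atM (cF1 x)); apply: (continuous_atM (ck x _)); exact: cc.
move=> j; rewrite partial_radial; split => x _; first by case: (is_derive2_radial x i j).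
rewrite partial2_radial; apply: continuous_atD; apply: continuous_atM.
- exact: cF2.
- apply: continuous_atM; last exact: cc.
  apply: continuous_atM; [exact: ck|exact: cc].
- exact: cF1.
- exact: ck.
Qed.

End Profile.
End Radial.

Lemma enormE (R : realType) (n : nat) (x : 'rV[R]_n) : enorm x = Num.sqrt (sq x).
Proof. by []. Qed.

Lemma enorm_continuous (R : realType) (n : nat) : continuous (@enorm R n).
Proof.
by move=> x; apply: continuous_comp; [exact: sq_continuous|exact: sqrt_continuous].
Qed.

Lemma enorm_scale_delta (R : realType) (n : nat) (i : 'I_n) (a : R) : 0 <= a ->
  enorm (a *: delta_mx 0 i : 'rV[R]_n) = a.
Proof.
move=> a_ge0; rewrite enormE /sq (bigD1 i) //= big1; last first.
  by move=> j ji; rewrite !mxE (negbTE ji) andbF mulr0 expr0n.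
by rewrite !mxE !eqxx mulr1 addr0 sqrtr_sqr ger0_norm.
Qed.

Lemma measurable_enorm_powR (R : realType) (n : nat) (a : R) (x : 'rV[R]_n) :
  measurable_fun setT (fun y : 'rV[R]_n => enorm (x - y) `^ a).
Proof.
apply: (measurableT_comp (measurable_powR a)).
apply: continuous_measurable_rV => y.
apply: continuous_comp; last exact: enorm_continuous.
by apply: continuousB; [exact: cst_continuous|exact: cvg_id].
Qed.

Lemma measurable_sq_powR (R : realType) (n : nat) (a : R) (y : 'rV[R]_n) :
  measurable_fun setT (fun x : 'rV[R]_n => sq (x - y) `^ a).
Proof.
apply: (measurableT_comp (measurable_powR a)); apply: continuous_measurable_rV => x.
apply: continuous_comp; last exact: sq_continuous.
by apply: continuousB; [exact: cvg_id|exact: cst_continuous].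
Qed.

(** * Radial profiles *)

Section Profiles.
Context {R : realType}.

(* [C = (4/3)^3] makes the inner argument of [pcut] vanish at [t = 1/4]. *)
Let C : R := 64 / 27.

(** Two nested cubes of positive parts give a [C^2] cutoff equal to [1] for [t <= 1/4] and to [0]
    for [t >= 1]. Applied to [|x|^2 / rho^2], it is [1] up to distance [rho / 2] and [0] from [rho]
    on. *)
Definition pcut (t : R) : R := 1 + (-1) * cubep (1 + (- C) * cubep (1 + (-1) * t)).
Let y (t : R) := 1 + (- C) * cubep (1 + (-1) * t).
Let y1 (t : R) := (- C) * (cubep1 (1 + (-1) * t) * -1).
Let y2 (t : R) := (- C) *
  (cubep2 (1 + (-1) * t) * (-1) ^+ 2 + cubep1 (1 + (-1) * t) * 0).
Definition pcut1 (t : R) : R := -1 * (cubep1 (y t) * y1 t).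
Definition pcut2 (t : R) : R :=
  -1 * (cubep2 (y t) * y1 t ^+ 2 + cubep1 (y t) * y2 t).

Lemma C2on_pcut : C2on setT pcut pcut1 pcut2.
Proof.
have H := C2on_comp C2on_cubep (@C2on_affine R setT 1 (-1)) (fun _ _ => I).
have Hy : C2on setT y y1 y2 := C2on_scale 1 (- C) H.
exact: C2on_scale 1 (-1) (C2on_comp C2on_cubep Hy (fun _ _ => I)).
Qed.

Lemma pcut_eq1 t : t <= 1 / 4 -> [/\ pcut t = 1, pcut1 t = 0 & pcut2 t = 0].
Proof.
move=> t4; have yt : y t <= 0.
  have t0 : 0 <= 1 + -1 * t by move: t4; lra.
  rewrite /y; have [-> _ _] := cubep_ge0 t0.
  have : (3 / 4) ^+ 3 <= (1 + -1 * t) ^+ 3.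
    by rewrite ler_pXn2r // ?nnegrE //; move: t4; lra.
  by rewrite /C; move: ((1 + -1 * t) ^+ 3) => z; rewrite !exprS expr0; lra.
have [e0 e1 e2] := cubep_le0 yt.
by rewrite /pcut /pcut1 /pcut2 -/(y t) e0 e1 e2; split; ring.
Qed.

Lemma pcut_eq0 t : 1 <= t -> [/\ pcut t = 0, pcut1 t = 0 & pcut2 t = 0].
Proof.
move=> t1; have t0 : 1 + -1 * t <= 0 by move: t1; lra.
have [e0 e1 e2] := cubep_le0 t0.
rewrite /pcut /pcut1 /pcut2 /y /y1 /y2 e0 e1 e2 mulr0 addr0.
have [-> -> ->] := cubep_ge0 (ler01 : (0 : R) <= 1).
by split; ring.
Qed.

Lemma cubep_bnd (t M : R) : t <= M -> 0 <= M ->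
  [/\ 0 <= cubep t <= M ^+ 3, 0 <= cubep1 t <= 3 * M ^+ 2 & 0 <= cubep2 t <= 6 * M].
Proof.
move=> tM M0; have [t0|t0] := leP 0 t.
  have [-> -> ->] := cubep_ge0 t0.
  split; apply/andP; split; rewrite ?exprn_ge0 ?mulr_ge0 ?exprn_ge0 //.
  - by rewrite ler_pXn2r // ?nnegrE.
  - by rewrite ler_pM2l // ler_pXn2r // ?nnegrE.
  - by rewrite ler_pM2l.
have [-> -> ->] := cubep_le0 (ltW t0).
by split; apply/andP; split; rewrite ?exprn_ge0 ?mulr_ge0 ?exprn_ge0.
Qed.

Lemma pcut_bnd t : 0 <= pcut t <= 1.
Proof.
have [/andP[c0 _] _ _] := @cubep_bnd (1 + -1 * t) `|1 + -1 * t| (ler_norm _) (normr_ge0 _).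
have y1' : y t <= 1.
  by rewrite /y; move: c0; rewrite /C; move: (cubep _) => z; lra.
have [/andP[d0 d1] _ _] := cubep_bnd y1' ler01.
by move: d0 d1; rewrite expr1n /pcut -/(y t); move: (cubep _) => z; lra.
Qed.

Lemma pcut_deriv_bnd : exists2 B : R, 0 < B & forall t, 0 <= t ->
  [/\ pcut1 t <= 0, `|pcut1 t| <= B & `|pcut2 t| <= B].
Proof.
(* Any number above [384 + 45], the bound found below for [pcut2], would do. *)
exists 600%:R => [|t t0]; first by rewrite ltr0n.
have u1 : 1 + -1 * t <= 1 by move: t0; lra.
have [/andP[c0 c0'] /andP[c1 c1'] /andP[c2 c2']] := cubep_bnd u1 ler01.
rewrite expr1n ?mulr1 in c0' c1' c2'.
have y1' : y t <= 1 by rewrite /y; move: c0; rewrite /C; move: (cubep _) => z; lra.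
have [_ /andP[d1 d1'] /andP[d2 d2']] := cubep_bnd y1' ler01.
rewrite expr1n ?mulr1 in d1' d2'.
have z1 : 0 <= y1 t <= 8.
  by rewrite /y1 /C; move: c1 c1'; move: (cubep1 _) => z; lra.
have z2 : `|y2 t| <= 15.
  rewrite /y2 /C ler_norml; move: c2 c2'; move: (cubep2 _) (cubep1 _) => z w.
  by rewrite expr2; lra.
have a1 : 0 <= cubep1 (y t) * y1 t <= 24.
  case/andP: z1 => z1 z1'; apply/andP; split; first exact: mulr_ge0.
  apply: (le_trans (ler_pM d1 z1 d1' z1')); lra.
have a2 : 0 <= cubep2 (y t) * y1 t ^+ 2 <= 384.
  case/andP: z1 => z1 z1'; apply/andP; split; first by rewrite mulr_ge0 // sqr_ge0.
  apply: (@le_trans _ _ (6 * 8 ^+ 2)); last by rewrite expr2; lra.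
  by apply: ler_pM => //; rewrite ?sqr_ge0 // ler_pXn2r // ?nnegrE.
have a3 : `|cubep1 (y t) * y2 t| <= 45.
  rewrite normrM (ger0_norm d1); apply: (le_trans (ler_pM d1 (normr_ge0 _) d1' z2)); lra.
rewrite /pcut1 /pcut2.
move: a1 a2 a3; rewrite !ler_norml.
move: (cubep1 (y t) * y1 t) (cubep2 (y t) * y1 t ^+ 2) (cubep1 (y t) * y2 t) => a b c.
by move=> *; split; lra.
Qed.

Lemma C2on_shift_powR (a b : R) : 0 < a ->
  C2on [set s | 0 <= s] (fun s => (a + s) `^ b)
    (fun s => b * (a + s) `^ (b - 1)) (fun s => b * ((b - 1) * (a + s) `^ (b - 1 - 1))).
Proof.
move=> a0.
have D0 s : [set s : R | 0 <= s] s -> [set s : R | 0 < s] (a + 1 * s).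
  by move=> /= s0; rewrite mul1r ltr_wpDr.
have := C2on_comp (C2on_powR b) (@C2on_affine R [set s | 0 <= s] a 1) D0.
rewrite (_ : (fun s => (a + 1 * s) `^ b) = (fun s => (a + s) `^ b)); last first.
  by apply/funext => s; rewrite mul1r.
rewrite (_ : (fun s => b * (a + 1 * s) `^ (b - 1) * 1) = (fun s => b * (a + s) `^ (b - 1))); last first.
  by apply/funext => s; rewrite mul1r mulr1.
rewrite (_ : (fun s => b * ((b - 1) * (a + 1 * s) `^ (b - 1 - 1)) * 1 ^+ 2 +
    b * (a + 1 * s) `^ (b - 1) * 0) = (fun s => b * ((b - 1) * (a + s) `^ (b - 1 - 1)))) //.
by apply/funext => s; rewrite mul1r expr1n mulr1 mulr0 addr0.
Qed.

(* The Laplacian on R^n of [F (sq x)] at a point with [sq x = s]. *)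
Definition rlap (n : nat) (F1 F2 : R -> R) (s : R) : R :=
  2 * n%:R * F1 s + 4 * s * F2 s.

Lemma powR_le (a b c : R) : 0 < a -> a <= b -> c <= 0 -> b `^ c <= a `^ c.
Proof.
move=> a0 ab; have b0 := lt_le_trans a0 ab.
have [d ->] : exists d, c = - d by exists (- c); rewrite opprK.
rewrite oppr_le0 => d0; rewrite !powRN lef_pV2 ?posrE ?powR_gt0 //.
by apply: ge0_ler_powR; rewrite // nnegrE ltW.
Qed.

Lemma powRB1 (a b : R) : 0 < a -> a `^ (b - 1) = a `^ b / a.
Proof. by move=> a0; rewrite powRB ?(gt_eqF a0) ?implybT // powRr1 // ltW. Qed.

Lemma C2on_rescale (F F1 F2 : R -> R) (c : R) : 0 <= c -> C2on setT F F1 F2 ->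
  C2on [set s | 0 <= s] (fun s => F (s * c)) (fun s => F1 (s * c) * c)
    (fun s => F2 (s * c) * c ^+ 2).
Proof.
move=> c0 HF; have := C2on_comp HF (@C2on_affine R [set s | 0 <= s] 0 c) (fun _ _ => I).
rewrite (_ : (fun s => F (0 + c * s)) = (fun s => F (s * c))); last first.
  by apply/funext => s; rewrite add0r mulrC.
rewrite (_ : (fun s => F1 (0 + c * s) * c) = (fun s => F1 (s * c) * c)); last first.
  by apply/funext => s; rewrite add0r [c * s]mulrC.
rewrite (_ : (fun s => F2 (0 + c * s) * c ^+ 2 + F1 (0 + c * s) * 0) =
    (fun s => F2 (s * c) * c ^+ 2)) //.
by apply/funext => s; rewrite add0r [c * s]mulrC mulr0 addr0.
Qed.

(** The function [(r^2 + |x|^2)^(-k)] is the fundamental solution [|x|^(2-n)] regularised at scale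
    [r], and its Laplacian is exactly [- 2 n k r^2 (r^2 + |x|^2)^(-k-2)]. Derivatives of the cutoff
    are supported where [rho^2 / 4 <= s <= rho^2], which gives an error of size [rho^(-n)] uniformly
    in [r]. *)
Lemma bubble_profile (n : nat) (k : R) : (3 <= n)%N -> k = (n%:R - 2) / 2 ->
  exists2 C0 : R, 0 < C0 & forall r rho : R, 0 < r -> 0 < rho -> exists b1 b2 : R -> R,
  C2on [set s | 0 <= s]
    (fun s => pcut (s * rho ^- 2) * (r ^+ 2 + s) `^ (- k)) b1 b2 /\
  forall s, 0 <= s ->
    `|rlap n b1 b2 s + pcut (s * rho ^- 2) *
        (2 * n%:R * k * r ^+ 2 * (r ^+ 2 + s) `^ (- k - 1 - 1))| <=
    (if rho ^+ 2 / 4 <= s <= rho ^+ 2 then C0 * (rho ^+ 2) `^ (- k - 1) else 0).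
Proof.
move=> n3 kE; have n3' : 3 <= n%:R :> R by rewrite ler_nat.
have k0 : 0 < k by rewrite kE; lra.
have K4 : 0 < 4 `^ (k + 1) :> R by rewrite powR_gt0.
have [B B0 HB] := pcut_deriv_bnd.
have n4 : 0 < 2 * n%:R + 4 :> R by lra.
have k8 : 0 < 8 * k by lra.
have h1 : 0 < (2 * n%:R + 4) * B by exact: mulr_gt0.
have h2 : 0 < 8 * k * B by exact: mulr_gt0.
have h12 : 0 < (2 * n%:R + 4) * B + 8 * k * B by exact: addr_gt0.
exists (((2 * n%:R + 4) * B + 8 * k * B) * 4 `^ (k + 1)); first exact: mulr_gt0.
move=> r rho r0 rho0; set c := rho ^- 2.
have c0 : 0 < c by rewrite invr_gt0 exprn_gt0.
have r20 : 0 < r ^+ 2 by rewrite exprn_gt0.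
have HP := C2on_rescale (ltW c0) C2on_pcut.
have HG := C2on_shift_powR (- k) r20.
have H := C2on_mul HP HG.
eexists; eexists; split; first exact: H.
move=> s s0; rewrite /rlap.
have t0 : 0 < r ^+ 2 + s by rewrite ltr_wpDr.
rewrite !powRB1 //; set g := (r ^+ 2 + s) `^ (- k).
have g0 : 0 < g by rewrite powR_gt0.
set p := pcut _; set p1 := pcut1 _; set p2 := pcut2 _.
have -> : 2 * n%:R * (p1 * c * g + p * (- k * (g / (r ^+ 2 + s)))) +
  4 * s * (p2 * c ^+ 2 * g + 2 * (p1 * c * (- k * (g / (r ^+ 2 + s)))) +
  p * (- k * ((- k - 1) * (g / (r ^+ 2 + s) / (r ^+ 2 + s))))) +
  p * (2 * n%:R * k * r ^+ 2 * (g / (r ^+ 2 + s) / (r ^+ 2 + s))) =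
  g * c * (2 * n%:R * p1 + 4 * (s * c) * p2) - 8 * k * (s / (r ^+ 2 + s)) * c * g * p1.
  (* This relation makes all terms without derivatives of [pcut] cancel. *)
  have -> : n%:R = 2 * k + 2 by rewrite kE; field.
  move: (r ^+ 2) t0 => q t0; field; exact: lt0r_neq0.
have [sc|sc] := boolP (_ <= s <= _); last first.
  suff [-> ->] : p1 = 0 /\ p2 = 0 by rewrite !mulr0 addr0 subr0 mulr0 normr0.
  move: sc; rewrite negb_and -!ltNge => /orP[sc|sc].
    have h : s * c <= 1 / 4.
      by rewrite /c ler_pdivrMr ?exprn_gt0 // ltW // mulrC mulrA mulr1.
    by have [_ ? ?] := pcut_eq1 h.
  have h : 1 <= s * c.
    by rewrite /c ler_pdivlMr ?exprn_gt0 // mul1r ltW.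
  by have [_ ? ?] := pcut_eq0 h.
case/andP: sc => s1 s2.
have sc0 : 0 <= s * c by rewrite mulr_ge0 // ltW.
have sc1 : s * c <= 1 by rewrite /c ler_pdivrMr ?exprn_gt0 // mul1r.
have [_ P1 P2] := HB _ sc0.
have rho20 : 0 < rho ^+ 2 by rewrite exprn_gt0.
have gc : g * c <= 4 `^ (k + 1) * (rho ^+ 2) `^ (- k - 1).
  have h : g <= (rho ^+ 2 / 4) `^ (- k).
    apply: powR_le; [by rewrite divr_gt0|by rewrite (le_trans s1) // lerDr ltW|].
    by rewrite oppr_le0 ltW.
  rewrite powRB1 // /c mulrA ler_pM2r ?invr_gt0 //; apply: le_trans h _.
  rewrite powRM ?invr_ge0 ?(ltW rho20) // [leLHS]mulrC ler_pM2r ?powR_gt0 //.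
  rewrite -powR_inv1 // -powRrM mulN1r opprK.
  by rewrite ler_powR //; [rewrite ler1n|rewrite lerDl].
have st0 : 0 <= s / (r ^+ 2 + s) by rewrite divr_ge0 // ltW.
have st1 : s / (r ^+ 2 + s) <= 1 by rewrite ler_pdivrMr // mul1r lerDr ltW.
have gc0 : 0 <= g * c by rewrite mulr_ge0 // ltW.
have np : `|2 * n%:R * p1 + 4 * (s * c) * p2| <= (2 * n%:R + 4) * B.
  apply: le_trans (ler_normD _ _) _.
  rewrite (_ : (2 * n%:R + 4) * B = 2 * n%:R * B + 4 * B); last by ring.
  apply: lerD.
    rewrite normrM ger0_norm; last by lra.
    by rewrite ler_wpM2l //; lra.
  have -> : `|4 * (s * c) * p2| = 4 * (s * c * `|p2|).
    by rewrite normrM (ger0_norm (mulr_ge0 _ sc0)) ?mulrA.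
  by rewrite ler_pM2l // -[leRHS]mul1r; apply: ler_pM.
have nq : `|8 * k * (s / (r ^+ 2 + s)) * p1| <= 8 * k * B.
  rewrite normrM ger0_norm; last by rewrite mulr_ge0 // ltW.
  apply: ler_pM => //; first by rewrite mulr_ge0 // ltW.
  by rewrite -[leRHS]mulr1 ler_wpM2l // ltW.
apply: (@le_trans _ _ (g * c * ((2 * n%:R + 4) * B + 8 * k * B))).
  rewrite [X in `|X|](_ : _ = g * c * (2 * n%:R * p1 + 4 * (s * c) * p2 -
    8 * k * (s / (r ^+ 2 + s)) * p1)); last by ring.
  rewrite normrM (ger0_norm gc0) ler_wpM2l //.
  by apply: le_trans (ler_normB _ _) _; exact: lerD.
move: h12; set K := _ + _ => h12.
by rewrite -(mulrA K) [leLHS](mulrC _ K) ler_pM2l // -powRB1.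
by rewrite exprn_gt0.
Qed.

End Profiles.

(** * Subharmonic cutoffs and test functions *)

Section TestProfile.
Context {R : realType}.

Lemma powR_sqr_Nhalf (c : R) : 0 < c -> (c ^+ 2) `^ (- 2^-1) = c^-1.
Proof.
move=> c0; rewrite -powR_mulrn ?ltW // -powRrM mulrN divff // powRN powRr1 // ltW //.
Qed.

(** As a function of [s = |x|^2], its Laplacian is [c (a^2 + s)^(-5/2) (n a^2 + (n - 3) s)], so it
    is subharmonic and radially nondecreasing in every dimension at least [3], with the same
    exponent. It is smooth at the origin because [a > 0]. *)
Definition subh (c a : R) (s : R) : R := 1 + (- c) * (a ^+ 2 + s) `^ (- 2^-1).
Definition subh1 (c a : R) (s : R) : R :=
  - c * (- 2^-1 * (a ^+ 2 + s) `^ (- 2^-1 - 1)).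
Definition subh2 (c a : R) (s : R) : R :=
  - c * (- 2^-1 * ((- 2^-1 - 1) * (a ^+ 2 + s) `^ (- 2^-1 - 1 - 1))).

Section Subh.
Variables (c a : R).
Hypotheses (a0 : 0 < a) (c0 : 0 < c) (ca : c <= 2 * a).

Lemma C2on_subh : C2on [set s | 0 <= s] (subh c a) (subh1 c a) (subh2 c a).
Proof. by apply: C2on_scale; apply: C2on_shift_powR; rewrite exprn_gt0. Qed.

Variable (s : R).
Hypothesis (s0 : 0 <= s).
Let A := (a ^+ 2 + s) `^ (- 2^-1).
Let t := a ^+ 2 + s.

Let a20 : 0 < a ^+ 2. Proof. by rewrite exprn_gt0. Qed.
Let t0 : 0 < t. Proof. by rewrite /t ltr_wpDr. Qed.
Let A0 : 0 < A. Proof. by rewrite powR_gt0. Qed.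

Let cAle : c * A <= c / a.
Proof.
rewrite ler_pM2l // -powR_sqr_Nhalf //; apply: powR_le => //.
by rewrite lerDl.
Qed.

Let cA2 : c * A <= 2.
Proof. by apply: le_trans cAle _; rewrite ler_pdivrMr. Qed.

Lemma subh1E : subh1 c a s = c * A / t / 2.
Proof. by rewrite /subh1 !powRB1 // -/A -/t; field; exact: lt0r_neq0. Qed.

Lemma subh2E : subh2 c a s = - (3 / 4) * (c * A / t / t).
Proof. by rewrite /subh2 !powRB1 // -/A -/t; field; exact: lt0r_neq0. Qed.

Lemma subh_rlap (n : nat) :
  rlap n (subh1 c a) (subh2 c a) s = c * A / t / t * (n%:R * a ^+ 2 + (n%:R - 3) * s).
Proof.
by rewrite /rlap subh1E subh2E /t; field; apply: lt0r_neq0.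
Qed.

Lemma subh1_ge0 : 0 <= subh1 c a s.
Proof. by rewrite subh1E !divr_ge0 ?mulr_ge0 // ltW. Qed.

Lemma subh_rlap_ge (n : nat) : (3 <= n)%N ->
  3 * a ^+ 2 * (c * A / t / t) <= rlap n (subh1 c a) (subh2 c a) s.
Proof.
move=> n3; have n3' : 3 <= n%:R :> R by rewrite ler_nat.
rewrite subh_rlap mulrC ler_wpM2l //; first by rewrite !divr_ge0 ?mulr_ge0 // ltW.
rewrite -[leLHS]addr0 lerD //; last by rewrite mulr_ge0 // subr_ge0.
by rewrite ler_pM2r.
Qed.

Lemma subh_rlap_ge0 (n : nat) : (3 <= n)%N -> 0 <= rlap n (subh1 c a) (subh2 c a) s.
Proof.
move=> n3; apply: le_trans (subh_rlap_ge n3).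
have h : 0 <= c * A / t / t by rewrite !divr_ge0 ?mulr_ge0 // ltW.
by rewrite mulr_ge0 // mulr_ge0 // ltW.
Qed.

Lemma subh_itv : 1 - c / a <= subh c a s <= 1.
Proof.
rewrite /subh -/A mulNr; apply/andP; split; first by rewrite lerD2l lerN2.
by rewrite gerDl oppr_le0 mulr_ge0 // ltW.
Qed.

Lemma subh_bnd : 1 / 4 <= s -> `|subh1 c a s| <= 4 /\ `|subh2 c a s| <= 24.
Proof.
move=> s4; have t4 : t^-1 <= 4.
  have h : 1 / 4 <= t by rewrite /t (le_trans s4) // lerDr ltW.
  by rewrite -[4]invrK lef_pV2 ?posrE //; move: h; lra.
have ti : 0 < t^-1 by rewrite invr_gt0.
have cA0 : 0 < c * A by exact: mulr_gt0.
have h1 : c * A / t <= 2 * 4 by apply: ler_pM => //; exact: ltW.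
have h0 : 0 <= c * A / t by rewrite mulr_ge0 // ltW.
have h2 : c * A / t / t <= 2 * 4 * 4 by apply: ler_pM => //; exact: ltW.
have h3 : 0 <= c * A / t / t by rewrite mulr_ge0 // ltW.
rewrite subh1E subh2E mulNr normrN; split.
  by rewrite ger0_norm; move: h0 h1; lra.
by rewrite ger0_norm; move: h3 h2; move: (c * A / t / t) => z; lra.
Qed.
End Subh.

(* A subharmonic cutoff: zero for [s <= 3 d^2], bounded below for [s >= 15 d^2]. It
   removes the singularity of a superharmonic function at 0 from the test integrals. *)
Definition zeta (d s : R) := cubep (subh (2 * d) d s).

Lemma zeta_itv (d s : R) : 0 < d -> 0 <= s -> 0 <= zeta d s <= 1.
Proof.
move=> d0 s0; have d2 : 0 < 2 * d by rewrite mulr_gt0.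
have /andP[_ h] := subh_itv d0 d2 s0.
by have [+ _ _] := cubep_bnd h ler01; rewrite expr1n.
Qed.

Lemma zeta_eq0 (d s : R) : 0 < d -> 0 <= s -> s <= 3 * d ^+ 2 -> zeta d s = 0.
Proof.
move=> d0 s0 sd; have d2 : 0 < 2 * d by rewrite mulr_gt0.
suff h : subh (2 * d) d s <= 0 by have [] := cubep_le0 h.
rewrite /subh mulNr subr_le0 mulrC -ler_pdivrMr // div1r -(powR_sqr_Nhalf d2).
apply: powR_le => //; first by rewrite ltr_wpDr // exprn_gt0.
by rewrite exprMn; move: sd; move: (d ^+ 2) => q; rewrite expr2; lra.
Qed.

(** From [s = 15 d^2] on the square root of [d^2 + s] is at least [4 d], hence [subh] is at least
    [1/2] and its cube at least [1/8]. *)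
Lemma zeta_ge (d s : R) : 0 < d -> 15 * d ^+ 2 <= s -> 1 / 8 <= zeta d s.
Proof.
move=> d0 sd; have d4 : 0 < 4 * d by rewrite mulr_gt0.
have h : 1 / 2 <= subh (2 * d) d s.
  have h : (d ^+ 2 + s) `^ (- 2^-1) <= (4 * d)^-1.
    rewrite -(powR_sqr_Nhalf d4); apply: powR_le; rewrite ?exprn_gt0 //.
    by rewrite exprMn; move: sd; move: (d ^+ 2) => q; rewrite expr2; lra.
  have d2 : 0 < 2 * d by rewrite mulr_gt0.
  rewrite -(ler_pM2l d2) in h; rewrite /subh mulNr.
  suff : 2 * d / (4 * d) = 1 / 2 by move: h; move: (2 * d * _ `^ _) => z; lra.
  by field; exact: lt0r_neq0.
have h0 : 0 <= subh (2 * d) d s by move: h; lra.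
have [e _ _] := cubep_ge0 h0; rewrite /zeta e.
have : (1 / 2) ^+ 3 <= subh (2 * d) d s ^+ 3 by rewrite ler_pXn2r // nnegrE.
by apply: le_trans; rewrite !exprS expr0; lra.
Qed.

Lemma normM_le (x y a b : R) : `|x| <= a -> `|y| <= b -> `|x * y| <= a * b.
Proof. by move=> xa yb; rewrite normrM; apply: ler_pM. Qed.

Lemma normD_le (x y a b : R) : `|x| <= a -> `|y| <= b -> `|x + y| <= a + b.
Proof. by move=> xa yb; apply: le_trans (ler_normD _ _) _; exact: lerD. Qed.

(** Where [pcut] is [1], the Laplacian of [zeta phi] is [zeta] times that of [phi] plus two
    nonnegative terms: [phi] times the Laplacian of [zeta], and twice the product of the gradients
    of two radially nondecreasing functions. On the annulus everything is bounded independently of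
    [phi] and [d], which is what allows [d] to tend to [0]. *)
Lemma test_profile (n : nat) : (3 <= n)%N -> exists2 C : R, 0 < C &
  forall phi phi1 phi2, C2on [set s | 0 <= s] phi phi1 phi2 ->
  (forall s, 0 <= s -> [/\ 0 <= phi s <= 1, 0 <= phi1 s & 0 <= rlap n phi1 phi2 s]) ->
  (forall s, 1 / 4 <= s -> `|phi1 s| <= 4 /\ `|phi2 s| <= 24) ->
  forall d, 0 < d <= 1 -> exists psi1 psi2,
  [/\ C2on [set s | 0 <= s] (fun s => pcut s * (zeta d s * phi s)) psi1 psi2,
      forall s, 0 <= s -> s <= 1 / 4 ->
        zeta d s * rlap n phi1 phi2 s <= rlap n psi1 psi2 s &
      forall s, 1 / 4 <= s -> `|rlap n psi1 psi2 s| <= if s <= 1 then C else 0].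
Proof.
move=> n3; have [B B0 HB] := @pcut_deriv_bnd R.
have n0 : 0 <= n%:R :> R by [].
(* The formula for [rlap] of the triple product, with each factor replaced by a bound on the
   annulus: [1, B, B] for [pcut] and its derivatives, [1, 12, 168] for [zeta], [1, 4, 24] for [phi].
   The last line of the proof rebuilds it term by term. *)
exists (2 * n%:R * (B * (1 * 1) + 1 * (12 * 1 + 1 * 4)) +
  4 * 1 * (B * (1 * 1) + 2 * (B * (12 * 1 + 1 * 4)) +
    1 * (168 * 1 + 2 * (12 * 4) + 1 * 24))).
  have nB : 0 <= n%:R * B by rewrite mulr_ge0 // ltW.
  by move: nB n0 B0; move: (n%:R * B) => z; nra.
move=> phi phi1 phi2 Hphi Hphi0 Hphib d /andP[d0 d1].
have d2 : 0 < 2 * d by rewrite mulr_gt0.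
have Hz : C2on [set s | 0 <= s] (zeta d)
    (fun s => cubep1 (subh (2 * d) d s) * subh1 (2 * d) d s)
    (fun s => cubep2 (subh (2 * d) d s) * subh1 (2 * d) d s ^+ 2 +
      cubep1 (subh (2 * d) d s) * subh2 (2 * d) d s).
  exact: C2on_comp C2on_cubep (@C2on_subh (2 * d) d d0) (fun _ _ => I).
set z1 := (X in C2on _ _ X _) in Hz; set z2 := (X in C2on _ _ _ X) in Hz.
have Hp : C2on [set s | 0 <= s] (@pcut R) pcut1 pcut2.
  by apply: C2on_sub C2on_pcut.
have H := C2on_mul Hp (C2on_mul Hz Hphi).
eexists; eexists; split; first exact: H.
- move=> s s0 s4; have [p0 p1 p2] := pcut_eq1 s4.
  have [/andP[f0 _] f1 f2] := Hphi0 _ s0.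
  rewrite /rlap p0 p1 p2.
  have z10 : 0 <= z1 s.
    apply: mulr_ge0; last exact: subh1_ge0.
    by have [_ /andP[]] := cubep_bnd (ler_norm (subh (2 * d) d s)) (normr_ge0 _).
  (* [zeta] is a convex nondecreasing function of a subharmonic function. *)
  have rz : 0 <= rlap n z1 z2 s.
    have -> : rlap n z1 z2 s =
        cubep1 (subh (2 * d) d s) * rlap n (subh1 (2 * d) d) (subh2 (2 * d) d) s +
        4 * (s * (cubep2 (subh (2 * d) d s) * subh1 (2 * d) d s ^+ 2)).
      by rewrite /rlap /z1 /z2; ring.
    have [_ /andP[c1 _] /andP[c2 _]] := cubep_bnd (ler_norm (subh (2 * d) d s)) (normr_ge0 _).
    apply: addr_ge0; first by rewrite mulr_ge0 // subh_rlap_ge0.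
    by rewrite mulr_ge0 // mulr_ge0 // mulr_ge0 // sqr_ge0.
  have -> : 2 * n%:R * (0 * (zeta d s * phi s) + 1 * (z1 s * phi s + zeta d s * phi1 s)) +
    4 * s * (0 * (zeta d s * phi s) + 2 * (0 * (z1 s * phi s + zeta d s * phi1 s)) +
      1 * (z2 s * phi s + 2 * (z1 s * phi1 s) + zeta d s * phi2 s)) =
    zeta d s * (2 * n%:R * phi1 s + 4 * s * phi2 s) + (phi s * rlap n z1 z2 s +
      8 * (s * (z1 s * phi1 s))).
    by rewrite /rlap; ring.
  rewrite lerDl addr_ge0 // mulr_ge0 //.
  by rewrite mulr_ge0 // mulr_ge0.
move=> s s4; have s0 : 0 <= s by move: s4; lra.
case: ifPn => s1; last first.
  have [p0 p1 p2] : [/\ pcut s = 0, pcut1 s = 0 & pcut2 s = 0].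
    by apply: pcut_eq0; rewrite ltW // ltNge.
  by rewrite /rlap p0 p1 p2 !mul0r !mulr0 !addr0 !mulr0 addr0 normr0.
have [/andP[f0 f0'] _ _] := Hphi0 _ s0; have [f1 f2] := Hphib _ s4.
have f0n : `|phi s| <= 1 by rewrite ger0_norm.
have [_ P1 P2] := HB _ s0.
have P0 : `|pcut s| <= 1 by have /andP[? ?] := pcut_bnd s; rewrite ger0_norm.
have Z0 : `|zeta d s| <= 1 by have /andP[? ?] := zeta_itv d0 s0; rewrite ger0_norm.
have /andP[_ w1] := subh_itv d0 d2 s0.
have [_ /andP[c1 c1'] /andP[c2 c2']] := cubep_bnd w1 ler01.
have [h1 h2] := subh_bnd d0 d2 (lexx _) s0 s4.
have C1 : `|cubep1 (subh (2 * d) d s)| <= 3.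
  by rewrite ger0_norm //; move: c1'; rewrite expr1n mulr1.
have C2 : `|cubep2 (subh (2 * d) d s)| <= 6.
  by rewrite ger0_norm //; move: c2'; rewrite mulr1.
have Z1 : `|z1 s| <= 12.
  by apply: le_trans (normM_le C1 h1) _; lra.
have Z2 : `|z2 s| <= 168.
  apply: le_trans (normD_le (normM_le C2 (normM_le h1 h1)) (normM_le C1 h2)) _; lra.
have two : `|2 : R| <= 2 by rewrite ger0_norm.
have nn : `|2 * n%:R : R| <= 2 * n%:R by rewrite ger0_norm // mulr_ge0.
have s1n : `|4 * s| <= 4 * 1.
  by rewrite ger0_norm ?mulr_ge0 // ler_pM2l.
have G0 := normM_le Z0 f0n.
have G1 := normD_le (normM_le Z1 f0n) (normM_le Z0 f1).
have G2 := normD_le (normD_le (normM_le Z2 f0n) (normM_le two (normM_le Z1 f1)))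
  (normM_le Z0 f2).
have F1 := normD_le (normM_le P1 G0) (normM_le P0 G1).
have F2 := normD_le (normD_le (normM_le P2 G0) (normM_le two (normM_le P1 G1)))
  (normM_le P0 G2).
exact: normD_le (normM_le nn F1) (normM_le s1n F2).
Qed.

End TestProfile.

(** * Superharmonic functions on a punctured ball *)

Section MeasureHelpers.
Context {R : realType} {n : nat}.
Local Notation V := ('rV[R]_n).
Local Open Scope ereal_scope.

Lemma leb_set1 (y : V) : (0 < n)%N -> leb [set y] = 0.
Proof.
move=> n0; have -> : [set y] = box (fun i => [set y 0%R i] : set (measurableTypeR R)).
  by apply/seteqP; split => x /= => [-> //|H]; apply/rowP => i; exact: H.
rewrite leb_box => [|i]; last exact: measurable_set1.
rewrite (bigD1 (Ordinal n0)) //= lebesgue_measure_set1 mul0e //.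
Qed.

Lemma measurable_set1_rV (y : V) : measurable [set y].
Proof.
have -> : [set y] = box (fun i => [set y 0%R i] : set (measurableTypeR R)).
  by apply/seteqP; split => x /= => [-> //|H]; apply/rowP => i; exact: H.
by apply: measurable_box => i; exact: measurable_set1.
Qed.

(** Removes the singularity of a kernel before pointwise estimates: there [powR] with a negative
    exponent has the value [0], which would spoil monotonicity in the distance. *)
Lemma ge0_integralD1 (A : set V) (y : V) (g : V -> \bar R) : (0 < n)%N ->
  measurable A -> measurable_fun A g -> (forall x, A x -> 0 <= g x) ->
  \int[leb]_(x in A) g x = \int[leb]_(x in A `\` [set y]) g x.
Proof.
move=> n0 mA mg g0; apply: ge0_negligible_integral => //.
  exact: measurable_set1_rV.
exact: leb_set1.
Qed.

Lemma measurable_set_lt (f : V -> R) (b : R) : continuous f ->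
  measurable [set x | (f x < b)%R].
Proof.
move=> cf; have := continuous_measurable_rV cf measurableT (measurable_itv `]-oo, b[).
by rewrite setTI set_itvE.
Qed.

Lemma measurable_set_le (f : V -> R) (b : R) : continuous f ->
  measurable [set x | (f x <= b)%R].
Proof.
move=> cf; have := continuous_measurable_rV cf measurableT (measurable_itv `]-oo, b]).
by rewrite setTI set_itvE.
Qed.

Lemma measurable_set_ge (f : V -> R) (b : R) : continuous f ->
  measurable [set x | (b <= f x)%R].
Proof.
move=> cf; have := continuous_measurable_rV cf measurableT (measurable_itv `[b, +oo[).
by rewrite setTI set_itvE.
Qed.

Lemma norm_continuous_shift (y : V) : continuous (fun x : V => `|x - y|%R).
Proof.
move=> x; apply: continuous_comp; last exact: norm_continuous.
by apply: continuousB; [exact: cvg_id|exact: cst_continuous].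
Qed.

Lemma integrable_compact (K D : set V) (g : V -> R) : compact K -> open D ->
  K `<=` D -> (forall x, D x -> {for x, continuous g}) ->
  leb.-integrable K (EFin \o g).
Proof.
move=> cK oD KD cg.
have clK : closed K by apply: compact_closed => //; exact: norm_hausdorff.
have mK : measurable K.
  have oK : open (~` K) by rewrite openC.
  by rewrite -[K]setCK; apply: measurableC; exact: open_measurable_rV.
have [M [_ KM]] := compact_bounded cK.
have KM1 x : K x -> (`|x| <= `|M| + 1)%R.
  by move=> Kx; apply: (KM _ _ _ Kx); rewrite (le_lt_trans (ler_norm M)) // ltrDl.
apply: measurable_bounded_integrable => //.
- have M2 : (0 < `|M| + 2)%R by rewrite ltr_wpDl.
  apply: (@le_lt_trans _ _ (leb (cube (0 : V) (`|M| + 2)%R))).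
    apply: le_measure; rewrite ?inE //; first exact: measurable_cube.
    by move=> x /KM1 h; rewrite /cube /= subr0; apply: le_lt_trans h _; rewrite ltrD2l ltr1n.
  by rewrite [X in X < _]leb_cube // ltry.
- apply: measurable_funS (continuous_in_measurable_rV oD cg) => //.
  exact: open_measurable_rV.
have : compact [set g x | x in K].
  apply: continuous_compact => //; apply: continuous_in_subspaceT => x.
  by rewrite inE => /KD; exact: cg.
move=> /compact_bounded [B [Br HB]]; exists B; split => // b Bb x Kx.
by apply: HB => //; exists x.
Qed.

Lemma patch_indic (A : set V) (g : V -> R) :
  (EFin \o g) \_ A = (fun x => (g x * \1_A x)%R%:E).
Proof.
apply/funext => x; rewrite patchE indicE.
by case: (boolP (x \in A)) => _; rewrite ?mulr1 ?mulr0.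
Qed.

(** The way Green's formula is exploited: [h] is a multiple of the difference of its two integrands,
    so it has integral [0]; the pointwise inequality then bounds the useful quantity [g1] on [A] by
    the error [g2] on [B]. *)
Lemma integral_comparison (A B : set V) (g1 g2 h : V -> R) :
  measurable A -> measurable B -> measurable_fun A g1 ->
  (forall x, A x -> (0 <= g1 x)%R) -> leb.-integrable B (EFin \o g2) ->
  leb.-integrable setT (EFin \o h) -> \int[leb]_x (h x)%:E = 0 ->
  (forall x, (g1 x * \1_A x <= h x + g2 x * \1_B x)%R) ->
  \int[leb]_(x in A) (g1 x)%:E <= \int[leb]_(x in B) (g2 x)%:E.
Proof.
move=> mA mB mg1 g10 ig2 ih h0 H.
have ig2' : leb.-integrable setT (fun x => (g2 x * \1_B x)%R%:E).
  by rewrite -patch_indic; exact: (integrable_mkcond _ mB).1.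
have mg1' : measurable_fun setT (fun x => (g1 x * \1_A x)%R%:E).
  rewrite -patch_indic; apply: (measurable_restrict _ mA measurableT).1.
  by rewrite setTI; apply/measurable_EFinP.
have g1ge0 x : (0 <= g1 x * \1_A x)%R.
  rewrite indicE; case: (boolP (x \in A)); rewrite ?mulr1 ?mulr0 // inE.
  exact: g10.
rewrite integral_mkcond [leRHS]integral_mkcond.
have -> : (fun x => (g1 x)%:E) \_ A = (fun x => (g1 x * \1_A x)%R%:E) := patch_indic A g1.
have -> : (fun x => (g2 x)%:E) \_ B = (fun x => (g2 x * \1_B x)%R%:E) := patch_indic B g2.
apply: (@le_trans _ _ (\int[leb]_x ((EFin \o h) x + (g2 x * \1_B x)%R%:E))).
  apply: ge0_le_integral => //.
  - by move=> x _; rewrite lee_fin.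
  - apply: emeasurable_funD; [exact: (measurable_int leb ih)|exact: (measurable_int leb ig2')].
  - by move=> x _; rewrite /= -EFinD lee_fin.
rewrite (integralD measurableT ih ig2').
have -> : \int[leb]_x (EFin \o h) x = 0 by exact: h0.
by rewrite add0e.
Qed.

End MeasureHelpers.

Ltac clra := clear; intros; lra.

Section Superharmonic.
Context {R : realType} {n : nat}.
Local Notation V := ('rV[R]_n).

Lemma enorm_lt2 (x : V) : sq x < 4 -> enorm x < 2.
Proof.
move=> x4; rewrite -(ltr_pXn2r (isT : (0 < 2)%N)) ?nnegrE ?sqrtr_ge0 //.
by rewrite sqr_sqrtr ?sq_ge0 // (lt_le_trans x4) // expr2; lra.
Qed.

Lemma sq_eq0 : sq (0 : V) = 0.
Proof. by rewrite /sq big1 // => i _; rewrite mxE expr0n. Qed.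

Lemma laplacian_near0 (g : V -> R) (d : R) :
  (forall x, `|x| < d -> g x = 0) -> forall x, `|x| < d -> laplacian g x = 0.
Proof.
move=> g0 x xd; rewrite /laplacian big1 // => i _.
exact: (partial_vanishing i (partial_vanishing i g0) xd).
Qed.

Lemma continuous_laplacian (u : V -> R) : Ck 2 [set x | x != 0] u ->
  forall x, x != 0 -> {for x, continuous (fun x => - laplacian u x)}.
Proof.
move=> /Ck2P[_ H] x x0.
have c : {for x, continuous (laplacian u)}.
  by apply: continuous_at_sum => i; have [_ _ /(_ i)[_]] := H i; exact.
exact: (continuousN c).
Qed.

Lemma open_neq0 : open [set x : V | x != 0].
Proof.
rewrite openE => x /= x0; rewrite /interior /=.
exact: near_neq0.
Qed.

Lemma measurable_neq0 : measurable [set x : V | x != 0].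
Proof. by apply: open_measurable_rV; exact: open_neq0. Qed.

Lemma measurable_continuous_neq0 (f : V -> R) : (forall x, x != 0 -> {for x, continuous f}) ->
  measurable_fun setT f.
Proof.
move=> cf; have -> : setT = [set x : V | x != 0] `|` [set 0].
  by apply/seteqP; split => // x _; have [->|h] := eqVneq x 0; [right|left].
apply/measurable_funU; [exact: measurable_neq0|exact: measurable_set1_rV|split].
  exact: continuous_in_measurable_rV open_neq0 cf.
move=> _ Y mY; have [Yu|Yu] := pselect (Y (f 0)).
  rewrite (_ : _ `&` _ = [set 0]); first exact: measurable_set1_rV.
  by apply/seteqP; split => x [] // -> /=.
rewrite (_ : _ `&` _ = set0); first exact: measurable0.
by apply/seteqP; split => x [] // -> /=.
Qed.

Lemma closed_ball_sq (b : R) (y : V) : compact [set x : V | sq (x - y) <= b].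
Proof.
have [b0|b0] := ltP b 0.
  rewrite (_ : mkset _ = set0); first exact: compact0.
  by apply/seteqP; split => x //= h; have := le_lt_trans h b0; rewrite ltNge sq_ge0.
apply: bounded_closed_compact.
  exists (`|y| + Num.sqrt b); split; first exact: num_real.
  move=> M yM x /= xb; apply: le_trans (ltW yM).
  rewrite -(subrK y x) addrC; apply: le_trans (ler_normD _ _) _; rewrite lerD2l.
  by apply: le_trans (norm_le_enorm _) _; rewrite ler_sqrt.
have cs : continuous (fun x : V => sq (x - y)).
  move=> x; apply: continuous_comp; last exact: sq_continuous.
  by apply: continuousB; [exact: cvg_id|exact: cst_continuous].
rewrite (_ : mkset _ = (fun x : V => sq (x - y)) @^-1` [set s | s <= b]) //.
by apply: closed_comp; [move=> x _; exact: cs|exact: closed_le].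
Qed.

Lemma integral_scaled_diff (c : R) (A B : V -> R) :
  leb.-integrable setT (EFin \o A) -> leb.-integrable setT (EFin \o B) ->
  (\int[leb]_x (A x)%:E = \int[leb]_x (B x)%:E)%E ->
  leb.-integrable setT (EFin \o (fun x => c * (A x - B x))) /\
  (\int[leb]_x (c * (A x - B x))%:E = 0)%E.
Proof.
move=> iA iB AB; have iAB := integrableB measurableT iA iB; split.
  exact: (integrableZl measurableT c iAB).
transitivity (c%:E * \int[leb]_x ((EFin \o A) x - (EFin \o B) x))%E.
  exact: (integralZl measurableT iAB c).
rewrite (integralB measurableT iA iB) AB subee ?mule0 //.
exact: (integrable_fin_num measurableT iB).
Qed.

(** Here [pcut (sq x)] is [1]; its derivatives live on [annulus], which stays away from [0], so that
    [u] is integrable over it. *)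
Definition punctured_quarter : set V := [set x | x != 0 /\ sq x < 1 / 4].

Definition annulus : set V := [set x | 1 / 4 <= sq x <= 1].

Lemma annulusE : annulus = [set x | 1 / 4 <= sq x] `&` [set x | sq x <= 1].
Proof.
apply/seteqP; split=> x; first by case/andP; split.
by move=> [? ?]; rewrite /annulus /=; apply/andP; split.
Qed.

Lemma measurable_annulus : measurable annulus.
Proof.
rewrite annulusE; apply: measurableI.
  exact: measurable_set_ge sq_continuous.
exact: measurable_set_le sq_continuous.
Qed.

Lemma annulus_neq0 x : annulus x -> x != 0.
Proof.
move=> /andP[h _]; apply: contraTN h => /eqP ->.
by rewrite sq_eq0 -ltNge; lra.
Qed.

Lemma integrable_annulus (u : V -> R) : (forall x, x != 0 -> {for x, continuous u}) ->
  leb.-integrable annulus (EFin \o u).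
Proof.
move=> cu; apply: (@integrable_compact _ _ _ [set x | x != 0]) => //.
- apply: (@subclosed_compact _ annulus [set x : V | sq (x - 0) <= 1]).
  + rewrite annulusE; apply: closedI.
      rewrite (_ : mkset _ = sq @^-1` [set s | 1 / 4 <= s]) //.
      by apply: closed_comp; [move=> x _; exact: sq_continuous|exact: closed_ge].
    rewrite (_ : mkset _ = sq @^-1` [set s | s <= 1]) //.
    by apply: closed_comp; [move=> x _; exact: sq_continuous|exact: closed_le].
  + exact: closed_ball_sq.
  + by move=> x /andP[_ h] /=; rewrite subr0.
- exact: open_neq0.
- exact: annulus_neq0.
Qed.

End Superharmonic.

Local Opaque pcut zeta laplacian partial sq rlap.

(** With the test function [pcut zeta phi], Green's formula has only nonnegative contributions
    inside [punctured_quarter], and on the annulus an error of at most [C u]. The resulting bound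
    depends neither on [phi], which is left free for later choices, nor on the inner cutoff. *)
Lemma superharmonic_test (R : realType) (n : nat) (u : 'rV[R]_n -> R) : (3 <= n)%N ->
  Ck 2 [set x | x != 0] u -> (forall x, x != 0 -> 0 <= u x) ->
  (forall x, x != 0 -> enorm x < 2 -> 0 <= - laplacian u x) ->
  exists2 K : R, 0 <= K &
  forall phi phi1 phi2, C2on [set s | 0 <= s] phi phi1 phi2 ->
  (forall s, 0 <= s -> [/\ 0 <= phi s <= 1, 0 <= phi1 s & 0 <= rlap n phi1 phi2 s]) ->
  (forall s, 1 / 4 <= s -> `|phi1 s| <= 4 /\ `|phi2 s| <= 24) ->
  (\int[leb]_(x in punctured_quarter)
    (- laplacian u x * phi (sq x) + u x * rlap n phi1 phi2 (sq x))%:E <= K%:E)%E.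
Proof.
move=> n3 C2u u0 f0; pose V := 'rV[R]_n.
have cu x : x != 0 -> {for x, continuous u} by have /Ck2P[+ _] := C2u; apply.
have [C C0 HC] := @test_profile R n n3.
have C8 : 0 <= 8 * C by rewrite mulr_ge0 // ltW.
have ig2 : leb.-integrable annulus (EFin \o (fun x => 8 * C * u x)).
  exact: (integrableZl measurable_annulus (8 * C) (integrable_annulus cu)).
have g20 : (0 <= \int[leb]_(x in annulus) (8 * C * u x)%:E)%E.
  apply: integral_ge0 => x ax; rewrite lee_fin mulr_ge0 // u0 //.
  exact: annulus_neq0.
exists (fine (\int[leb]_(x in annulus) (8 * C * u x)%:E)); first exact: fine_ge0.
move=> phi phi1 phi2 Hphi Hphi0 Hphib.
rewrite fineK; last exact: (integrable_fin_num measurable_annulus ig2).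
pose W x := - laplacian u x * phi (sq x) + u x * rlap n phi1 phi2 (sq x).
have cphi (x : V) : {for x, continuous (fun x : V => phi (sq x))}.
  have [h _ _] := Hphi _ (sq_ge0 x).
  by apply: continuous_comp; [exact: sq_continuous|exact: is_derive_continuous h].
have crlap (x : V) : {for x, continuous (fun x : V => rlap n phi1 phi2 (sq x))}.
  have [_ h c2] := Hphi _ (sq_ge0 x).
  have c1 := is_derive_continuous h.
  have cs : {for x, continuous (fun x : V => sq x)} by exact: sq_continuous.
  apply: continuous_atD; apply: continuous_atM.
  - exact: cst_continuous.
  - exact: continuous_comp.
  - by apply: continuous_atM => //; exact: cst_continuous.
  - exact: continuous_comp.
have cW x : x != 0 -> {for x, continuous W}.
  move=> x0; apply: continuous_atD; apply: continuous_atM => //.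
    exact: continuous_laplacian.
  exact: cu.
have mW := continuous_in_measurable_rV open_neq0 cW.
have W0 x : x != 0 -> sq x < 1 / 4 -> 0 <= W x.
  move=> x0 x4; have [/andP[a _] _ b] := Hphi0 _ (sq_ge0 x).
  apply: addr_ge0; apply: mulr_ge0 => //; last exact: u0.
  have x2 : sq x < 4 by move: x4; clra.
  exact: (f0 _ x0 (enorm_lt2 x2)).
(* With [d = 1 / (k + 1)] this is where [zeta d] is at least [1/8]; the sets increase to
   [punctured_quarter]. *)
pose A (k : nat) : set V := [set x | 15 * k.+1%:R^-1 ^+ 2 <= sq x] `&` [set x | sq x < 1 / 4].
have mA k : measurable (A k).
  apply: measurableI; first exact: measurable_set_ge sq_continuous.
  exact: measurable_set_lt sq_continuous.
have A0 k x : A k x -> x != 0.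
  move=> [/= h _]; apply: contraTN h => /eqP ->; rewrite sq_eq0 -ltNge.
  by rewrite mulr_gt0 // exprn_gt0 // invr_gt0.
have AE : \bigcup_k A k = punctured_quarter.
  apply/seteqP; split => x.
    by move=> [k _ Akx]; split; [exact: A0 Akx|case: Akx].
  move=> [x0 x4].
  have sx : 0 < sq x by apply: lt_le_trans (norm_le_sq x); rewrite exprn_gt0 // normr_gt0.
  have [k _ /(_ _ (leqnn k)) kx] := near_infty_natSinv_lt (PosNum (divr_gt0 sx (ltr0n R 15))).
  exists k => //; split => //=; rewrite -ler_pdivlMl // mulrC.
  apply: le_trans (ltW kx); rewrite expr2 ger_pMr ?invr_gt0 //.
  by rewrite invf_le1 // ler1n.
have mAW k : measurable_fun (A k) (EFin \o W).
  apply/measurable_EFinP; apply: measurable_funS mW; first exact: measurable_neq0.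
  exact: A0.
have bnd k : (\int[leb]_(x in A k) (W x)%:E <= \int[leb]_(x in annulus) (8 * C * u x)%:E)%E.
  set d : R := k.+1%:R^-1.
  have d0 : 0 < d by rewrite invr_gt0.
  have d1 : d <= 1 by rewrite invf_le1 // ler1n.
  have d01 : 0 < d <= 1 by rewrite d0.
  have [psi1 [psi2 [Hpsi psiin psiout]]] := HC phi phi1 phi2 Hphi Hphi0 Hphib d d01.
  pose psi (x : V) := pcut (sq x) * (zeta d (sq x) * phi (sq x)).
  have psiE : psi = (fun x : V => (fun s => pcut s * (zeta d s * phi s)) (sq (x - 0))).
    by apply/funext => x; rewrite /psi subr0.
  have Cpsi : Ck 2 setT psi by rewrite psiE; exact: (Ck2_radial 0 Hpsi).
  have Lpsi x : laplacian psi x = rlap n psi1 psi2 (sq x).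
    by rewrite psiE (laplacian_radial 0 Hpsi) subr0.
  (* The sup norm ball of radius [d / n] lies in the Euclidean ball of radius [d], where [zeta d]
     vanishes. *)
  have nd0 : 0 < d / n%:R by rewrite divr_gt0 // ltr0n (leq_trans _ n3).
  have psi0 x : `|x| < d / n%:R -> psi x = 0.
    move=> xd; rewrite /psi zeta_eq0 ?sq_ge0 //; first by rewrite mul0r mulr0.
    apply: (@le_trans _ _ (d ^+ 2)); last by rewrite ler_peMl ?sqr_ge0 // ler1n.
    have h : enorm x <= d.
      apply: le_trans (enorm_le_norm x) _; rewrite mulrC -ler_pdivlMr; first exact: ltW.
      by rewrite ltr0n (leq_trans _ n3).
    by rewrite -[leLHS]sqr_sqrtr ?sq_ge0 // ler_pXn2r // ?nnegrE ?sqrtr_ge0 // ltW.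
  have psiM x : 1 < `|x| -> psi x = 0.
    move=> x1; rewrite /psi; have [|-> _ _] := @pcut_eq0 R (sq x); last by rewrite mul0r.
    by apply: le_trans (norm_le_sq x); rewrite -[leLHS](expr1n _ 2) ler_pXn2r // ?nnegrE // ltW.
  have psix x : psi x = pcut (sq x) * (zeta d (sq x) * phi (sq x)) by [].
  clearbody psi; have psi00 : psi 0 = 0 by apply: psi0; rewrite normr0.
  have L0 : laplacian psi 0 = 0 by apply: (laplacian_near0 psi0); rewrite normr0.
  have [i1 i2 E] := green nd0 C2u Cpsi psi0 psiM.
  (* The factor [8] compensates the lower bound [1/8] of [zeta] on [A k]. *)
  pose h x := 8 * (u x * laplacian psi x - psi x * laplacian u x).
  have [ih h0] := integral_scaled_diff 8 i1 i2 E.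
  apply: (integral_comparison (mA k) measurable_annulus _ _ ig2 ih h0).
  - by apply/measurable_EFinP; exact: mAW.
  - by move=> x Ax; apply: W0; [exact: A0 Ax|case: Ax].
  move=> x; rewrite !indicE.
  have [->|x0] := eqVneq x 0.
    have -> : (0 : V) \in A k = false by apply/negP; rewrite inE => /A0; rewrite eqxx.
    have -> : (0 : V) \in annulus = false.
      by apply/negP; rewrite inE => /annulus_neq0; rewrite eqxx.
    by rewrite /h L0 psi00 !mulr0 mul0r subrr mulr0 addr0.
  have psige0 : 0 <= psi x.
    have [/andP[p0 _] /andP[z0 _]] := (pcut_bnd (sq x), zeta_itv d0 (sq_ge0 x)).
    have [/andP[q0 _] _ _] := Hphi0 _ (sq_ge0 x); rewrite psix.
    exact: (mulr_ge0 p0 (mulr_ge0 z0 q0)).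
  have [x4|x4] := ltP (sq x) (1 / 4).
    have -> : x \in annulus = false by apply/negP; rewrite inE => /andP[]; rewrite leNgt x4.
    rewrite mulr0 addr0 /h Lpsi.
    have hp := psiin _ (sq_ge0 x) (ltW x4).
    have /andP[z0 z1] := zeta_itv d0 (sq_ge0 x).
    have ux := u0 _ x0.
    have hz : zeta d (sq x) * W x <= u x * rlap n psi1 psi2 (sq x) - psi x * laplacian u x.
      rewrite /W psix; have [-> _ _] := pcut_eq1 (ltW x4).
      have := ler_wpM2l ux hp.
      move: (zeta d (sq x)) (phi (sq x)) (rlap n phi1 phi2 (sq x)) (u x) (laplacian u x) => a b c e g.
      by move: (rlap n psi1 psi2 (sq x)); clra.
    have Wx := W0 _ x0 x4.
    have zW : 0 <= zeta d (sq x) * W x := mulr_ge0 z0 Wx.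
    have zd : x \in A k -> W x <= 8 * (zeta d (sq x) * W x).
      rewrite inE => -[xA _]; have := ler_wpM2r Wx (zeta_ge d0 xA).
      by move: (zeta d (sq x) * W x) (W x); clra.
    move: hz zW zd; move: (u x * rlap n psi1 psi2 (sq x) - psi x * laplacian u x)
      (zeta d (sq x) * W x) (W x) => q z w hz zW.
    case: (x \in A k) => [/(_ isT)|_]; rewrite ?mulr1 ?mulr0; move: hz zW; clra.
  have -> : x \in A k = false by apply/negP; rewrite inE => -[_ /=]; rewrite ltNge x4.
  rewrite mulr0; have := psiout _ x4; case: ifPn => x1.
    have -> : x \in annulus by rewrite inE /annulus /= x4.
    rewrite mulr1 ler_norml => /andP[lo _]; rewrite /h Lpsi.
    have x2 : sq x < 4 by move: x1; clra.
    have fx := f0 _ x0 (enorm_lt2 x2).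
    have := ler_wpM2l (u0 _ x0) lo; have := mulr_ge0 psige0 fx.
    move: (psi x) (u x) (laplacian u x) (rlap n psi1 psi2 (sq x)); clra.
  rewrite normr_le0 => /eqP e0; rewrite /h Lpsi e0 mulr0.
  have x1' : 1 <= sq x by apply: ltW; rewrite ltNge; exact: x1.
  have [p0 _ _] := pcut_eq0 x1'.
  rewrite psix p0 !mul0r subrr mulr0 add0r.
  exact: (mulr_ge0 (mulr_ge0 C8 (u0 _ x0)) (ler0n _ _)).
(* Monotone convergence along [A k] removes the inner cutoff. *)
have H := @ge0_nondecreasing_set_cvg_integral _ _ _ A (EFin \o W) leb.
have /H : {homo A : k l / (k <= l)%N >-> (k <= l)%O}.
  move=> k l kl; rewrite subsetEset => x [/= h1 h2]; split => //=.
  apply: le_trans h1; rewrite ler_pM2l // ler_pXn2r // ?nnegrE ?invr_ge0 //.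
  by rewrite lef_pV2 ?posrE // ler_nat.
move=> /(_ mA mAW) {}H.
rewrite AE in H.
have /H cv : forall k x, A k x -> (0 <= (EFin \o W) x)%E.
  by move=> k x Ax; rewrite lee_fin; apply: W0; [exact: A0 Ax|case: Ax].
rewrite -/W -(cvg_lim (@ereal_hausdorff R) cv).
by apply: lime_le; [apply/cvg_ex; eexists; exact: cv|exact: nearW].
Qed.

Lemma rlapE (R : realType) n (F1 F2 : R -> R) s :
  rlap n F1 F2 s = 2 * n%:R * F1 s + 4 * s * F2 s.
Proof. by []. Qed.

Local Opaque pcut zeta laplacian partial sq rlap enorm.

Definition pcube {R : realType} {n : nat} (r : R) : set 'rV[R]_n :=
  [set x | x != 0 /\ `|x| < r].

Lemma measurable_pcube (R : realType) (n : nat) (r : R) : measurable (@pcube R n r).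
Proof.
have -> : pcube r = [set x : 'rV[R]_n | x != 0] `&` cube 0 r.
  by apply/seteqP; split => x [x0]; rewrite /cube /= subr0.
by apply: measurableI; [exact: measurable_neq0|exact: measurable_cube].
Qed.

Lemma measurable_punctured_quarter (R : realType) (n : nat) :
  measurable (@punctured_quarter R n).
Proof.
have -> : @punctured_quarter R n = [set x | x != 0] `&` [set x | sq x < 1 / 4].
  by apply/seteqP; split => x [].
apply: measurableI; first exact: measurable_neq0.
exact: measurable_set_lt sq_continuous.
Qed.

(** Explains the recurring radius [(2 n)^-1]: the Euclidean norm is at most [n] times the sup norm,
    so such a cube lies in the Euclidean ball of radius [1/2]. *)
Lemma pcube_sub_quarter (R : realType) (n : nat) (r : R) : (0 < n)%N ->
  0 < r -> r <= (2 * n%:R)^-1 -> @pcube R n r `<=` @punctured_quarter R n.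
Proof.
move=> n0 r0 rn x [x0 xr]; split => //.
have n0' : 0 < n%:R :> R by rewrite ltr0n.
have n1 : 1 <= n%:R :> R by rewrite ler1n.
have nr : 2 * n%:R * r <= 1 by rewrite -ler_pdivlMl ?mulr1 // mulr_gt0.
have nx : 2 * n%:R * `|x| < 1.
  by apply: lt_le_trans nr; rewrite ltr_pM2l // mulr_gt0.
have nx0 : 0 <= 2 * n%:R * `|x| by rewrite mulr_ge0 // mulr_ge0.
have sx : (2 * n%:R * `|x|) ^+ 2 < 1 by rewrite expr_lt1.
have h : sq x <= n%:R ^+ 2 * `|x| ^+ 2.
  apply: le_trans (sq_le_norm x) _; rewrite ler_wpM2r ?sqr_ge0 //.
  by rewrite expr2 ler_peMr // ltW.
have e : (2 * n%:R * `|x|) ^+ 2 = 4 * (n%:R ^+ 2 * `|x| ^+ 2) by ring.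
by move: sx h; rewrite e; move: (n%:R ^+ 2 * `|x| ^+ 2); clra.
Qed.

Lemma integral_laplacian_le (R : realType) (n : nat) (u : 'rV[R]_n -> R) : (3 <= n)%N ->
  Ck 2 [set x | x != 0] u -> (forall x, x != 0 -> 0 <= u x) ->
  (forall x, x != 0 -> enorm x < 2 -> 0 <= - laplacian u x) ->
  exists2 K : R, 0 <= K &
  (\int[leb]_(x in punctured_quarter) (- laplacian u x)%:E <= K%:E)%E.
Proof.
move=> n3 C2u u0 f0; have [K K0 HK] := superharmonic_test n3 C2u u0 f0.
exists K => //.
(* The choice [phi = 1] leaves only the mass of [- laplacian u]. *)
have H := HK _ _ _ (@C2on_affine R [set s | 0 <= s] 1 0).
have E0 s : rlap n (fun=> 0) (fun=> 0) s = 0 :> R by rewrite rlapE !mulr0 addr0.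
have H1 s : 0 <= s -> [/\ 0 <= (1 + 0 * s : R) <= 1, 0 <= (0 : R) &
    0 <= rlap n (fun=> 0) (fun=> 0) s :> R].
  by move=> _; rewrite E0 mul0r addr0 ler01 !lexx.
have H2 (s : R) : 1 / 4 <= s -> `|0 : R| <= 4 /\ `|0 : R| <= 24.
  by move=> _; rewrite normr0 !ler0n.
have <- : (\int[leb]_(x in punctured_quarter) (- laplacian u x * (1 + 0 * sq x) +
    u x * rlap n (fun=> 0) (fun=> 0) (sq x))%:E =
    \int[leb]_(x in punctured_quarter) (- laplacian u x)%:E)%E.
  by apply: eq_integral => x _; rewrite mul0r addr0 mulr1 E0 mulr0 addr0.
exact: H H1 H2.
Qed.

(** The choice [phi = 1 - r (r^2 + |x|^2)^(-1/2)]: this profile lies between [0] and [1], and its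
    Laplacian is at least a constant times [r^(-2)] on the cube of radius [r]. The constant [K] of
    [superharmonic_test] being the same for all [r], the factor [r^2] results. *)
Lemma integral_superharmonic_le (R : realType) (n : nat) (u : 'rV[R]_n -> R) : (3 <= n)%N ->
  Ck 2 [set x | x != 0] u -> (forall x, x != 0 -> 0 <= u x) ->
  (forall x, x != 0 -> enorm x < 2 -> 0 <= - laplacian u x) ->
  exists2 K : R, 0 <= K &
  forall r, 0 < r -> @pcube R n r `<=` punctured_quarter ->
  (\int[leb]_(x in pcube r) (u x)%:E <= (K * r ^+ 2)%:E)%E.
Proof.
move=> n3 C2u u0 f0; have [K K0 HK] := superharmonic_test n3 C2u u0 f0.
(* On the cube [r^2 + sq x <= m r^2], so the Laplacian of the profile is at least
   [3 / (m^3 r^2)]. *)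
pose m : R := n%:R + 1.
have m0 : 0 < m by rewrite /m ltr_wpDl.
have m3 : 0 <= m ^+ 3 / 3 by rewrite divr_ge0 // exprn_ge0 // ltW.
exists (m ^+ 3 / 3 * K); first exact: mulr_ge0.
move=> r r0 rq.
have r2 : r <= 2 * r by move: r0; clear; lra.
have Hphi s : 0 <= s -> [/\ 0 <= subh r r s <= 1, 0 <= subh1 r r s &
    0 <= rlap n (subh1 r r) (subh2 r r) s].
  move=> s0; split; [|exact: subh1_ge0|exact: subh_rlap_ge0].
  have := subh_itv r0 r0 s0.
  by rewrite divff ?subrr // gt_eqF.
have Hphib s : 1 / 4 <= s -> `|subh1 r r s| <= 4 /\ `|subh2 r r s| <= 24.
  move=> s4; apply: subh_bnd => //; apply: le_trans s4; exact: divr_ge0.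
have H := HK _ _ _ (C2on_subh r r0) Hphi Hphib.
pose W x := - laplacian u x * subh r r (sq x) + u x * rlap n (subh1 r r) (subh2 r r) (sq x).
have WK : (\int[leb]_(x in punctured_quarter) (W x)%:E <= K%:E)%E := H.
have c0 : 0 <= m ^+ 3 / 3 * r ^+ 2 by rewrite mulr_ge0 // exprn_ge0 // ltW.
have /Ck2P[cu _] := C2u.
have [Hs0 Hs1 Hs2] : [/\ forall x : 'rV[R]_n, {for x, continuous (fun x => subh r r (sq x))},
    forall x : 'rV[R]_n, {for x, continuous (fun x => subh1 r r (sq x))} &
    forall x : 'rV[R]_n, {for x, continuous (fun x => subh2 r r (sq x))}].
  split=> x; have [h1 h2 h3] := @C2on_subh R r r r0 _ (sq_ge0 x);
    apply: continuous_comp; try exact: sq_continuous.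
  - exact: is_derive_continuous h1.
  - exact: is_derive_continuous h2.
  - exact: h3.
have cW x : x != 0 -> {for x, continuous W}.
  move=> x0; apply: continuous_atD; apply: continuous_atM.
  - exact: continuous_laplacian.
  - exact: Hs0.
  - exact: cu.
  have cs : {for x, continuous (fun x : 'rV[R]_n => sq x)} by exact: sq_continuous.
  have ck (c : R) : {for x, continuous (fun _ : 'rV[R]_n => c)} by exact: cst_continuous.
  exact: (continuous_atD (continuous_atM (ck _) (Hs1 x))
    (continuous_atM (continuous_atM (ck _) cs) (Hs2 x))).
have mW := continuous_in_measurable_rV open_neq0 cW.
have mu := continuous_in_measurable_rV open_neq0 cu.
have W0 x : punctured_quarter x -> 0 <= W x.
  move=> [x0 x4]; have [/andP[a _] _ b] := Hphi _ (sq_ge0 x).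
  have x2 : sq x < 4 by move: x4; clra.
  exact: (addr_ge0 (mulr_ge0 (f0 _ x0 (enorm_lt2 x2)) a) (mulr_ge0 (u0 _ x0) b)).
have key x : pcube r x -> u x <= m ^+ 3 / 3 * r ^+ 2 * W x.
  move=> px; have [x0 x4] := rq _ px; have xr : `|x| < r by case: px.
  have [/andP[a _] _ b] := Hphi _ (sq_ge0 x).
  have x2 : sq x < 4 by move: x4; clra.
  have fx := mulr_ge0 (f0 _ x0 (enorm_lt2 x2)) a.
  have ux := u0 _ x0.
  have := subh_rlap_ge r0 r0 (sq_ge0 x) n3.
  set q := rlap _ _ _ _; set t := r ^+ 2 + sq x; set A := t `^ _ => Hq.
  have r20 : 0 < r ^+ 2 by rewrite exprn_gt0.
  have t0 : 0 < t by rewrite /t ltr_wpDr // sq_ge0.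
  have tm : t <= m * r ^+ 2.
    rewrite /t /m mulrDl mul1r addrC lerD2r; apply: le_trans (sq_le_norm x) _.
    by rewrite ler_wpM2l // ler_pXn2r // ?nnegrE // ltW.
  have Am : (m * r)^-1 <= A.
    rewrite -powR_sqr_Nhalf ?mulr_gt0 //; apply: powR_le => //.
    apply: le_trans tm _; rewrite exprMn ler_pM2r // expr2 ler_pMl //.
    by rewrite /m lerDr.
  have ti : (m * r ^+ 2)^-1 <= t^-1 by rewrite lef_pV2 ?posrE // mulr_gt0.
  have mr0 : 0 < (m * r)^-1 by rewrite invr_gt0 mulr_gt0.
  have mrr0 : 0 < (m * r ^+ 2)^-1 by rewrite invr_gt0 mulr_gt0.
  have h : r * (m * r)^-1 / (m * r ^+ 2) / (m * r ^+ 2) <= r * A / t / t.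
    apply: ler_pM; [| |apply: ler_pM|exact: ti].
    - by rewrite mulr_ge0 ?(ltW mrr0) // mulr_ge0 ?(ltW mr0) // ltW.
    - exact: ltW.
    - by rewrite mulr_ge0 ?(ltW mr0) // ltW.
    - exact: ltW.
    - by rewrite ler_pM2l.
    - exact: ti.
  have hq : 1 <= m ^+ 3 / 3 * r ^+ 2 * q.
    apply: (@le_trans _ _ (m ^+ 3 / 3 * r ^+ 2 * (3 * r ^+ 2 *
        (r * (m * r)^-1 / (m * r ^+ 2) / (m * r ^+ 2))))).
      rewrite le_eqVlt; apply/orP; left; apply/eqP; field.
      by rewrite !gt_eqF.
    rewrite ler_wpM2l //; apply: le_trans Hq; rewrite ler_wpM2l //.
    by rewrite mulr_ge0 // ltW.
  rewrite /W -/q mulrDr.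
  have := mulr_ge0 c0 fx; have := ler_wpM2l ux hq.
  rewrite mulr1 mulrCA => h1 h2; apply: (le_trans h1).
  by rewrite lerDr.
apply: (@le_trans _ _ (\int[leb]_(x in pcube r) ((m ^+ 3 / 3 * r ^+ 2)%:E * (W x)%:E))%E).
  apply: ge0_le_integral.
  - exact: measurable_pcube.
  - by move=> x [x0 _]; rewrite lee_fin u0.
  - apply/measurable_EFinP; apply: measurable_funS mu; first exact: measurable_neq0.
    by move=> x [].
  - apply: measurable_funeM; apply/measurable_EFinP; apply: measurable_funS mW.
      exact: measurable_neq0.
    by move=> x [].
  - by move=> x px; rewrite -EFinM lee_fin; exact: key.
have mWq (D : set 'rV[R]_n) : measurable D -> D `<=` [set x | x != 0] -> measurable_fun D (EFin \o W).
  move=> mD DS; apply/measurable_EFinP; apply: measurable_funS mW => //.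
  exact: measurable_neq0.
rewrite ge0_integralZl_EFin; [|exact: measurable_pcube| |
  exact: (mWq _ (measurable_pcube _) (fun x p => proj1 p))|exact: c0]; last first.
  by move=> x px; rewrite lee_fin; apply: W0; exact: rq.
apply: (@le_trans _ _ ((m ^+ 3 / 3 * r ^+ 2)%:E * \int[leb]_(x in punctured_quarter) (W x)%:E)%E).
  apply: lee_wpmul2l; first by rewrite lee_fin.
  apply: ge0_subset_integral => //; first exact: measurable_pcube.
  - exact: measurable_punctured_quarter.
  - exact: (mWq _ (@measurable_punctured_quarter R n) (fun x p => proj1 p)).
apply: (@le_trans _ _ ((m ^+ 3 / 3 * r ^+ 2)%:E * K%:E)%E).
  by apply: lee_wpmul2l; rewrite ?lee_fin.
by rewrite -EFinM lee_fin mulrAC.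
Qed.

(** * Pointwise bounds by the Newtonian potential *)

Definition ccube {R : realType} {n : nat} (c : 'rV[R]_n) (r : R) : set 'rV[R]_n :=
  [set x | `|x - c| <= r].

Lemma compact_ccube (R : realType) (n : nat) (c : 'rV[R]_n) (r : R) :
  compact (ccube c r).
Proof.
apply: bounded_closed_compact.
  exists (`|c| + r); split; first exact: num_real.
  move=> M cM x xr; apply: le_trans (ltW cM).
  by rewrite -[x](subrK c) addrC; apply: le_trans (ler_normD _ _) _; rewrite lerD2l.
rewrite (_ : ccube c r = (fun x : 'rV[R]_n => `|x - c|) @^-1` [set s | s <= r]) //.
by apply: closed_comp; [move=> x _; exact: norm_continuous_shift|exact: closed_le].
Qed.

Lemma measurable_ccube (R : realType) (n : nat) (c : 'rV[R]_n) (r : R) :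
  measurable (ccube c r).
Proof. exact: measurable_set_le (@norm_continuous_shift R n c). Qed.

Lemma integral_cst_cube (R : realType) (n : nat) (y : 'rV[R]_n) (c r : R) : 0 < r ->
  (\int[leb]_(x in cube y r) c%:E = (c * (2 * r) ^+ n)%:E)%E.
Proof.
move=> r0; rewrite (integral_cst leb (measurable_cube y r)).
by rewrite [X in (_ * X)%E]leb_cube // EFinM.
Qed.

Lemma sq_sub_gt0 (R : realType) (n : nat) (x y : 'rV[R]_n) :
  x != y -> 0 < sq (x - y).
Proof.
move=> xy; apply: lt_le_trans (norm_le_sq _).
by rewrite exprn_gt0 // normr_gt0 subr_eq0.
Qed.

Lemma powR_sqr_Nk (R : realType) (n : nat) (k r : R) : k = (n%:R - 2) / 2 -> 0 < r ->
  (r ^+ 2) `^ (- k - 1) = r ^- n.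
Proof.
move=> kE r0; rewrite -powR_mulrn ?ltW // -powRrM.
rewrite (_ : 2%:R * (- k - 1) = - n%:R); last by rewrite kE; field.
by rewrite powRN powR_mulrn // ltW.
Qed.

Lemma le_inveM (R : realType) (a c : R) (I : \bar R) : 0 < c -> (0 <= I)%E ->
  ((c * a)%:E <= I)%E -> (a%:E <= (c^-1)%:E * I)%E.
Proof.
move=> c0 I0 h; have ci : 0 < c^-1 by rewrite invr_gt0.
apply: (@le_trans _ _ ((c^-1)%:E * (c * a)%:E)%E).
  by rewrite -EFinM mulrA mulVf ?mul1r // gt_eqF.
by apply: lee_wpmul2l => //; rewrite lee_fin ltW.
Qed.

Lemma lee_factor (R : realType) (C b : R) (I J : \bar R) : 0 <= C -> 0 <= b ->
  (0 <= I)%E -> (0 <= J)%E ->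
  (I + (C * b)%:E * J <= (1 + C)%:E * (I + b%:E * J))%E.
Proof.
move=> C0 b0 I0 J0; have bJ : (0 <= b%:E * J)%E by rewrite mule_ge0.
rewrite ge0_muleDr // EFinM -muleA; apply: leeD.
  by rewrite -[leLHS]mul1e; apply: lee_wpmul2r; rewrite // lee_fin lerDl.
by apply: lee_wpmul2r; rewrite // lee_fin lerDr.
Qed.

(** On the cube of radius [r] minus the Laplacian of the bubble is comparable with [r^(-n)], the
    inverse of the volume: it acts as an approximate Dirac mass. *)
Lemma bubble_lower (R : realType) (n : nat) (k r rho s : R) : (0 < n)%N ->
  k = (n%:R - 2) / 2 -> 0 < k -> 0 < r -> 0 < rho -> 2 * n%:R * r <= rho ->
  0 <= s -> s <= n%:R * r ^+ 2 ->
  2 * n%:R * k * (n%:R + 1) `^ (- k - 1 - 1) * r ^- n <=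
  pcut (s * rho ^- 2) * (2 * n%:R * k * r ^+ 2 * (r ^+ 2 + s) `^ (- k - 1 - 1)).
Proof.
move=> n0 kE k0 r0 rho0 rn s0 sr.
have nR0 : 0 < n%:R :> R by rewrite ltr0n.
have r2 : 0 < r ^+ 2 by rewrite exprn_gt0.
have srho : s * rho ^- 2 <= 1 / 4.
  rewrite ler_pdivrMr ?exprn_gt0 //; apply: le_trans sr _.
  have : (2 * n%:R * r) ^+ 2 <= rho ^+ 2.
    by rewrite ler_pXn2r ?nnegrE ?(ltW rho0) // !mulr_ge0 // ltW.
  have -> : (2 * n%:R * r) ^+ 2 = 4 * (n%:R * (n%:R * r ^+ 2)) :> R by ring.
  have : n%:R * r ^+ 2 <= n%:R * (n%:R * r ^+ 2) :> R.
    by rewrite ler_peMl ?ler1n // mulr_ge0 // ltW.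
  by move: (n%:R * (n%:R * r ^+ 2)) (n%:R * r ^+ 2) (rho ^+ 2); clra.
have [-> _ _] := pcut_eq1 srho; rewrite mul1r.
have c0 : 0 < 2 * n%:R * k by rewrite !mulr_gt0.
rewrite -(powR_sqr_Nk kE r0) -!(mulrA (2 * n%:R * k)) ler_pM2l //.
have -> : (n%:R + 1) `^ (- k - 1 - 1) * (r ^+ 2) `^ (- k - 1) =
    r ^+ 2 * ((n%:R + 1) * r ^+ 2) `^ (- k - 1 - 1).
  rewrite powRM ?(ltW r2) ?addr_ge0 // mulrCA; congr (_ * _).
  by rewrite [in RHS]powRB1 // mulrCA divff ?mulr1 // gt_eqF.
rewrite ler_pM2l //; apply: powR_le.
- by rewrite ltr_wpDr.
- by rewrite mulrDl mul1r addrC lerD2r.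
- by move: k0; clra.
Qed.

(** Green's formula against a bubble of width [r] centred at [y] and cut off at [rho]. Its Laplacian
    collects a multiple of [u y] near [y], while the cutoff error gives the average of [u]. One
    small [r] suffices, without a limit, because [u >= u y / 2] near [y] is enough for an inequality
    up to a constant. *)
Lemma representation (R : realType) (n : nat) (k : R) : (3 <= n)%N ->
  k = (n%:R - 2) / 2 -> exists2 C : R, 0 < C & forall u : 'rV[R]_n -> R,
  Ck 2 [set x | x != 0] u -> (forall x, x != 0 -> 0 <= u x) ->
  forall y rho, 0 < rho ->
  (forall x, ccube y rho x -> x != 0 /\ 0 <= - laplacian u x) ->
  ((u y)%:E <= C%:E *
    (\int[leb]_(x in ccube y rho `\` [set y]) (sq (x - y) `^ (- k) * - laplacian u x)%:E +
     (rho ^- n)%:E * \int[leb]_(x in ccube y rho) (u x)%:E))%E.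
Proof.
move=> n3 kE; have [C0 C00 HC] := @bubble_profile R n k n3 kE.
have n0 : (0 < n)%N by exact: leq_trans n3.
have nR0 : 0 < n%:R :> R by rewrite ltr0n.
have n3' : 3 <= n%:R :> R by rewrite ler_nat.
have k0 : 0 < k by rewrite kE divr_gt0 // subr_gt0 (lt_le_trans _ n3') // ltr_nat.
pose m : R := (n%:R + 1) `^ (- k - 1 - 1).
have m0 : 0 < m by rewrite powR_gt0 // ltr_wpDl.
(* The product of [u y / 2], of the lower bound [2 n k m r^(-n)] and of the volume [(2 r)^n] is [c]
   times [u y]. *)
pose c := n%:R * k * m * 2 ^+ n.
have c0 : 0 < c by rewrite !mulr_gt0 // exprn_gt0.
exists (c^-1 * (1 + C0)); first by rewrite mulr_gt0 ?invr_gt0 // (addr_gt0 ltr01 C00).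
move=> u C2u u0 y rho rho0 Q0.
have Qn0 x : ccube y rho x -> x != 0 by move=> /Q0[].
have yQ : ccube y rho y by rewrite /ccube /= subrr normr0 ltW.
have y0 : y != 0 := Qn0 _ yQ.
have /Ck2P[cu _] := C2u.
have cf := continuous_laplacian C2u.
pose I1 := (\int[leb]_(x in ccube y rho `\` [set y])
  (sq (x - y) `^ (- k) * - laplacian u x)%:E)%E.
pose I2 := (\int[leb]_(x in ccube y rho) (u x)%:E)%E.
have mQ := @measurable_ccube R n y rho.
have mQy : measurable (ccube y rho `\` [set y]).
  by apply: measurableD => //; exact: measurable_set1_rV.
have I10 : (0 <= I1)%E.
  apply: integral_ge0 => x [/Q0[_ fx] _]; rewrite lee_fin mulr_ge0 //; exact: powR_ge0.
have I20 : (0 <= I2)%E by apply: integral_ge0 => x /Qn0 x0; rewrite lee_fin u0.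
have rn0 : 0 < rho ^- n by rewrite invr_gt0 exprn_gt0.
suff main : ((c * u y)%:E <= I1 + (C0 * rho ^- n)%:E * I2)%E.
  have J0 : (0 <= I1 + (C0 * rho ^- n)%:E * I2)%E.
    by rewrite adde_ge0 // mule_ge0 // lee_fin mulr_ge0 // ltW.
  apply: le_trans (le_inveM c0 J0 main) _.
  rewrite (EFinM c^-1) -muleA; apply: lee_wpmul2l; first by rewrite lee_fin invr_ge0 ltW.
  exact: lee_factor (ltW C00) (ltW rn0) I10 I20.
have [uy0|uy0] := leP (u y) 0.
  apply: (@le_trans _ _ 0%E).
    by rewrite lee_fin -(mulr0 c) ler_pM2l.
  by rewrite adde_ge0 // mule_ge0 // lee_fin mulr_ge0 // ltW.
(* [2 n r <= rho] places the cube of radius [r] in the plateau of the cutoff. *)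
have [r [r0 rn ur]] : exists r : R, [/\ 0 < r, 2 * n%:R * r <= rho &
    forall x, `|x - y| < r -> u y / 2 <= u x].
  have hy : u y / 2 < u y by rewrite ltr_pdivrMr // ltr_pMr // ltr1n.
  have : \forall x \near y, u y / 2 < u x by exact: (cvgr_gt _ (cu _ y0) _ hy).
  move=> /nbhs_ballP[e /= e0 He].
  have e1 : 0 < rho / (2 * n%:R) by rewrite divr_gt0 // mulr_gt0.
  exists (Num.min e (rho / (2 * n%:R))); split.
  - by rewrite lt_min e0.
  - by rewrite mulrC -ler_pdivlMr ?mulr_gt0 // ge_min lexx orbT.
  - move=> x; rewrite lt_min => /andP[xe _]; apply/ltW/He.
    by rewrite mx_norm_ball /ball_ /= distrC.
have rrho : r <= rho.
  apply: le_trans rn; rewrite ler_peMl ?(ltW r0) //.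
  by apply: mulr_ege1; rewrite ler1n.
have [b1 [b2 [Hb Eb]]] := HC r rho r0 rho0.
have rho2 : 0 < rho ^+ 2 by rewrite exprn_gt0.
have r2 : 0 < r ^+ 2 by rewrite exprn_gt0.
pose psi (x : 'rV[R]_n) := pcut (sq (x - y) * rho ^- 2) * (r ^+ 2 + sq (x - y)) `^ (- k).
have Cpsi : Ck 2 setT psi := Ck2_radial y Hb.
have Lpsi x : laplacian psi x = rlap n b1 b2 (sq (x - y)).
  by rewrite (laplacian_radial y Hb).
have psix x : psi x = pcut (sq (x - y) * rho ^- 2) * (r ^+ 2 + sq (x - y)) `^ (- k) by [].
clearbody psi.
have out x : rho < `|x - y| -> rho ^+ 2 < sq (x - y).
  move=> h; apply: lt_le_trans (norm_le_sq _).
  by rewrite ltr_pXn2r // nnegrE // ltW.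
have p0 x : rho < `|x - y| -> pcut (sq (x - y) * rho ^- 2) = 0.
  move=> /out h; have h1 : 1 <= sq (x - y) * rho ^- 2.
    by rewrite ler_pdivlMr // mul1r ltW.
  by have [] := pcut_eq0 h1.
have psi0 x : rho < `|x - y| -> psi x = 0 by move=> /p0 h; rewrite psix h mul0r.
have Lpsi0 x : rho < `|x - y| -> laplacian psi x = 0.
  move=> h; have := Eb _ (sq_ge0 (x - y)); rewrite p0 // mul0r addr0 Lpsi.
  by rewrite ifF ?normr_le0 => [/eqP //|]; rewrite [X in _ && X]leNgt (out _ h) andbF.
(* The closed cube avoids [0], so the test function vanishes near [0], as [green] requires. *)
have ygt : rho < `|y|.
  by rewrite ltNge; apply/negP => h; have := @Qn0 0; rewrite /ccube /= sub0r normrN eqxx => /(_ h).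
have d0 : 0 < `|y| - rho by rewrite subr_gt0.
have far x : `|x| < `|y| - rho -> psi x = 0.
  move=> h; apply: psi0; rewrite distrC; apply: lt_le_trans (lerB_dist _ _).
  by rewrite ltrBrDr addrC -ltrBrDr.
have farM x : `|y| + rho < `|x| -> psi x = 0.
  move=> h; apply: psi0; apply: lt_le_trans (lerB_dist _ _).
  by rewrite ltrBrDr addrC.
have [i1 i2 E] := green d0 C2u Cpsi far farM.
have [ih h0] := integral_scaled_diff (-1) i1 i2 E.
pose g2 x := psi x * - laplacian u x + C0 * rho ^- n * u x.
have /Ck2P[cp _] := Cpsi.
have cpsi x : {for x, continuous psi} := cp x I.
have cg2 x : x != 0 -> {for x, continuous g2}.
  move=> x0; apply: continuous_atD; apply: continuous_atM.
  - exact: cpsi.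
  - exact: cf.
  - exact: cst_continuous.
  - exact: cu.
have ig2 : leb.-integrable (ccube y rho) (EFin \o g2).
  apply: (integrable_compact (@compact_ccube R n y rho) open_neq0) => //.
pose c1 := u y / 2 * (2 * n%:R * k * m * r ^- n).
have rn'0 : 0 < r ^- n by rewrite invr_gt0 exprn_gt0.
have B0 : 0 <= 2 * n%:R * k * m * r ^- n.
  exact: (mulr_ge0 (mulr_ge0 (mulr_ge0 (mulr_ge0 (ler0n _ _) (ltW nR0)) (ltW k0)) (ltW m0)) (ltW rn'0)).
have c10 : 0 <= c1 by exact: mulr_ge0 (divr_ge0 (ltW uy0) (ler0n _ _)) B0.
have mA := measurable_cube y r.
have psige x : 0 <= psi x.
  rewrite psix; have /andP[h _] := pcut_bnd (sq (x - y) * rho ^- 2).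
  exact: (mulr_ge0 h (powR_ge0 _ _)).
have key x : c1 * \1_(cube y r) x <=
    -1 * (u x * laplacian psi x - psi x * laplacian u x) + g2 x * \1_(ccube y rho) x.
  rewrite !indicE; have [xQ|xQ] := leP `|x - y| rho; last first.
    have -> : x \in cube y r = false.
      apply/negP; rewrite inE /cube /= => h; have := lt_trans xQ h.
      by rewrite ltNge rrho.
    have -> : x \in ccube y rho = false by apply/negP; rewrite inE /ccube /= leNgt xQ.
    by rewrite (Lpsi0 _ xQ) (psi0 _ xQ) !mulr0 mul0r subrr mulr0 addr0.
  have -> : x \in ccube y rho by rewrite inE.
  have x0 : x != 0 := Qn0 _ xQ; have ux := u0 _ x0.
  rewrite mulr1 /g2.
  pose P := pcut (sq (x - y) * rho ^- 2) *
      (2 * n%:R * k * r ^+ 2 * (r ^+ 2 + sq (x - y)) `^ (- k - 1 - 1)).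
  have hE : P <= C0 * rho ^- n - laplacian psi x.
    rewrite lerBrDr addrC Lpsi; apply: le_trans (ler_norm _) _.
    apply: le_trans (Eb _ (sq_ge0 (x - y))) _; rewrite (powR_sqr_Nk kE rho0).
    case: (_ <= _ <= _); [exact: lexx|exact: mulr_ge0 (ltW C00) (ltW rn0)].
  have P0 : 0 <= P.
    have /andP[h _] := pcut_bnd (sq (x - y) * rho ^- 2).
    apply: (mulr_ge0 h); apply: mulr_ge0; last exact: powR_ge0.
    exact: (mulr_ge0 (mulr_ge0 (mulr_ge0 (ler0n _ _) (ltW nR0)) (ltW k0)) (ltW r2)).
  have hu := ler_wpM2l ux hE; have hu0 := mulr_ge0 ux P0.
  have hc : x \in cube y r -> c1 <= u x * P.
    rewrite inE /cube /= => xr.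
    have sr : sq (x - y) <= n%:R * r ^+ 2.
      apply: le_trans (sq_le_norm _) _; rewrite (ler_pM2l nR0).
      rewrite -subr_ge0 subr_sqr; apply: mulr_ge0; first by rewrite subr_ge0 (ltW xr).
      exact: addr_ge0 (ltW r0) (normr_ge0 _).
    apply: ler_pM; [exact: divr_ge0 (ltW uy0) (ler0n _ _)|exact: B0|exact: ur|].
    exact: (bubble_lower n0 kE k0 r0 rho0 rn (sq_ge0 _) sr).
  have eR : -1 * (u x * laplacian psi x - psi x * laplacian u x) +
      (psi x * - laplacian u x + C0 * rho ^- n * u x) =
      u x * (C0 * rho ^- n - laplacian psi x).
    move: (u x) (psi x) (laplacian psi x) (laplacian u x) (C0 * rho ^- n); clear.
    by move=> a b p q w; ring.
  rewrite eR; apply: le_trans hu.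
  by case: (boolP (x \in cube y r)) => [/hc|_]; rewrite ?mulr1 ?mulr0.
have H := integral_comparison (g1 := fun=> c1) mA mQ (measurable_cst _)
  (fun _ _ => c10) ig2 ih h0 key.
have E1 : (\int[leb]_(x in cube y r) c1%:E = (c * u y)%:E)%E.
  rewrite (integral_cst_cube _ _ r0); congr (_%:E).
  rewrite /c1 /c exprMn; field.
  exact: (lt0r_neq0 (exprn_gt0 n r0)).
rewrite E1 in H; apply: le_trans H _.
have mono D : measurable D -> D `<=` ccube y rho -> forall g : 'rV[R]_n -> R,
    (forall x, x != 0 -> {for x, continuous g}) -> measurable_fun D (EFin \o g).
  move=> mD DQ g cg; apply/measurable_EFinP.
  apply: measurable_funS (continuous_in_measurable_rV open_neq0 cg).
    exact: measurable_neq0.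
  by move=> x /DQ/Qn0.
have f0 x : ccube y rho x -> 0 <= - laplacian u x by move=> /Q0[].
have cpf x : x != 0 -> {for x, continuous (fun x => psi x * - laplacian u x)}.
  by move=> x0; apply: continuous_atM; [exact: cpsi|exact: cf].
have -> : (\int[leb]_(x in ccube y rho) (g2 x)%:E =
    \int[leb]_(x in ccube y rho) ((psi x * - laplacian u x)%:E +
      (C0 * rho ^- n)%:E * (u x)%:E))%E.
  by apply: eq_integral => x _; rewrite -EFinM -EFinD.
have C0r : 0 <= C0 * rho ^- n by exact: mulr_ge0 (ltW C00) (ltW rn0).
rewrite ge0_integralD; first last.
- apply: measurable_funeM; exact: (mono _ mQ (fun _ h => h) _ cu).
- by move=> x xQ; rewrite -EFinM lee_fin; exact: mulr_ge0 C0r (u0 _ (Qn0 _ xQ)).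
- exact: (mono _ mQ (fun _ h => h) _ cpf).
- by move=> x xQ; rewrite lee_fin; exact: mulr_ge0 (psige x) (f0 _ xQ).
- exact: mQ.
rewrite (ge0_integralZl_EFin leb mQ); first last.
- exact: C0r.
- exact: (mono _ mQ (fun _ h => h) _ cu).
- by move=> x xQ; rewrite lee_fin; exact: u0 _ (Qn0 _ xQ).
apply: leeD; last exact: lexx.
rewrite (@ge0_integralD1 R n _ y _ n0 mQ); first last.
- by move=> x xQ; rewrite lee_fin; exact: mulr_ge0 (psige x) (f0 _ xQ).
- exact: (mono _ mQ (fun _ h => h) _ cpf).
have mK := measurable_sq_powR (- k) y.
have DQ : ccube y rho `\` [set y] `<=` ccube y rho by move=> x [].
apply: ge0_le_integral.
- exact: mQy.
- by move=> x [xQ _]; rewrite lee_fin; exact: mulr_ge0 (psige x) (f0 _ xQ).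
- exact: (mono _ mQy DQ _ cpf).
- apply/measurable_EFinP; apply: measurable_funM.
    exact: measurable_funTS.
  by apply/measurable_EFinP; exact: (mono _ mQy DQ _ cf).
- move=> x [xQ xy]; rewrite lee_fin; apply: (ler_wpM2r (f0 _ xQ)).
  rewrite psix; have /andP[_ h] := pcut_bnd (sq (x - y) * rho ^- 2).
  (* Dropping [r^2] from the base removes the auxiliary scale from the result. *)
  apply: (@le_trans _ _ ((r ^+ 2 + sq (x - y)) `^ (- k))).
    by rewrite -[leRHS]mul1r; exact: ler_wpM2r (powR_ge0 _ _) _ _ h.
  apply: powR_le; last by rewrite oppr_le0 (ltW k0).
    exact: (sq_sub_gt0 (introN eqP xy)).
  by rewrite lerDr (ltW r2).
Qed.

(** * Riesz kernels *)

Section Kernel.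
Context {R : realType} {n : nat}.
Local Notation V := ('rV[R]_n).

Definition shell (r t : R) : set V := [set y | (r <= `|y|) /\ (`|y| < t)].

Lemma measurable_shell r t : measurable (shell r t).
Proof.
have -> : shell r t = [set y | (r <= `|y|)] `&` [set y | (`|y| < t)].
  by apply/seteqP; split => x [].
by apply: measurableI; [apply: measurable_set_ge|apply: measurable_set_lt];
  exact: norm_continuous.
Qed.

Lemma measurable_norm_powR (a : R) (z : V) :
  measurable_fun setT (fun y : V => (`|y - z| `^ a)).
Proof.
apply: (measurableT_comp (measurable_powR a)).
exact: continuous_measurable_rV (@norm_continuous_shift R n z).
Qed.

Lemma measurable_norm_powRC (a : R) (z : V) :
  measurable_fun setT (fun y : V => `|z - y| `^ a).
Proof.
by under eq_fun do rewrite distrC; exact: measurable_norm_powR.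
Qed.

Lemma shell_homo (r : R) : 0 <= r ->
  {homo (fun N => shell (r * 2^-1 ^+ N) r) : k l / (k <= l)%N >-> (k <= l)%O}.
Proof.
move=> r0 k l kl; rewrite subsetEset => x [h1 h2]; split => //.
apply: le_trans h1; apply: ler_wpM2l r0 _ _ _; apply: ler_wiXn2l kl.
  by rewrite invr_ge0.
by rewrite invf_le1 // ler1n.
Qed.

Lemma bigcup_shell (r : R) : 0 < r ->
  \bigcup_N shell (r * 2^-1 ^+ N) r = pcube r.
Proof.
move=> r0; apply/seteqP; split => x.
  move=> [N _ [h1 h2]]; split => //; rewrite -normr_gt0; apply: lt_le_trans h1.
  by rewrite mulr_gt0 // exprn_gt0 // invr_gt0.
move=> [x0 xr]; have nx : 0 < `|x| / r by rewrite divr_gt0 // normr_gt0.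
have := @cvg_geometric R 1 2^-1.
rewrite ger0_norm ?invr_ge0 // invf_lt1 // ltr1n => /(_ isT) h.
have [N _ HN] := cvgr_lt _ h _ nx.
exists N => //; split => //; have /ltW := HN N (leqnn N).
by rewrite /geometric /= mul1r ler_pdivlMr // mulrC.
Qed.

Lemma shell_bound (a r t : R) : (0 < a) -> (0 < r) -> (r <= t) ->
  (\int[leb]_(y in shell r t) (`|y| `^ (- a))%:E <= (r `^ (- a) * (2 * t) ^+ n)%:E)%E.
Proof.
move=> a0 r0 rt; have t0 := lt_le_trans r0 rt.
rewrite -(integral_cst_cube 0 _ t0).
apply: (@le_trans _ _ (\int[leb]_(y in shell r t) (r `^ (- a))%:E)%E).
  apply: ge0_le_integral.
  - exact: measurable_shell.
  - by move=> y _; rewrite lee_fin powR_ge0.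
  - apply/measurable_EFinP; apply: measurable_funTS.
    have -> : (fun y : V => (`|y| `^ (- a))) = (fun y : V => (`|y - 0| `^ (- a))).
      by apply/funext => y; rewrite subr0.
    exact: measurable_norm_powR.
  - exact: measurable_cst.
  - by move=> y [ry _]; rewrite lee_fin powR_le // oppr_le0 ltW.
apply: ge0_subset_integral => //.
- exact: measurable_shell.
- exact: measurable_cube.
- by move=> y _; rewrite lee_fin powR_ge0.
- by move=> y [_ yt]; rewrite /cube /= subr0.
Qed.

Lemma measurable_norm_powR0 (a : R) :
  measurable_fun setT (fun y : V => (`|y| `^ a)).
Proof.
have -> : (fun y : V => (`|y| `^ a)) = (fun y : V => (`|y - 0| `^ a)).
  by apply/funext => y; rewrite subr0.
exact: measurable_norm_powR.
Qed.

Lemma powR_nB (t a : R) : (0 < t) -> (t `^ (n%:R - a) = t ^+ n * t `^ (- a)).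
Proof.
move=> t0; rewrite powRD; first by rewrite powR_mulrn // ltW.
by rewrite (gt_eqF t0) implybT.
Qed.

(** By induction the shell is an outer shell of ratio [2] plus a shell of outer radius [t / 2]. The
    constant [D / (1 - q)] is the fixed point of [C = q C + D], hence independent of [N]; [q < 1] is
    the condition [a < n]. *)
Lemma integral_shells (a : R) : (0 < a) -> (a < n%:R) ->
  exists2 C : R, (0 < C) & forall N (t : R), (0 < t) ->
  (\int[leb]_(y in shell (t * 2^-1 ^+ N) t) (`|y| `^ (- a))%:E <=
  (C * t `^ (n%:R - a))%:E)%E.
Proof.
move=> a0 an; pose q := (2^-1 `^ (n%:R - a)).
have na : (0 < n%:R - a) by rewrite subr_gt0.
have h0 : (0 < 2^-1 :> R) by rewrite invr_gt0.
have q0 : (0 < q) by rewrite powR_gt0.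
have q1 : (q < 1).
  rewrite (_ : 1 = 1 `^ (n%:R - a)); last (by rewrite powR1); apply: (gt0_ltr_powR na).
  - by rewrite nnegrE ltW.
  - by rewrite nnegrE ler01.
  - by rewrite invf_lt1 // ltr1n.
pose D := (2^-1 `^ (- a) * 2 ^+ n).
have D0 : (0 < D) by rewrite mulr_gt0 ?powR_gt0 // exprn_gt0.
have q1' : (0 < 1 - q) by rewrite subr_gt0.
exists (D / (1 - q)); first by rewrite divr_gt0.
elim=> [|N IH] t t0.
  rewrite expr0 mulr1 (_ : shell t t = set0).
    by rewrite integral_set0 lee_fin; exact: (mulr_ge0 (divr_ge0 (ltW D0) (ltW q1')) (powR_ge0 _ _)).
  by apply/seteqP; split => x // [h1 h2]; have := le_lt_trans h1 h2; rewrite ltxx.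
have th : (0 < t * 2^-1) by rewrite mulr_gt0.
have E : shell (t * 2^-1 ^+ N.+1) t =
    shell (t * 2^-1 * 2^-1 ^+ N) (t * 2^-1) `|` shell (t * 2^-1) t.
  apply/seteqP; split => x.
    move=> [h1 h2]; have [h|h] := leP (t * 2^-1) `|x|; first by right; split.
    by left; split => //; rewrite -mulrA -exprS.
  have hN : (2^-1 ^+ N <= 1 :> R) by rewrite exprn_ile1 ?ltW // invf_lt1 // ltr1n.
  have ht : (t * 2^-1 <= t) by rewrite ler_piMr ?ltW // invf_lt1 // ltr1n.
  move=> [[h1 h2]|[h1 h2]]; split => //.
  - by rewrite exprS mulrA.
  - exact: lt_le_trans h2 ht.
  - apply: le_trans h1; rewrite exprS mulrA ler_piMr //; exact: ltW.
rewrite E ge0_integral_setU; first last.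
- apply/disj_setPS => x [[_ h1] [h2 _]].
  by have := lt_le_trans h1 h2; rewrite ltxx.
- by move=> x _; rewrite lee_fin powR_ge0.
- by apply/measurable_EFinP; apply: measurable_funTS; exact: measurable_norm_powR0.
- exact: measurable_shell.
- exact: measurable_shell.
have ht : (t * 2^-1 <= t) by rewrite ler_piMr ?ltW // invf_lt1 // ltr1n.
apply: le_trans (leeD (IH _ th) (shell_bound a0 th ht)) _.
rewrite -EFinD lee_fin.
rewrite (powRM _ (ltW t0) (ltW h0)) -/q.
rewrite [X in (_ + X)](_ : _ = D * t `^ (n%:R - a)); last first.
  rewrite (powRM _ (ltW t0) (ltW h0)) exprMn powR_nB // /D.
  by move: (t `^ (- a)) (2^-1 `^ (- a)) (t ^+ n) (2 ^+ n) => *; ring.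
rewrite -subr_ge0.
rewrite (_ : _ - _ = 0) //.
by field; rewrite (gt_eqF q1').
Qed.

Lemma integral_norm_powR (a : R) : (0 < n)%N -> (0 < a) -> (a < n%:R) ->
  exists2 C : R, (0 < C) & forall (c : V) (t : R), (0 < t) ->
  (\int[leb]_(y in cube c t) (`|y - c| `^ (- a))%:E <= (C * t `^ (n%:R - a))%:E)%E.
Proof.
move=> n0 a0 an; have [C C0 HC] := integral_shells a0 an; exists C => // c t t0.
have cent : (\int[leb]_(y in cube (0 : V) t) (`|y| `^ (- a))%:E <=
      (C * t `^ (n%:R - a))%:E)%E.
  have mK := measurable_norm_powR0 (- a).
  rewrite (@ge0_integralD1 R n _ 0 _ n0 (measurable_cube _ _)); first last.
  - by move=> x _; rewrite lee_fin powR_ge0.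
  - by apply/measurable_EFinP; apply: measurable_funTS.
  pose A N := shell (t * 2^-1 ^+ N) t.
  have AE : cube 0 t `\` [set 0] = \bigcup_N A N.
    rewrite bigcup_shell //; apply/seteqP; split => x [h1 h2].
      by move: h1; rewrite /cube /= subr0 => h1; split => //; apply/eqP.
    by split; [rewrite /cube /= subr0|exact/eqP].
  have H := @ge0_nondecreasing_set_cvg_integral _ _ _ A
    (fun y : V => (`|y| `^ (- a))%:E) leb.
  have hom : {homo A : k l / (k <= l)%N >-> (k <= l)%O} := shell_homo (ltW t0).
  have mA k : measurable (A k) by exact: measurable_shell.
  have cv := H hom mA.
  have {}cv := cv (fun k => measurable_funTS (measurableT_comp (@EFin_measurable _ _) mK)).
  have {}cv := cv (fun k x _ => powR_ge0 _ _).
  rewrite AE -(cvg_lim (@ereal_hausdorff R) cv).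
  by apply: lime_le; [apply/cvg_ex; eexists; exact: cv|apply: nearW => N; exact: HC].
rewrite integral_mkcond.
have mi : measurable_fun setT (fun y : V => (`|y - c| `^ (- a))%:E).
  by apply/measurable_EFinP; exact: measurable_norm_powR.
rewrite -(@ge0_integral_translate R n c); first last.
- by move=> x; rewrite patchE; case: ifP => // _; rewrite lee_fin powR_ge0.
- by apply/(measurable_restrictT _ (measurable_cube c t)); exact: measurable_funTS.
apply: le_trans cent; rewrite [leRHS]integral_mkcond.
rewrite (_ : (fun x : V => _) = ((fun y : V => (`|y| `^ (- a))%:E) \_ (cube 0 t))) //.
apply/funext => x; rewrite !patchE addrK (_ : (x + c \in cube c t) = (x \in cube 0 t)) //.
by apply/idP/idP; rewrite !inE /cube /= addrK subr0.
Qed.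

(** Both factors are at most the corresponding power of the smaller base. If a base is [0], so is
    its power, and the product vanishes. *)
Lemma powRM_le_addP (a b p q : R) : 0 < a -> 0 < b -> 0 <= p -> 0 <= q ->
  p `^ (- a) * q `^ (- b) <= p `^ (- (a + b)) + q `^ (- (a + b)).
Proof.
move=> a0 b0; rewrite le_eqVlt => /orP[/eqP<-|p0].
  by move=> _; rewrite powR0 ?oppr_eq0 ?gt_eqF // mul0r addr_ge0 // powR_ge0.
rewrite le_eqVlt => /orP[/eqP<-|q0].
  by rewrite [0 `^ (- b)]powR0 ?oppr_eq0 ?gt_eqF // mulr0 addr_ge0 // powR_ge0.
have E (r : R) : 0 < r -> r `^ (- (a + b)) = r `^ (- a) * r `^ (- b).
  by move=> r0; rewrite opprD powRD // (gt_eqF r0) implybT.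
have [pq|qp] := leP p q.
  rewrite (E p p0) -[leLHS]addr0; apply: lerD; last exact: powR_ge0.
  apply: ler_wpM2l; first exact: powR_ge0.
  by apply: powR_le => //; rewrite oppr_le0 ltW.
rewrite (E q q0) -[leLHS]add0r; apply: lerD; first exact: powR_ge0.
apply: ler_wpM2r; first exact: powR_ge0.
by apply: powR_le => //; rewrite ?oppr_le0 ltW.
Qed.

(** [powRM_le_addP] reduces the product to two single kernels of exponent [a + b < n], with a bound
    that ignores the distance of the two poles. *)
Lemma integral_two_kernels (a b t : R) : (0 < n)%N -> 0 < a -> 0 < b ->
  a + b < n%:R -> 0 < t -> exists2 C : R, 0 < C & forall z x : V,
  `|z| < t -> `|x| < t ->
  (\int[leb]_(y in cube 0%R t) (`|z - y| `^ (- a) * `|x - y| `^ (- b))%:E <= C%:E)%E.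
Proof.
move=> n0 a0 b0 ab t0.
have ab0 : 0 < a + b by rewrite addr_gt0.
have [C C0 HC] := integral_norm_powR n0 ab0 ab.
have t20 : 0 < 2 * t by rewrite mulr_gt0.
exists (C * (2 * t) `^ (n%:R - (a + b)) + C * (2 * t) `^ (n%:R - (a + b))).
  by rewrite addr_gt0 // mulr_gt0 // powR_gt0.
move=> z x zt xt.
have sub (w : V) : `|w| < t -> (cube 0 t : set V) `<=` cube w (2 * t).
  move=> wt y; rewrite /cube /= subr0 => yt.
  by apply: le_lt_trans (ler_normB _ _) _; rewrite mulr_natl mulr2n ltrD.
have part (w : V) : `|w| < t ->
    (\int[leb]_(y in cube 0%R t) (`|w - y| `^ (- (a + b)))%:E <=
    (C * (2 * t) `^ (n%:R - (a + b)))%:E)%E.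
  move=> wt; apply: le_trans (HC w _ t20).
  under eq_integral do rewrite distrC.
  apply: ge0_subset_integral (sub _ wt).
  - exact: measurable_cube.
  - exact: measurable_cube.
  - by apply/measurable_EFinP; apply: measurable_funTS; exact: measurable_norm_powR.
  - by move=> y _; rewrite lee_fin powR_ge0.
rewrite EFinD; apply: le_trans (leeD (part z zt) (part x xt)).
rewrite -ge0_integralD; first last.
- by apply/measurable_EFinP; apply: measurable_funTS; exact: measurable_norm_powRC.
- by move=> y _; rewrite lee_fin powR_ge0.
- by apply/measurable_EFinP; apply: measurable_funTS; exact: measurable_norm_powRC.
- by move=> y _; rewrite lee_fin powR_ge0.
- exact: measurable_cube.
apply: ge0_le_integral.
- exact: measurable_cube.
- by move=> y _; rewrite lee_fin mulr_ge0 ?powR_ge0.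
- by apply/measurable_EFinP; apply: measurable_funTS; apply: measurable_funM; exact: measurable_norm_powRC.
- apply/measurable_EFinP; apply: measurable_funTS; apply: measurable_funD; exact: measurable_norm_powRC.
- move=> y _; rewrite -EFinD lee_fin; exact: powRM_le_addP.
Qed.

Lemma measurable_sub_powR (a : R) :
  measurable_fun setT (fun p : V * V => `|p.2 - p.1| `^ a).
Proof.
apply: (measurableT_comp (measurable_powR a)).
apply: (measurableT_comp (continuous_measurable_rV (@norm_continuous R V))).
apply/measurable_fun_rVP => i.
rewrite (_ : (fun _ => _) = (fun p : V * V => p.2 0 i - p.1 0 i)); last first.
  by apply/funext => p; rewrite !mxE.
apply: measurable_funB.
  by apply: (measurableT_comp (measurable_coord i)); exact: measurable_snd.
by apply: (measurableT_comp (measurable_coord i)); exact: measurable_fst.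
Qed.

Lemma measurable_kernel_pair (a : R) (f g : V -> R) :
  measurable_fun setT f -> measurable_fun setT g ->
  measurable_fun setT (fun p : V * V => (`|p.2 - p.1| `^ a * f p.2 * g p.1)%:E).
Proof.
move=> mf mg; apply/measurable_EFinP; apply: measurable_funM.
  apply: measurable_funM; first exact: measurable_sub_powR.
  exact: (measurableT_comp mf measurable_snd).
exact: (measurableT_comp mg measurable_fst).
Qed.

(** Exchanging the integrals lets [g] be integrated against the kernel first; afterwards only the
    mass of [f] matters. The inner bound is asked only where [f] is nonzero because it will hold for
    bounded [z] only. *)
Lemma integral_kernel_tonelli (a : R) (f g : V -> R) (K M : R) : 0 <= K ->
  measurable_fun setT f -> measurable_fun setT g ->
  (forall x, 0 <= f x) -> (forall x, 0 <= g x) ->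
  (forall z, f z != 0 ->
     (\int[leb]_y (`|z - y| `^ a * g y)%:E <= K%:E)%E) ->
  (\int[leb]_z (f z)%:E <= M%:E)%E ->
  (\int[leb]_y ((\int[leb]_z (`|z - y| `^ a * f z)%:E) * (g y)%:E) <= (K * M)%:E)%E.
Proof.
move=> K0 mf mg f0 g0 HK HM.
pose F (p : V * V) := (`|p.2 - p.1| `^ a * f p.2 * g p.1)%:E.
have F0 p : (0 <= F p)%E by rewrite lee_fin !mulr_ge0 // powR_ge0.
have mF : measurable_fun setT F by exact: measurable_kernel_pair.
have -> : (\int[leb]_y ((\int[leb]_z (`|z - y| `^ a * f z)%:E) * (g y)%:E) =
    \int[leb]_y \int[leb]_z F (y, z))%E.
  apply: eq_integral => y _; rewrite /F /=.
  under [RHS]eq_integral do rewrite EFinM.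
  rewrite ge0_integralZr //.
  - apply/measurable_EFinP/measurable_funM => //.
    exact: measurable_norm_powR.
  - by move=> z _; rewrite lee_fin mulr_ge0 // powR_ge0.
  - by rewrite lee_fin.
rewrite fubini_tonelli //.
apply: (@le_trans _ _ (\int[leb]_z (K%:E * (f z)%:E))%E); last first.
  rewrite ge0_integralZl //; last first.
  - by move=> z _; rewrite lee_fin.
  - by apply/measurable_EFinP.
  by rewrite EFinM; apply: lee_wpmul2l.
apply: ge0_le_integral => //.
- by move=> z _; apply: integral_ge0.
- have mF' : measurable_fun setT (fun p : V * V => F (p.2, p.1)).
    by apply: (measurableT_comp mF); apply: measurable_fun_pair;
      [exact: measurable_snd|exact: measurable_fst].
  exact: (@measurable_fun_fubini_tonelli_F _ _ V V R leb _ mF' (fun p => F0 _)).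
- by apply: measurable_funeM; apply/measurable_EFinP.
- move=> z _; have [fz|fz] := eqVneq (f z) 0.
    rewrite fz mule0 (eq_integral (cst 0%E)) ?integral0 // => y _.
    by rewrite /F /= fz mulr0 mul0r.
  rewrite muleC; apply: le_trans (lee_wpmul2l _ (HK z fz)); last by rewrite lee_fin.
  rewrite -ge0_integralZl //.
  - rewrite le_eqVlt; apply/orP; left; apply/eqP; apply: eq_integral => y _.
    rewrite /F /= -EFinM; congr (_%:E); ring.
  - by apply/measurable_EFinP/measurable_funM => //; exact: measurable_norm_powRC.
  - by move=> y _; rewrite lee_fin mulr_ge0 // powR_ge0.
  - by rewrite lee_fin.
Qed.
End Kernel.

(** * Boundedness of the convolution near the origin *)

Lemma pcube_enorm_lt2 (R : realType) (n : nat) (x : 'rV[R]_n) : (0 < n)%N ->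
  pcube (2 * n%:R)^-1 x -> enorm x < 2.
Proof.
move=> n0 xr; have [|_ h] := @pcube_sub_quarter R n (2 * n%:R)^-1 n0 _ (lexx _) x xr.
  by rewrite invr_gt0 mulr_gt0 // ltr0n.
by apply: enorm_lt2; apply: lt_trans h _; lra.
Qed.

Lemma measurable_pcube_continuous (R : realType) (n : nat) (r : R) (g : 'rV[R]_n -> R) :
  (forall x, x != 0 -> {for x, continuous g}) -> measurable_fun (pcube r) g.
Proof.
move=> cg; apply: measurable_funS (continuous_in_measurable_rV open_neq0 cg).
  exact: measurable_neq0.
by move=> x [].
Qed.

Lemma powR_sqr_norm (R : realType) (n : nat) (x : 'rV[R]_n) (k : R) : 0 < k -> x != 0 ->
  sq x `^ (- k) <= `|x| `^ (- (2 * k)).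
Proof.
move=> k0 x0; have nx : 0 < `|x| by rewrite normr_gt0.
have -> : `|x| `^ (- (2 * k)) = (`|x| ^+ 2) `^ (- k).
  rewrite -powR_mulrn ?normr_ge0 // -powRrM; congr (_ `^ _).
  by rewrite mulrN.
apply: powR_le; [exact: exprn_gt0|exact: norm_le_sq|by rewrite oppr_le0 ltW].
Qed.

(** [representation] with [rho = |y| / 2], the scale at which the cube still avoids [0]. The mass
    [O(|y|^2)] of [u] turns the average into [|y|^(2-n)]. *)
Lemma superharmonic_riesz_bound (R : realType) (n : nat) (u : 'rV[R]_n -> R) : (3 <= n)%N ->
  Ck 2 [set x | x != 0] u -> (forall x, x != 0 -> 0 <= u x) ->
  (forall x, x != 0 -> enorm x < 2 -> 0 <= - laplacian u x) ->
  exists2 C : R, 0 < C & forall y, pcube ((2 * n%:R)^-1 / 2) y ->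
  ((u y)%:E <= C%:E * (\int[leb]_(z in pcube (2 * n%:R)^-1)
     (`|z - y| `^ (- (n%:R - 2)) * - laplacian u z)%:E +
     (`|y| `^ (- (n%:R - 2)))%:E))%E.
Proof.
move=> n3 C2u u0 f0; have n0 : (0 < n)%N by exact: leq_trans n3.
have nR0 : 0 < n%:R :> R by rewrite ltr0n.
have n3' : 3 <= n%:R :> R by rewrite ler_nat.
pose k : R := (n%:R - 2) / 2.
have k0 : 0 < k by rewrite divr_gt0 // subr_gt0 (lt_le_trans _ n3') // ltr_nat.
have [C C0 HC] := @representation R n k n3 erefl.
have [K K0 HK] := integral_superharmonic_le n3 C2u u0 f0.
have /Ck2P[cu _] := C2u.
have cf := continuous_laplacian C2u.
pose r : R := (2 * n%:R)^-1; rewrite -/r.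
have r0 : 0 < r by rewrite invr_gt0 mulr_gt0.
have f0' x : pcube r x -> 0 <= - laplacian u x.
  by move=> xr; apply: f0; [case: xr|exact: pcube_enorm_lt2 n0 xr].
(* [2^n] comes from [(|y| / 2)^(-n)], and [4] from the mass of [u] on the cube of radius [2 |y|]. *)
pose B := 2 ^+ n * (K * 4); have B0 : 0 <= B by rewrite !mulr_ge0 // exprn_ge0.
exists (C * (1 + B)); first by rewrite mulr_gt0 // ltr_wpDr.
move=> y [y0 yr].
have ny : 0 < `|y| by rewrite normr_gt0.
have rho0 : 0 < `|y| / 2 by rewrite divr_gt0.
have sub : ccube y (`|y| / 2) `<=` pcube (2 * `|y|).
  move=> x; rewrite /ccube /= => xy; split.
    apply/eqP => x0; move: xy; rewrite x0 sub0r normrN; move: ny; clra.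
  have := ler_normD (x - y) y; rewrite subrK; move: xy ny; clra.
have subr : pcube (2 * `|y|) `<=` (pcube r : set 'rV[R]_n).
  by move=> x [x0 xy]; split => //; move: yr xy; clra.
have Q0 x : ccube y (`|y| / 2) x -> x != 0 /\ 0 <= - laplacian u x.
  by move=> xQ; split; [case: (sub _ xQ)|exact: f0' (subr _ (sub _ xQ))].
have f0k x : pcube r x -> (0 <= (`|x - y| `^ (- (n%:R - 2)) * - laplacian u x)%:E)%E.
  by move=> xr; rewrite lee_fin; exact: mulr_ge0 (powR_ge0 _ _) (f0' _ xr).
apply: le_trans (HC u C2u u0 y _ rho0 Q0) _.
rewrite EFinM -muleA; apply: lee_wpmul2l; first by rewrite lee_fin ltW.
set I := (\int[leb]_(z in pcube r) _)%E.
have I0 : (0 <= I)%E by apply: integral_ge0 => x xr; exact: f0k.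
have Y0 : 0 <= `|y| `^ (- (n%:R - 2)) by exact: powR_ge0.
apply: (@le_trans _ _ (I + (B * `|y| `^ (- (n%:R - 2)))%:E)%E); last first.
  rewrite ge0_muleDr //; apply: leeD.
    by rewrite -[leLHS]mul1e; apply: lee_wpmul2r => //; rewrite lee_fin lerDl.
  by rewrite -EFinM lee_fin; apply: ler_wpM2r => //; rewrite lerDr.
have mQy : measurable (ccube y (`|y| / 2) `\` [set y]).
  by apply: measurableD; [exact: measurable_ccube|exact: measurable_set1_rV].
have mk c : measurable_fun setT (fun z : 'rV[R]_n => `|z - y| `^ c).
  exact: measurable_norm_powR.
have mf : measurable_fun (pcube r) (fun x => - laplacian u x).
  exact: measurable_pcube_continuous.
have mkf : measurable_fun (pcube r)
    (fun z => (`|z - y| `^ (- (n%:R - 2)) * - laplacian u z)%:E).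
  by apply/measurable_EFinP/measurable_funM => //; exact: measurable_funTS.
apply: leeD.
  apply: (@le_trans _ _ (\int[leb]_(z in ccube y (`|y| / 2) `\` [set y])
      (`|z - y| `^ (- (n%:R - 2)) * - laplacian u z)%:E)%E).
    have DQ : ccube y (`|y| / 2) `\` [set y] `<=` (pcube r : set 'rV[R]_n).
      by move=> x [/sub/subr].
    apply: ge0_le_integral.
    - exact: mQy.
    - by move=> x /DQ xr; rewrite lee_fin; exact: mulr_ge0 (powR_ge0 _ _) (f0' _ xr).
    - apply/measurable_EFinP/measurable_funM.
        by apply: measurable_funTS; exact: measurable_sq_powR.
      exact: measurable_funS (measurable_pcube _) DQ mf.
    - exact: measurable_funS (measurable_pcube _) DQ mkf.
    - move=> x [xQ xy]; rewrite lee_fin; apply: (ler_wpM2r (f0' _ (subr _ (sub _ xQ)))).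
      have -> : n%:R - 2 = 2 * k :> R by rewrite /k; field.
      by apply: (powR_sqr_norm k0); rewrite subr_eq0; apply/eqP.
  apply: ge0_subset_integral mkf _ _.
  - exact: mQy.
  - exact: measurable_pcube.
  - exact: f0k.
  - by move=> x [/sub/subr].
have rn0 : 0 < (`|y| / 2) ^- n by rewrite invr_gt0 exprn_gt0.
apply: (@le_trans _ _ (((`|y| / 2) ^- n)%:E * (K * (2 * `|y|) ^+ 2)%:E)%E).
  apply: lee_wpmul2l; first by rewrite lee_fin ltW.
  apply: le_trans (HK (2 * `|y|) _ _); first last.
  - move=> x /subr; exact: pcube_sub_quarter n0 r0 (lexx _) _.
  - exact: mulr_gt0.
  apply: ge0_subset_integral sub.
  - exact: measurable_ccube.
  - exact: measurable_pcube.
  - by apply/measurable_EFinP; exact: measurable_pcube_continuous.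
  - by move=> x [x0 _]; rewrite lee_fin; exact: u0.
rewrite -EFinM lee_fin opprB (_ : 2 - n%:R = - (n%:R - 2)); last by rewrite opprB.
rewrite opprB addrC powRD; last by rewrite (gt_eqF ny) implybT.
rewrite powRN powR_mulrn ?normr_ge0 // -[2]/(2%:R) powR_mulrn ?normr_ge0 //.
rewrite le_eqVlt; apply/orP; left; apply/eqP; rewrite /B exprMn.
have := lt0r_neq0 (exprn_gt0 n ny); rewrite exprVn.
have := lt0r_neq0 (@exprn_gt0 R n 2 (ltr0n _ _)).
move: (`|y|) (`|y| ^+ n) (2 ^+ n) => a b c c0 b0; field.
by rewrite c0 b0.
Qed.

(** With [powR_absorb], this replaces Jensen's inequality: applied to the kernel and integrated
    against [f], it bounds the power [p] of the potential by the potential of the power [p]. *)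
Lemma powR_interpolation (R : realType) (p T g : R) : 1 <= p -> 0 < T -> 0 <= g ->
  g <= T + T `^ (1 - p) * g `^ p.
Proof.
move=> p1 T0 g0; have [gT|Tg] := leP g T.
  by rewrite -[leLHS]addr0; apply: lerD => //; rewrite mulr_ge0 ?powR_ge0.
have gp : 0 < g := lt_trans T0 Tg.
rewrite -[leLHS]add0r; apply: lerD; first exact: ltW.
have -> : g = g `^ (1 - p) * g `^ p.
  by rewrite -powRD ?subrK ?powRr1 // (gt_eqF gp) implybT.
rewrite -powRD ?subrK ?powRr1 ?(gt_eqF gp) ?implybT //.
rewrite -[X in X <= _](@powRr1 _ g) // -[in X in X <= _](subrK p 1).
rewrite powRD ?(gt_eqF gp) ?implybT //.
apply: ler_wpM2r; first exact: powR_ge0.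
by apply: powR_le; [|exact: ltW|rewrite subr_le0].
Qed.

(* Choosing [T] proportional to [w], the term [M * T] is absorbed by the left-hand side. *)
Lemma powR_absorb (R : realType) (p C M w W I : R) : 1 <= p -> 0 < C -> 0 <= M ->
  0 <= w -> 0 <= W -> 0 <= I ->
  (forall T, 0 < T -> w <= C * (M * T + T `^ (1 - p) * I + W)) ->
  w `^ p <= ((4 * C) `^ p + 4 * C * (4 * C * (M + 1)) `^ (p - 1)) * (I + W `^ p).
Proof.
move=> p1 C0 M0 w0 W0 I0 H.
have p0 : 0 < p by exact: lt_le_trans p1.
have M1 : 0 < M + 1 by rewrite ltr_wpDl.
have C4 : 0 < 4 * C by rewrite mulr_gt0.
have D0 : 0 < 4 * C * (M + 1) by rewrite mulr_gt0.
have A0 : 0 <= (4 * C) `^ p by exact: powR_ge0.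
have B0 : 0 <= 4 * C * (4 * C * (M + 1)) `^ (p - 1).
  exact: mulr_ge0 (ltW C4) (powR_ge0 _ _).
have IW : 0 <= I + W `^ p by apply: addr_ge0 => //; exact: powR_ge0.
move: w0; rewrite le_eqVlt => /orP[/eqP<-|w0].
  by rewrite powR0 ?gt_eqF // mulr_ge0 // addr_ge0.
pose T := w / (4 * C * (M + 1)); have T0 : 0 < T by rewrite divr_gt0.
have {H} := H T T0.
have TM : C * (M * T) <= w / 4.
  have : M * T <= w / (4 * C).
    rewrite /T (_ : M * _ = w / (4 * C) * (M / (M + 1))); last first.
      by field; rewrite !gt_eqF.
    rewrite ler_piMr ?divr_ge0 ?(ltW w0) ?(ltW C4) //.
    by rewrite ler_pdivrMr // mul1r lerDl.
  move=> /(ler_wpM2l (ltW C0)); rewrite (_ : C * (w / (4 * C)) = w / 4) //.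
  by field; rewrite gt_eqF.
have [h|h] := leP (T `^ (1 - p) * I) W => H.
  have : w <= 4 * C * W.
    have := mulr_ge0 (ltW C0) W0.
    have := ler_wpM2l (ltW C0) h; move: H TM; rewrite !mulrDr -mulrA.
    by move: (C * (M * T)) (C * (T `^ (1 - p) * I)) (C * W); clra.
  move=> /(ge0_ler_powR (ltW p0)) h1.
  have {}h1 : w `^ p <= (4 * C * W) `^ p.
    apply: h1; rewrite nnegrE; [exact: ltW|exact: mulr_ge0 (ltW C4) W0].
  apply: le_trans h1 _; rewrite powRM ?(ltW C4) //.
  by apply: ler_pM => //; rewrite ?powR_ge0 ?lerDl ?lerDr.
have : w <= 4 * C * (T `^ (1 - p) * I).
  have := mulr_ge0 (ltW C0) W0.
  have := ler_wpM2l (ltW C0) (ltW h); move: H TM; rewrite !mulrDr -!(mulrA 4).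
  by move: (C * (M * T)) (C * (T `^ (1 - p) * I)) (C * W); clra.
move=> h1.
have wp : w `^ p = w `^ (p - 1) * w.
  by rewrite -[X in _ = _ * X]powRr1 ?(ltW w0) // -powRD ?subrK // (gt_eqF w0) implybT.
rewrite wp; apply: (@le_trans _ _ (w `^ (p - 1) * (4 * C * (T `^ (1 - p) * I)))).
  by apply: ler_wpM2l => //; exact: powR_ge0.
have -> : T `^ (1 - p) = w `^ (1 - p) * (4 * C * (M + 1)) `^ (p - 1).
  rewrite /T powRM ?(ltW w0) ?invr_ge0 ?(ltW D0) //; congr (_ * _).
  by rewrite -powR_inv1 ?(ltW D0) // -powRrM mulN1r opprB.
have E : w `^ (p - 1) * w `^ (1 - p) = 1.
  rewrite -powRD ?(gt_eqF w0) ?implybT //.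
  by rewrite addrA subrK subrr powRr0.
have -> : w `^ (p - 1) * (4 * C * (w `^ (1 - p) * (4 * C * (M + 1)) `^ (p - 1) * I)) =
   4 * C * (4 * C * (M + 1)) `^ (p - 1) * I * (w `^ (p - 1) * w `^ (1 - p)).
  by ring.
rewrite E mulr1; apply: ler_pM => //; rewrite ?lerDl ?lerDr ?powR_ge0 //.
Qed.

(** Up to constants [u^p] is at most the potential of [f] with kernel [|z|^(-a)], [a = (n - 2) p],
    plus [|y|^(-a)]. Integration against [|x - y|^(-b)] leaves two-kernel integrals, uniformly
    bounded because [a + b < n], and the finite mass of [f]. *)
Lemma integral_superharmonic_kernel (R : realType) (n : nat) (u : 'rV[R]_n -> R) (p b : R) :
  (3 <= n)%N ->
  Ck 2 [set x | x != 0] u -> (forall x, x != 0 -> 0 <= u x) ->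
  (forall x, x != 0 -> enorm x < 2 -> 0 <= - laplacian u x) ->
  1 <= p -> 0 < b -> (n%:R - 2) * p + b < n%:R ->
  exists2 K : R, 0 <= K & forall x, `|x| < (2 * n%:R)^-1 / 2 ->
  (\int[leb]_(y in pcube ((2 * n%:R)^-1 / 2)) (u y `^ p * `|x - y| `^ (- b))%:E <= K%:E)%E.
Proof.
move=> n3 C2u u0 f0 p1 b0 ab; have n0 : (0 < n)%N by exact: leq_trans n3.
have nR0 : 0 < n%:R :> R by rewrite ltr0n.
have n3' : 3 <= n%:R :> R by rewrite ler_nat.
have n2 : 0 < n%:R - 2 :> R by rewrite subr_gt0 (lt_le_trans _ n3') // ltr_nat.
have p0 : 0 < p by exact: lt_le_trans p1.
have [C C0 HC] := superharmonic_riesz_bound n3 C2u u0 f0.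
have [M M0 HM] := integral_laplacian_le n3 C2u u0 f0.
have /Ck2P[cu _] := C2u.
have cf := continuous_laplacian C2u.
pose a := (n%:R - 2) * p; have a0 : 0 < a by rewrite mulr_gt0.
pose r : R := (2 * n%:R)^-1; rewrite -/r in HC *.
have r0 : 0 < r by rewrite invr_gt0 mulr_gt0.
have r2r : r / 2 < r by rewrite ltr_pdivrMr // ltr_pMr // ltr1n.
have [K K0 HK] := integral_two_kernels n0 a0 b0 ab r0.
have f0' x : pcube r x -> 0 <= - laplacian u x.
  by move=> xr; apply: f0; [case: xr|exact: pcube_enorm_lt2 n0 xr].
have mP : measurable (pcube r : set 'rV[R]_n) := measurable_pcube r.
have mf : measurable_fun (pcube r) (fun x => - laplacian u x).
  exact: measurable_pcube_continuous.
pose f := (fun x => - laplacian u x) \_ (pcube r).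
have fE x : f x = if x \in pcube r then - laplacian u x else 0 by rewrite /f patchE.
have mft : measurable_fun setT f by apply/(measurable_restrictT _ mP).
have ff0 x : 0 <= f x by rewrite fE; case: ifPn => //; rewrite inE; exact: f0'.
have fM : (\int[leb]_z (f z)%:E <= M%:E)%E.
  apply: le_trans HM; rewrite (_ : (fun z => (f z)%:E) =
      (EFin \o (fun x => - laplacian u x)) \_ (pcube r)); last first.
    by apply/funext => x; rewrite patchE fE /=; case: ifP.
  rewrite -integral_mkcond.
  apply: ge0_subset_integral.
  - exact: mP.
  - exact: measurable_punctured_quarter.
  - apply/measurable_EFinP; apply: measurable_funS (continuous_in_measurable_rV open_neq0 cf).
      exact: measurable_neq0.
    by move=> x [].
  - move=> x [x0 x4]; rewrite lee_fin; apply: f0 => //; apply: enorm_lt2.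
    by apply: lt_trans x4 _; lra.
  - exact: pcube_sub_quarter n0 r0 (lexx _).
have kint c y : (\int[leb]_(z in pcube r) (`|z - y| `^ c * - laplacian u z)%:E =
    \int[leb]_z (`|z - y| `^ c * f z)%:E)%E.
  rewrite integral_mkcond; apply: eq_integral => z _; rewrite patchE fE.
  by case: ifP => //; rewrite mulr0.
pose I y := (\int[leb]_z (`|z - y| `^ (- a) * f z)%:E)%E.
have mk c y : measurable_fun setT (fun z : 'rV[R]_n => (`|z - y| `^ c * f z)%:E).
  by apply/measurable_EFinP/measurable_funM => //; exact: measurable_norm_powR.
have I0 y : (0 <= I y)%E.
  by apply: integral_ge0 => z _; rewrite lee_fin mulr_ge0 // powR_ge0.
pose C2 := (4 * C) `^ p + 4 * C * (4 * C * (M + 1)) `^ (p - 1).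
have C20 : 0 < C2 by rewrite ltr_wpDr ?powR_gt0 ?mulr_gt0 // mulr_ge0 ?powR_ge0 // mulr_ge0 // ltW.
have key y : pcube (r / 2) y ->
    ((u y `^ p)%:E <= C2%:E * (I y + (`|y| `^ (- a))%:E))%E.
  move=> yr; have y0 : y != 0 by case: yr.
  (* Where the potential is infinite there is nothing to prove; elsewhere it is a real number and
     [powR_absorb] applies. *)
  have := I0 y; case E : (I y) => [i| |] // i0; last first.
    by rewrite addye // gt0_muley ?lte_fin // leey.
  rewrite -EFinD -EFinM lee_fin.
  have aE (s : R) : s `^ (- a) = (s `^ (- (n%:R - 2))) `^ p.
    by rewrite -powRrM mulNr.
  rewrite [`|y| `^ _]aE; apply: powR_absorb => //.
    exact: u0.
  move=> T T0; have h := HC y yr; rewrite kint in h.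
  rewrite -lee_fin; apply: le_trans h _; rewrite EFinM; apply: lee_wpmul2l.
    by rewrite lee_fin ltW.
  rewrite EFinD; apply: leeD => //.
  apply: (@le_trans _ _ (\int[leb]_z (T%:E * (f z)%:E +
      (T `^ (1 - p))%:E * (`|z - y| `^ (- a) * f z)%:E))%E).
    apply: ge0_le_integral => //.
    - by move=> z _; rewrite lee_fin mulr_ge0 // powR_ge0.
    - by apply: emeasurable_funD; apply: measurable_funeM => //; apply/measurable_EFinP.
    - move=> z _; rewrite -!EFinM -EFinD lee_fin aE mulrA -mulrDl.
      by apply: ler_wpM2r => //; apply: powR_interpolation => //; exact: powR_ge0.
  rewrite ge0_integralD //; first last.
  - exact: measurable_funeM.
  - by move=> z _; rewrite -EFinM lee_fin; apply: mulr_ge0 (powR_ge0 _ _) (mulr_ge0 (powR_ge0 _ _) (ff0 _)).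
  - by apply: measurable_funeM; apply/measurable_EFinP.
  - by move=> z _; rewrite -EFinM lee_fin mulr_ge0 // ltW.
  rewrite !ge0_integralZl_EFin //; first last.
  - exact: ltW.
  - by apply/measurable_EFinP.
  - by move=> z _; rewrite lee_fin.
  - exact: powR_ge0.
  - by move=> z _; rewrite lee_fin mulr_ge0 // powR_ge0.
  rewrite -/(I y) E EFinD; apply: leeD => //.
  by rewrite mulrC EFinM; apply: lee_wpmul2l => //; rewrite lee_fin ltW.
exists (C2 * (K * M + K)).
  by rewrite mulr_ge0 ?(ltW C20) // addr_ge0 ?mulr_ge0 // ltW.
move=> x xr.
have xr' : `|x| < r by exact: lt_trans r2r.
have mC := @measurable_cube R n 0 r.
pose g := (fun y : 'rV[R]_n => `|x - y| `^ (- b)) \_ (cube 0 r).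
have gE y : g y = if y \in cube 0 r then `|x - y| `^ (- b) else 0 by rewrite /g patchE.
have mg : measurable_fun setT g.
  by apply/(measurable_restrictT _ mC); apply: measurable_funTS; exact: measurable_norm_powRC.
have g0 y : 0 <= g y by rewrite gE; case: ifPn => // _; exact: powR_ge0.
have HKg z : `|z| < r -> (\int[leb]_y (`|z - y| `^ (- a) * g y)%:E <= K%:E)%E.
  move=> zr; apply: le_trans (HK z x zr xr').
  rewrite [leRHS]integral_mkcond le_eqVlt; apply/orP; left; apply/eqP.
  apply: eq_integral => y _; rewrite patchE gE; case: ifP => //; by rewrite mulr0.
have H1 : (\int[leb]_y (I y * (g y)%:E) <= (K * M)%:E)%E.
  apply: integral_kernel_tonelli => //; first exact: ltW.
  by move=> z; rewrite fE; case: ifPn; rewrite ?eqxx // inE => -[_ zr] _; exact: HKg.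
have H2 : (\int[leb]_y (`|y| `^ (- a) * g y)%:E <= K%:E)%E.
  apply: le_trans (HKg 0 _); last by rewrite normr0.
  by under eq_integral do rewrite -normrN -sub0r.
have mkf : measurable_fun setT
    (fun q : 'rV[R]_n * 'rV[R]_n => (`|q.2 - q.1| `^ (- a) * f q.2)%:E).
  rewrite (_ : (fun q => _) = (fun q : 'rV[R]_n * 'rV[R]_n =>
      (`|q.2 - q.1| `^ (- a) * f q.2 * cst 1 q.1)%:E)).
    exact: measurable_kernel_pair.
  by apply/funext => q; rewrite mulr1.
have mI : measurable_fun setT I.
  apply: (@measurable_fun_fubini_tonelli_F _ _ 'rV[R]_n 'rV[R]_n R leb _ mkf).
  by move=> q; rewrite lee_fin mulr_ge0 // powR_ge0.
have mg' : measurable_fun setT (fun y => (g y)%:E) by exact/measurable_EFinP.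
have mIg : measurable_fun setT (fun y => (I y * (g y)%:E)%E) by exact: emeasurable_funM.
have mag : measurable_fun setT (fun y : 'rV[R]_n => (`|y| `^ (- a) * g y)%:E).
  by apply/measurable_EFinP/measurable_funM => //; exact: measurable_norm_powR0.
have H3 : (\int[leb]_y (C2%:E * (I y * (g y)%:E + (`|y| `^ (- a) * g y)%:E)) <=
    (C2 * (K * M + K))%:E)%E.
  rewrite ge0_integralZl_EFin ?(ltW C20) //; last first.
  - exact: emeasurable_funD.
  - move=> y _; apply: adde_ge0; first by apply: mule_ge0; rewrite ?lee_fin.
    by rewrite lee_fin mulr_ge0 // powR_ge0.
  rewrite EFinM; apply: lee_wpmul2l; first by rewrite lee_fin ltW.
  rewrite ge0_integralD //.
  - by rewrite EFinD; exact: leeD.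
  - by move=> y _; apply: mule_ge0; rewrite ?lee_fin.
  - by move=> y _; rewrite lee_fin mulr_ge0 // powR_ge0.
apply: le_trans H3.
have mP2 : measurable (pcube (r / 2) : set 'rV[R]_n) := measurable_pcube _.
apply: (@le_trans _ _ (\int[leb]_(y in pcube (r / 2))
    (C2%:E * (I y * (g y)%:E + (`|y| `^ (- a) * g y)%:E)))%E).
  apply: ge0_le_integral => //.
  - by move=> y _; rewrite lee_fin mulr_ge0 ?powR_ge0.
  - apply/measurable_EFinP/measurable_funM.
      apply: (measurableT_comp (measurable_powR p)).
      exact: measurable_pcube_continuous.
    by apply: measurable_funTS; exact: measurable_norm_powRC.
  - apply: measurable_funeM; apply: emeasurable_funD; exact: measurable_funTS.
  - move=> y yr; have gy : g y = `|x - y| `^ (- b).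
      rewrite gE mem_set //; case: yr => _ yr; rewrite /cube /= subr0.
      exact: lt_trans r2r.
    rewrite EFinM gy.
    apply: le_trans (lee_wpmul2r _ (key y yr)) _; first by rewrite lee_fin powR_ge0.
    by rewrite -muleA ge0_muleDl.
apply: ge0_subset_integral => //.
- by apply: measurable_funeM; apply: emeasurable_funD.
- move=> y _; apply: mule_ge0; first by rewrite lee_fin ltW.
  apply: adde_ge0; first by apply: mule_ge0; rewrite ?lee_fin.
  by rewrite lee_fin mulr_ge0 // powR_ge0.
Qed.

Lemma powR_sublinear (R : realType) (l T g : R) : 0 < l -> l < 1 -> 0 < T -> 0 <= g ->
  g `^ l <= T `^ (l - 1) * g + T `^ l.
Proof.
move=> l0 l1 T0 g0; have [gT|Tg] := leP g T.
  rewrite -[leLHS]add0r; apply: lerD; first exact: mulr_ge0 (powR_ge0 _ _) g0.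
  by apply: (ge0_ler_powR (ltW l0)) gT; rewrite nnegrE // ltW.
have gp : 0 < g := lt_trans T0 Tg.
rewrite -[leLHS]addr0; apply: lerD; last exact: powR_ge0.
have -> : g `^ l = g `^ (l - 1) * g.
  rewrite -[X in _ = _ * X](powRr1 g0) -powRD ?subrK //.
  by rewrite (gt_eqF gp) implybT.
apply: (ler_wpM2r g0).
by apply: powR_le; [|exact: ltW|rewrite subr_le0 ltW].
Qed.

(** With threshold [|x - y|^(-c)], [powR_sublinear] splits [u^l |x - y|^(-a)] into [u] with kernel
    exponent [a - c (1 - l)] and a pure kernel of exponent [a + c l]; both must be admissible. In
    terms of the first exponent [b] this means [lo < b < hi], and the hypotheses make this interval
    nonempty. *)
Lemma sublinear_exponents (R : realType) (n l a : R) : 0 < a -> a < n -> 0 < l -> l < 1 ->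
  (n - 2) * l + a < n -> exists c, [/\ 0 < a - c * (1 - l), (n - 2) * 1 + (a - c * (1 - l)) < n,
    0 < a + c * l & a + c * l < n].
Proof.
move=> a0 an l0 l1 H.
pose q := (a - n * (1 - l)) / l.
pose lo := Num.max 0 q; pose hi := Num.min 2 a.
have lh : lo < hi.
  rewrite gt_max !lt_min a0 ltr0n /=.
  by apply/andP; split; rewrite /q ltr_pdivrMr //; nra.
pose b := (lo + hi) / 2.
have b1 : lo < b by rewrite /b; lra.
have b2 : b < hi by rewrite /b; lra.
have /andP[b0 bq] : (0 < b) && (q < b) by rewrite -gt_max.
have /andP[bt ba] : (b < 2) && (b < a) by rewrite -lt_min.
have l1' : 0 < 1 - l by rewrite subr_gt0.
exists ((a - b) / (1 - l)).
have E : a - (a - b) / (1 - l) * (1 - l) = b by rewrite divfK ?gt_eqF // subKr.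
have c0 : 0 < (a - b) / (1 - l) by rewrite divr_gt0 // subr_gt0.
rewrite E; split => //; first lra.
  by apply: addr_gt0 => //; exact: mulr_gt0.
have -> : a + (a - b) / (1 - l) * l = (a - b * l) / (1 - l).
  by field; rewrite gt_eqF.
by rewrite ltr_pdivrMr //; move: bq; rewrite /q ltr_pdivrMr //; lra.
Qed.

(** For [l < 1] the case of exponent [1] is used. A constant threshold in [powR_sublinear] would
    keep the kernel exponent [b] and so demand [b < 2]; a threshold depending on [|x - y|] lowers
    it. *)
Lemma integral_superharmonic_powR (R : realType) (n : nat) (u : 'rV[R]_n -> R) (l b : R) :
  (3 <= n)%N ->
  Ck 2 [set x | x != 0] u -> (forall x, x != 0 -> 0 <= u x) ->
  (forall x, x != 0 -> enorm x < 2 -> 0 <= - laplacian u x) ->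
  0 < l -> 0 < b -> b < n%:R -> (n%:R - 2) * l + b < n%:R ->
  exists2 K : R, 0 <= K & forall x, `|x| < (2 * n%:R)^-1 / 2 ->
  (\int[leb]_(y in pcube ((2 * n%:R)^-1 / 2)) (u y `^ l * `|x - y| `^ (- b))%:E <= K%:E)%E.
Proof.
move=> n3 C2u u0 f0 l0 b0 bn lb.
have [l1|l1] := leP 1 l; first exact: integral_superharmonic_kernel.
have n0 : (0 < n)%N by exact: leq_trans n3.
have [c [be0 be2 g0 gn]] := sublinear_exponents b0 bn l0 l1 lb.
have [K K0 HK] := integral_superharmonic_kernel n3 C2u u0 f0 (lexx 1) be0 be2.
have [C C0 HC] := @integral_norm_powR R n _ n0 g0 gn.
have /Ck2P[cu _] := C2u.
pose t : R := (2 * n%:R)^-1 / 2; rewrite -/t in HK *.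
have t0 : 0 < t by rewrite divr_gt0 // invr_gt0 mulr_gt0 // ltr0n.
have t20 : 0 < 2 * t by rewrite mulr_gt0.
exists (K + C * (2 * t) `^ (n%:R - (b + c * l))).
  by rewrite addr_ge0 // mulr_ge0 ?powR_ge0 // ltW.
move=> x xt.
have mP : measurable (pcube t : set 'rV[R]_n) := measurable_pcube t.
have mu e : measurable_fun (pcube t) (fun y : 'rV[R]_n => u y `^ e).
  apply: (measurableT_comp (measurable_powR e)).
  exact: measurable_pcube_continuous.
have I2 : (\int[leb]_(y in pcube t) (`|x - y| `^ (- (b + c * l)))%:E <=
    (C * (2 * t) `^ (n%:R - (b + c * l)))%:E)%E.
  apply: le_trans (HC x _ t20).
  under eq_integral do rewrite distrC.
  apply: ge0_subset_integral.
  - exact: mP.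
  - exact: measurable_cube.
  - by apply/measurable_EFinP; apply: measurable_funTS; exact: measurable_norm_powR.
  - by move=> y _; rewrite lee_fin powR_ge0.
  - move=> y [_ yt]; rewrite /cube /=; apply: le_lt_trans (ler_normB _ _) _.
    by rewrite mulr_natl mulr2n ltrD.
rewrite EFinD; apply: le_trans (leeD (HK x xt) I2).
rewrite -ge0_integralD; first last.
- by apply/measurable_EFinP; apply: measurable_funTS; exact: measurable_norm_powRC.
- by move=> y _; rewrite lee_fin powR_ge0.
- apply/measurable_EFinP/measurable_funM; first exact: mu.
  by apply: measurable_funTS; exact: measurable_norm_powRC.
- by move=> y _; rewrite lee_fin mulr_ge0 ?powR_ge0.
- exact: mP.
apply: ge0_le_integral.
- exact: mP.
- by move=> y _; rewrite lee_fin mulr_ge0 ?powR_ge0.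
- apply/measurable_EFinP/measurable_funM; first exact: mu.
  by apply: measurable_funTS; exact: measurable_norm_powRC.
- apply/measurable_EFinP/measurable_funD; last by apply: measurable_funTS; exact: measurable_norm_powRC.
  by apply: measurable_funM; [exact: mu|apply: measurable_funTS; exact: measurable_norm_powRC].
move=> y [y0 _]; rewrite -EFinD lee_fin powRr1 ?u0 //.
have [xy|xy] := eqVneq `|x - y| 0.
  rewrite xy [in leLHS]powR0 ?oppr_eq0 ?gt_eqF // mulr0.
  by rewrite addr_ge0 ?powR_ge0 // mulr_ge0 ?powR_ge0 // u0.
have s0 : 0 < `|x - y| by rewrite lt_neqAle eq_sym xy normr_ge0.
move: (`|x - y|) s0 => s s0.
have T0 : 0 < s `^ (- c) by rewrite powR_gt0.
have := powR_sublinear l0 l1 T0 (u0 y y0).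
move=> /(ler_wpM2r (powR_ge0 s (- b))) h; apply: le_trans h _.
have sD p q : s `^ p * s `^ q = s `^ (p + q).
  by rewrite powRD // (gt_eqF s0) implybT.
rewrite mulrDl -!powRrM mulrAC !sD [u y * _]mulrC.
rewrite (_ : - c * (l - 1) + - b = - (b - c * (1 - l))); last by ring.
by rewrite (_ : - c * l + - b = - (b + c * l)); last by ring.
Qed.

(** Near [0] the kernel estimate applies; for [|y| >= t] and [|x| < t / 2] the kernel is bounded,
    and the contribution is controlled by the integral of [u^l] over the whole space. *)
Lemma riesz_conv_bounded (R : realType) (n : nat) (u : 'rV[R]_n -> R) (l a : R) :
  (3 <= n)%N ->
  Ck 2 [set x | x != 0] u -> (forall x, x != 0 -> 0 <= u x) -> in_Llambda l u ->
  (forall x, x != 0 -> enorm x < 2 -> 0 <= - laplacian u x) ->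
  0 < l -> 0 < a -> a < n%:R -> (n%:R - 2) * l + a < n%:R ->
  exists K : R, exists2 t, 0 < t & forall x, `|x| < t ->
  (riesz_conv a l u x <= K%:E)%E.
Proof.
move=> n3 C2u u0 Lu f0 l0 a0 an la.
have [K K0 HK] := integral_superharmonic_powR n3 C2u u0 f0 l0 a0 an la.
have n0 : (0 < n)%N by exact: leq_trans n3.
have /Ck2P[cu _] := C2u.
pose t : R := (2 * n%:R)^-1 / 2; rewrite -/t in HK *.
have t0 : 0 < t by rewrite divr_gt0 // invr_gt0 mulr_gt0 // ltr0n.
have mu : measurable_fun setT u by exact: measurable_continuous_neq0.
have mue e : measurable_fun setT (fun y => u y `^ e).
  exact: (measurableT_comp (measurable_powR e)).
pose L := (\int[leb]_y (`|u y| `^ l)%:E)%E.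
have Lfin : (L < +oo)%E.
  rewrite /L -integral_rVE //.
  apply/measurable_EFinP; apply: (measurableT_comp (measurable_powR l)).
  exact: measurableT_comp.
have L0 : (0 <= L)%E by apply: integral_ge0 => y _; rewrite lee_fin powR_ge0.
have mke x := @measurable_enorm_powR R n (- a) x.
have c0 : 0 < (t / 2) `^ (- a) by rewrite powR_gt0 // divr_gt0.
exists (K + (t / 2) `^ (- a) * fine L), (t / 2); first by rewrite divr_gt0.
move=> x xt.
have xt' : `|x| < t by apply: lt_trans xt _; rewrite ltr_pdivrMr // ltr_pMr // ltr1n.
have mF : measurable_fun setT (fun y => (u y `^ l * enorm (x - y) `^ (- a))%:E).
  exact/measurable_EFinP/measurable_funM.
have F0 y : (0 <= (u y `^ l * enorm (x - y) `^ (- a))%:E)%E.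
  by rewrite lee_fin mulr_ge0 ?powR_ge0.
rewrite /riesz_conv integral_rVE //.
rewrite (@ge0_integralD1 R n setT 0 _ n0 measurableT mF (fun y _ => F0 y)).
pose A : set 'rV[R]_n := [set y | t <= `|y|].
have mA : measurable A by exact: measurable_set_ge (@norm_continuous _ _).
have mP : measurable (pcube t : set 'rV[R]_n) := measurable_pcube t.
have -> : [set: 'rV[R]_n] `\` [set 0] = pcube t `|` A.
  apply/seteqP; split => y.
    move=> [_ y0]; have [h|h] := leP t `|y|; first by right.
    by left; split => //; apply/eqP.
  move=> [[y0 _]|h]; split => //; first exact/eqP.
  by move=> y0; move: h; rewrite y0 /A /= normr0 leNgt t0.
rewrite ge0_integral_setU //; first last.
- apply/disj_setPS => y [[_ h1] h2]; move: h1; rewrite ltNge; exact/negP/negPn.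
- exact: measurable_funTS.
rewrite EFinD; apply: leeD.
  apply: le_trans (HK x xt'); apply: ge0_le_integral => //.
  - exact: measurable_funTS.
  - apply/measurable_EFinP; apply: measurable_funTS; apply: measurable_funM => //.
    exact: measurable_norm_powRC.
  - move=> y _; rewrite lee_fin; apply: ler_wpM2l; first exact: powR_ge0.
    have [xy|xy] := eqVneq (x - y) 0.
      rewrite xy enormE sq_eq0 sqrtr0 powR0; first exact: powR_ge0.
      by rewrite oppr_eq0 (gt_eqF a0).
    apply: powR_le; rewrite ?normr_gt0 ?oppr_le0 ?(ltW a0) //; exact: norm_le_enorm.
apply: (@le_trans _ _ (\int[leb]_(y in A) (((t / 2) `^ (- a))%:E * (`|u y| `^ l)%:E))%E).
  apply: ge0_le_integral => //.
  - exact: measurable_funTS.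
  - apply: measurable_funeM; apply/measurable_EFinP; apply: measurable_funTS.
    by apply: (measurableT_comp (measurable_powR l)); exact: measurableT_comp.
  - move=> y yA; rewrite -EFinM lee_fin mulrC.
    have y0 : y != 0.
      by apply/eqP => y0; move: yA; rewrite y0 /A /= normr0 leNgt t0.
    rewrite (ger0_norm (u0 y y0)); apply: ler_wpM2r; first exact: powR_ge0.
    have h : t / 2 <= `|x - y|.
      have := lerB_dist y x; rewrite distrC; move: yA xt; rewrite /A /=; lra.
    apply: powR_le; [exact: divr_gt0|exact: le_trans h (norm_le_enorm _)|].
    by rewrite oppr_le0 ltW.
rewrite ge0_integralZl_EFin //; first last.
- exact: ltW.
- apply/measurable_EFinP; apply: measurable_funTS.
  by apply: (measurableT_comp (measurable_powR l)); exact: measurableT_comp.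
rewrite EFinM fineK; last by rewrite ge0_fin_numE.
apply: lee_wpmul2l; first by rewrite lee_fin ltW.
apply: ge0_subset_integral => //.
apply/measurable_EFinP.
by apply: (measurableT_comp (measurable_powR l)); exact: measurableT_comp.
Qed.

(** Dyadic shells exhaust the punctured cube, so one of them carries all but [e] of a finite
    mass. *)
Lemma integral_pcube_small (R : realType) (n : nat) (g : 'rV[R]_n -> R) (r e : R) :
  0 < r -> 0 < e -> measurable_fun (pcube r) g -> (forall x, pcube r x -> 0 <= g x) ->
  (\int[leb]_(x in pcube r) (g x)%:E < +oo)%E ->
  exists s, [/\ 0 < s, s <= r & (\int[leb]_(x in pcube s) (g x)%:E <= e%:E)%E].
Proof.
move=> r0 e0 mg g0 fin.
have h0 : 0 < 2^-1 :> R by rewrite invr_gt0.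
have h1 : 2^-1 <= 1 :> R by rewrite invf_le1 // ler1n.
have p0 N : 0 < r * 2^-1 ^+ N by rewrite mulr_gt0 // exprn_gt0.
have p1 N : r * 2^-1 ^+ N <= r by rewrite (ler_piMr (ltW r0)) // exprn_ile1 // (ltW h0).
pose A N : set 'rV[R]_n := shell (r * 2^-1 ^+ N) r.
have AP N : A N `<=` pcube r.
  move=> x [xr xr']; split => //; rewrite -normr_gt0.
  exact: lt_le_trans xr.
have AE : pcube r = \bigcup_N A N by rewrite bigcup_shell.
have hom : {homo A : k l / (k <= l)%N >-> (k <= l)%O} := shell_homo (ltW r0).
have mA N : measurable (A N) by exact: measurable_shell.
have mgE : measurable_fun (pcube r) (EFin \o g) by exact/measurable_EFinP.
have cv := @ge0_nondecreasing_set_cvg_integral _ _ _ A (EFin \o g) leb hom mA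
  (fun N => measurable_funS (measurable_pcube r) (@AP N) mgE)
  (fun N x xA => g0 x (AP _ _ xA)).
rewrite -AE in cv.
have I0 : (0 <= \int[leb]_(x in pcube r) (g x)%:E)%E.
  by apply: integral_ge0 => x /g0; rewrite lee_fin.
move: cv fin I0; case E : (\int[leb]_(x in pcube r) _)%E => [m| |] // cv _ m0.
have [N hN] : exists N, ((m - e)%:E < \int[leb]_(x in A N) (g x)%:E)%E.
  apply: contrapT => /forallNP H; have : (m%:E <= (m - e)%:E)%E.
    rewrite -(cvg_lim (@ereal_hausdorff R) cv).
    apply: lime_le; first by apply/cvg_ex; eexists; exact: cv.
    by apply: nearW => N; rewrite leNgt; exact/negP/H.
  by rewrite lee_fin lerBrDr gerDl leNgt e0.
exists (r * 2^-1 ^+ N); split => //.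
have PU : pcube r = A N `|` pcube (r * 2^-1 ^+ N).
  apply/seteqP; split => x.
    move=> [x0 xr]; have [h|h] := leP (r * 2^-1 ^+ N) `|x|; first by left.
    by right.
  move=> [/AP//|[x0 xr]]; split => //; exact: lt_le_trans (p1 N).
have PS : pcube (r * 2^-1 ^+ N) `<=` (pcube r : set 'rV[R]_n).
  by rewrite PU => x; right.
move: E; rewrite {1}PU ge0_integral_setU //; first last.
- by apply/disj_setPS => x [[h _] [_ h']]; have := lt_le_trans h' h; rewrite ltxx.
- by move=> x [/AP/g0|/PS/g0]; rewrite lee_fin.
- by rewrite -PU.
- exact: measurable_pcube.
have i1 : (0 <= \int[leb]_(x in A N) (g x)%:E)%E.
  by apply: integral_ge0 => x /AP/g0; rewrite lee_fin.
have i2 : (0 <= \int[leb]_(x in pcube (r * 2^-1 ^+ N)) (g x)%:E)%E.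
  by apply: integral_ge0 => x /PS/g0; rewrite lee_fin.
move: hN i1 i2; case: (\int[leb]_(x in A N) _)%E => [p| |] //; last first.
  by move=> _ _ ip; rewrite addye // gt_eqF // (lt_le_trans _ ip).
case: (\int[leb]_(x in pcube _) _)%E => [q| |] //.
rewrite lte_fin => hp _ _ [E]; rewrite lee_fin; move: hp; rewrite -E; clra.
Qed.

(** Closer than [t] to [y], [f] is replaced by its supremum and the kernel has integral [O(t^2)];
    farther away, the kernel is at most [t^(2-n)] and the mass of [f] remains. *)
Lemma integral_kernel_split (R : realType) (n : nat) (k : R) : (3 <= n)%N ->
  k = (n%:R - 2) / 2 -> exists2 C : R, 0 < C &
  forall (f : 'rV[R]_n -> R) y rho B m t, 0 < t -> 0 <= B ->
  measurable_fun (ccube y rho) f -> (forall x, ccube y rho x -> 0 <= f x) ->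
  (forall x, ccube y rho x -> f x <= B) ->
  (\int[leb]_(x in ccube y rho) (f x)%:E <= m%:E)%E ->
  (\int[leb]_(x in ccube y rho `\` [set y]) (sq (x - y) `^ (- k) * f x)%:E <=
    (B * (C * t ^+ 2) + t `^ (- (n%:R - 2)) * m)%:E)%E.
Proof.
move=> n3 kE; have n0 : (0 < n)%N by exact: leq_trans n3.
have n3' : 3 <= n%:R :> R by rewrite ler_nat.
have n2 : 0 < n%:R - 2 :> R by rewrite subr_gt0 (lt_le_trans _ n3') // ltr_nat.
have k0 : 0 < k by rewrite kE divr_gt0.
have nn : n%:R - 2 < n%:R :> R by rewrite ltrBlDr ltrDl ltr0n.
have [C C0 HC] := @integral_norm_powR R n _ n0 n2 nn.
exists C => // f y rho B m t t0 B0 mf f0 fB fm.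
have mQ : measurable (ccube y rho) := @measurable_ccube R n y rho.
have mQy : measurable (ccube y rho `\` [set y]).
  by apply: measurableD; [exact: measurable_ccube|exact: measurable_set1_rV].
have DQ : ccube y rho `\` [set y] `<=` ccube y rho by move=> x [].
have mC := measurable_cube y t.
pose g := (fun x : 'rV[R]_n => `|x - y| `^ (- (n%:R - 2))) \_ (cube y t).
have gE x : g x = if x \in cube y t then `|x - y| `^ (- (n%:R - 2)) else 0.
  by rewrite /g patchE.
have mg : measurable_fun setT g.
  by apply/(measurable_restrictT _ mC); apply: measurable_funTS; exact: measurable_norm_powR.
have g0 x : 0 <= g x by rewrite gE; case: ifPn => // _; exact: powR_ge0.
clearbody g.
have Ig : (\int[leb]_x (g x)%:E <= (C * t ^+ 2)%:E)%E.
  have -> : t ^+ 2 = t `^ (n%:R - (n%:R - 2)).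
    by rewrite opprB addrC subrK -[2]/(2%:R) powR_mulrn // ltW.
  apply: le_trans (HC y t t0); rewrite [leRHS]integral_mkcond.
  rewrite le_eqVlt; apply/orP; left; apply/eqP; apply: eq_integral => x _.
  by rewrite patchE gE; case: ifP.
have c0 : 0 <= t `^ (- (n%:R - 2)) by exact: powR_ge0.
have mg' D : measurable_fun D (fun x => (g x)%:E).
  by apply: measurable_funTS; exact/measurable_EFinP.
have mf' : measurable_fun (ccube y rho `\` [set y]) (EFin \o f).
  by apply/measurable_EFinP; exact: measurable_funS mQ DQ mf.
apply: (@le_trans _ _ (\int[leb]_(x in ccube y rho `\` [set y])
    (B%:E * (g x)%:E + (t `^ (- (n%:R - 2)))%:E * (f x)%:E))%E).
  apply: ge0_le_integral.
  - exact: mQy.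
  - by move=> x /DQ xQ; rewrite lee_fin; exact: mulr_ge0 (powR_ge0 _ _) (f0 _ xQ).
  - apply/measurable_EFinP/measurable_funM; last exact/measurable_EFinP.
    by apply: measurable_funTS; exact: measurable_sq_powR.
  - by apply: emeasurable_funD; apply: measurable_funeM.
  - move=> x [xQ /eqP xy]; rewrite -!EFinM -EFinD lee_fin gE.
    have h : sq (x - y) `^ (- k) <= `|x - y| `^ (- (n%:R - 2)).
      have -> : n%:R - 2 = 2 * k :> R by rewrite kE; field.
      by apply: (powR_sqr_norm k0); rewrite subr_eq0.
    have fx := f0 x xQ; have := ler_wpM2r fx h.
    case: ifPn => xt /le_trans; apply.
      rewrite mulrC -[leLHS]addr0; apply: lerD; last exact: mulr_ge0.
      by apply: ler_wpM2r (fB _ xQ); exact: powR_ge0.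
    rewrite mulr0 add0r; apply: (ler_wpM2r fx).
    apply: powR_le => //; last by rewrite oppr_le0 ltW.
    by move: xt; rewrite notin_setE /cube /= => /negP; rewrite -leNgt.
rewrite ge0_integralD; first last.
- by apply: measurable_funeM.
- by move=> x /DQ xQ; rewrite -EFinM lee_fin; exact: mulr_ge0 (f0 _ xQ).
- by apply: measurable_funeM.
- by move=> x _; rewrite -EFinM lee_fin; exact: mulr_ge0.
- exact: mQy.
rewrite !ge0_integralZl_EFin //; first last.
- by move=> x _; rewrite lee_fin.
- by move=> x /DQ xQ; rewrite lee_fin; exact: f0.
rewrite EFinD; apply: leeD.
  rewrite EFinM; apply: lee_wpmul2l; first by rewrite lee_fin.
  apply: le_trans Ig; apply: ge0_subset_integral => //.
  by move=> x _; rewrite lee_fin.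
rewrite EFinM; apply: lee_wpmul2l; first by rewrite lee_fin.
apply: le_trans fm; apply: ge0_subset_integral => //.
by apply/measurable_EFinP.
Qed.

(** * The doubling argument *)

(** For [m = n - 2], [A] is the value at the maximum point and [k A^(-1/m)] the splitting scale.
    Both parts of the potential are then exact multiples of [A], which expresses the criticality of
    the exponent [1 + 2 / m = n / (n - 2)]. First [k], then [e], is chosen so that each, multiplied
    by [C], is at most [A / 4]. *)
Lemma doubling_absorption (R : realType) (m A B C D K k e Y : R) :
  0 < m -> 0 < A -> 0 < C -> 0 < D -> 0 <= K -> 0 <= Y ->
  k = (1 + 4 * C * D * K)^-1 -> e = k `^ m / (4 * C) ->
  B = K * A `^ (1 + 2 / m) ->
  A <= C * (B * (D * (k * A `^ (- m^-1)) ^+ 2) + (k * A `^ (- m^-1)) `^ (- m) * e + Y) ->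
  A <= 2 * C * Y.
Proof.
move=> m0 A0 C0 D0 K0 Y0 kE eE BE.
have q0 : 0 <= 4 * C * D * K by rewrite !mulr_ge0 // ltW.
have k0 : 0 < k by rewrite kE invr_gt0 ltr_wpDr.
have k1 : k <= 1 by rewrite kE invf_le1 ?lerDl // ltr_wpDr.
have AD p q : A `^ p * A `^ q = A `^ (p + q) by rewrite powRD // (gt_eqF A0) implybT.
have E1 : B * (D * (k * A `^ (- m^-1)) ^+ 2) = K * D * k ^+ 2 * A.
  rewrite BE exprMn -[(A `^ _) ^+ 2]powR_mulrn ?powR_ge0 // -powRrM.
  rewrite (_ : K * _ * _ = K * D * k ^+ 2 * (A `^ (1 + 2 / m) * A `^ (- m^-1 * 2%:R))); last by ring.
  rewrite AD (_ : 1 + 2 / m + - m^-1 * 2%:R = 1) ?powRr1 ?(ltW A0) //.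
  by field; rewrite gt_eqF.
have E2 : (k * A `^ (- m^-1)) `^ (- m) * e = A / (4 * C).
  rewrite powRM ?(ltW k0) ?powR_ge0 // -powRrM mulrNN mulVf ?gt_eqF //.
  rewrite powRr1 ?(ltW A0) // eE mulrAC mulrA -powRD ?(gt_eqF k0) ?implybT //.
  by rewrite addrC subrr powRr0 mul1r mulrC.
rewrite E1 E2 => H.
have h1 : 4 * (C * D * K * k) <= 1.
  rewrite !mulrA -ler_pdivlMr // mul1r kE invrK.
  by rewrite lerDr.
have h2 : C * (K * D * k ^+ 2 * A) <= A / 4.
  rewrite (_ : C * _ = (C * D * K * k) * (k * A)); last by ring.
  have kA : k * A <= A by rewrite ler_piMl // ltW.
  have : (C * D * K * k) * (k * A) <= (C * D * K * k) * A.
    by apply: ler_wpM2l kA; rewrite !mulr_ge0 // ltW.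
  have : 4 * (C * D * K * k) * A <= 1 * A by apply: ler_wpM2r h1; exact: ltW.
  by rewrite mul1r -mulrA; lra.
have h3 : C * (A / (4 * C)) = A / 4 by field; rewrite gt_eqF.
move: H; rewrite !mulrDr h3; have := mulr_ge0 (ltW C0) Y0; lra.
Qed.

Lemma superharmonic_doubling (R : realType) (n : nat) (u : 'rV[R]_n -> R) (K t : R) :
  (3 <= n)%N ->
  Ck 2 [set x | x != 0] u -> (forall x, x != 0 -> 0 <= u x) ->
  (forall x, x != 0 -> enorm x < 2 -> 0 <= - laplacian u x) ->
  0 <= K -> 0 < t ->
  (forall x, pcube t x -> - laplacian u x <= K * u x `^ (n%:R / (n%:R - 2))) ->
  exists C : R, exists2 s, 0 < s & forall x, pcube s x ->
  u x * `|x| ^+ (n - 2) <= C.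
Proof.
move=> n3 C2u u0 f0 K0 t0 fK; have n0 : (0 < n)%N by exact: leq_trans n3.
have nR0 : 0 < n%:R :> R by rewrite ltr0n.
have n3' : 3 <= n%:R :> R by rewrite ler_nat.
have n2 : 0 < n%:R - 2 :> R by rewrite subr_gt0 (lt_le_trans _ n3') // ltr_nat.
pose k : R := (n%:R - 2) / 2.
have [C C0 HC] := @representation R n k n3 erefl.
have [D D0 HD] := @integral_kernel_split R n k n3 erefl.
have [K1 K10 HK1] := integral_superharmonic_le n3 C2u u0 f0.
have [M M0 HM] := integral_laplacian_le n3 C2u u0 f0.
have /Ck2P[cu _] := C2u.
have cf := continuous_laplacian C2u.
pose r : R := (2 * n%:R)^-1.
have r0 : 0 < r by rewrite invr_gt0 mulr_gt0.
have rq : pcube r `<=` (punctured_quarter : set 'rV[R]_n).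
  exact: pcube_sub_quarter n0 r0 (lexx _).
have f0' x : pcube r x -> 0 <= - laplacian u x.
  by move=> xr; apply: f0; [case: xr|exact: pcube_enorm_lt2 n0 xr].
have mf D' : measurable (D' : set 'rV[R]_n) -> (forall x, D' x -> x != 0) ->
    measurable_fun D' (fun x => - laplacian u x).
  move=> mD D0'; apply: measurable_funS (continuous_in_measurable_rV open_neq0 cf) => //.
  exact: measurable_neq0.
pose s := n%:R / (n%:R - 2) : R; rewrite -/s in fK.
have sE : s = 1 + 2 / (n%:R - 2) by rewrite /s; field; rewrite gt_eqF.
(* The factor accounts for [u <= 2^n u(x1)] on the cube around the maximum point [x1]. *)
pose K2 := K * (2 ^+ n) `^ s.
have K20 : 0 <= K2 by rewrite mulr_ge0 ?powR_ge0.
(* [q] and [e] depend on the constants only, so the cube where [f] has mass at most [e] is fixed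
   before [x0] is chosen. *)
pose q := (1 + 4 * C * D * K2)^-1.
have q0 : 0 < q by rewrite invr_gt0 ltr_wpDr // !mulr_ge0 // ltW.
pose e := q `^ (n%:R - 2) / (4 * C).
have e0 : 0 < e by rewrite divr_gt0 ?powR_gt0 ?mulr_gt0.
have fin : (\int[leb]_(x in pcube r) (- laplacian u x)%:E < +oo)%E.
  apply: le_lt_trans (ltry M); apply: le_trans HM; apply: ge0_subset_integral rq.
  - exact: measurable_pcube.
  - exact: measurable_punctured_quarter.
  - apply/measurable_EFinP; apply: mf; first exact: measurable_punctured_quarter.
    by move=> x [].
  - move=> x [x0 x4]; rewrite lee_fin; apply: f0 => //; apply: enorm_lt2.
    by apply: lt_trans x4 _; lra.
have [s0 [s00 s0r He]] := integral_pcube_small r0 e0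
  (mf _ (measurable_pcube r) (fun x (h : pcube r x) => proj1 h)) f0' fin.
pose w0 := Num.min s0 t; have w00 : 0 < w0 by rewrite lt_min s00.
have w0s : w0 <= s0 by rewrite ge_min lexx.
have w0t : w0 <= t by rewrite ge_min lexx orbT.
(* [2^(n-2)] stems from [|x0| = 2 rr]. The radius [w0 / 2] keeps the cube of radius [4 rr = 2 |x0|]
   about [0] inside that of radius [w0]. *)
exists (2 ^+ (n - 2) * (2 ^+ n * (2 * C * (K1 * 16)))), (w0 / 2).
  by rewrite divr_gt0.
move=> x0 [x00 x0w].
pose rr := `|x0| / 2.
have nx0 : 0 < `|x0| by rewrite normr_gt0.
have rr0 : 0 < rr by rewrite divr_gt0.
have K2E : K2 = K * (2 ^+ n) `^ s by [].
have qE : q = (1 + 4 * C * D * K2)^-1 by [].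
have eE : e = q `^ (n%:R - 2) / (4 * C) by [].
have rrE : `|x0| = 2 * rr by rewrite /rr mulrCA divff ?mulr1 // gt_eqF.
clearbody w0 e q K2 s r k rr.
have big x : ccube x0 rr x -> x != 0 /\ `|x| < w0.
  rewrite /ccube /= => xx; split.
    apply/eqP => xz; move: xx; rewrite xz sub0r normrN rrE; move: rr0; clra.
  have := ler_normD (x - x0) x0; rewrite subrK; move: xx x0w nx0; rewrite rrE; clra.
(* Within half the distance [d] from the maximum point to the boundary the weight drops by at most
   [2^n], which bounds [u] there. The power [n] also cancels the factor [(d / 2)^(-n)] of
   [representation]. *)
pose W x := (rr - `|x - x0|) ^+ n * u x.
have cW : {within ccube x0 rr, continuous W}.
  apply: continuous_in_subspaceT => x /set_mem /big[xz _].
  have h : {for x, continuous (fun y : 'rV[R]_n => rr - `|y - x0|)}.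
    by apply: continuousB; [exact: cst_continuous|exact: norm_continuous_shift].
  have h2 : {for x, continuous (fun y : 'rV[R]_n => (rr - `|y - x0|) ^+ n)}.
    exact: (@continuous_comp _ _ _ (fun y : 'rV[R]_n => rr - `|y - x0|)
      (fun z : R => z ^+ n) x h (@exprn_continuous R n _)).
  exact: (continuous_atM h2 (cu x xz)).
have nz : ccube x0 rr !=set0 by exists x0; rewrite /ccube /= subrr normr0 ltW.
have [x1 x1Q x1max] := EVT_max_rV nz (@compact_ccube R n x0 rr) cW.
have {}x1Q : `|x1 - x0| <= rr by move: x1Q; rewrite inE.
have {}x1max x : ccube x0 rr x -> W x <= W x1 by move=> h; apply: x1max; rewrite inE.
suff main : W x1 <= 2 ^+ n * (2 * C * (K1 * 16)) * rr ^+ 2.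
  have : W x0 <= 2 ^+ n * (2 * C * (K1 * 16)) * rr ^+ 2.
    by apply: le_trans main; apply: x1max; rewrite /ccube /= subrr normr0 ltW.
  have En : rr ^+ n = rr ^+ (n - 2) * rr ^+ 2 by rewrite -exprD subnK // ltnW.
  rewrite /W subrr normr0 subr0 En rrE exprMn.
  move: (2 ^+ n * _) => c; rewrite mulrAC (ler_pM2r (exprn_gt0 2 rr0)) => h.
  by rewrite mulrCA ler_pM2l ?exprn_gt0 ?ltr0n // mulrC.
pose d := rr - `|x1 - x0|.
have Y0 : 0 <= K1 * 16 * rr ^+ 2 * (d / 2) ^- n.
  have d00 : 0 <= d / 2 by rewrite divr_ge0 // subr_ge0.
  rewrite mulr_ge0 ?invr_ge0 ?exprn_ge0 // mulr_ge0 ?exprn_ge0 ?(ltW rr0) //.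
  exact: mulr_ge0.
have B0 : 0 <= 2 ^+ n * (2 * C * (K1 * 16)) * rr ^+ 2.
  apply: (mulr_ge0 _ (exprn_ge0 2 (ltW rr0))).
  apply: (mulr_ge0 (exprn_ge0 n (ler0n _ 2))).
  exact: (mulr_ge0 (mulr_ge0 (ler0n _ 2) (ltW C0)) (mulr_ge0 K10 (ler0n _ 16))).
have x1z : x1 != 0 by case: (big x1 x1Q).
have u1 := u0 _ x1z.
(* A maximum point on the boundary has [W x1 = 0]. *)
have [d0|d0] := leP d 0.
  have -> : W x1 = 0 => //.
  rewrite /W -/d (_ : d = 0) ?expr0n ?gtn_eqF ?mul0r //.
  by apply/eqP; rewrite eq_le d0 /d subr_ge0.
have [A0|A0] := leP (u x1) 0.
  have -> : W x1 = 0 => //.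
  by rewrite /W (_ : u x1 = 0) ?mulr0 //; apply/eqP; rewrite eq_le A0.
have rho0 : 0 < d / 2 by rewrite divr_gt0.
have sub : ccube x1 (d / 2) `<=` ccube x0 rr.
  move=> x; rewrite /ccube /= => xx; rewrite -(subrK x1 x) -addrA.
  apply: le_trans (ler_normD _ _) _; move: xx d0; rewrite /d; clra.
have subs : ccube x1 (d / 2) `<=` (pcube s0 : set 'rV[R]_n).
  by move=> x /sub/big[xz xw]; split => //; exact: lt_le_trans w0s.
have subt : ccube x1 (d / 2) `<=` (pcube t : set 'rV[R]_n).
  by move=> x /sub/big[xz xw]; split => //; exact: lt_le_trans w0t.
have sr : pcube s0 `<=` (pcube r : set 'rV[R]_n).
  by move=> x [xz xs]; split => //; exact: lt_le_trans s0r.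
have fQ x : ccube x1 (d / 2) x -> 0 <= - laplacian u x.
  by move=> /subs/sr; exact: f0'.
have uA x : ccube x1 (d / 2) x -> u x <= 2 ^+ n * u x1.
  move=> xx; have := x1max _ (sub _ xx); rewrite /W -/d.
  have dx : d / 2 <= rr - `|x - x0|.
    have := ler_normD (x - x1) (x1 - x0); rewrite addrA subrK.
    by move: xx; rewrite /ccube /= /d; clra.
  have hx : (d / 2) ^+ n * u x <= (rr - `|x - x0|) ^+ n * u x.
    apply: ler_wpM2r; first by apply: u0; case: (subs _ xx).
    by rewrite ler_pXn2r ?nnegrE ?(ltW rho0) // (le_trans (ltW rho0)).
  move=> /(le_trans hx); have p2 : 0 < 2 ^+ n :> R by rewrite exprn_gt0 // ltr0n.
  have pd : 0 < d ^+ n by rewrite exprn_gt0.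
  rewrite exprMn exprVn -mulrA (ler_pM2l pd) mulrC ler_pdivrMr //.
  by rewrite mulrC.
have R1 := HC u C2u u0 x1 _ rho0 (fun x xx => conj (proj1 (big _ (sub _ xx))) (fQ x xx)).
have mQ := @measurable_ccube R n x1 (d / 2).
have fB x : ccube x1 (d / 2) x -> - laplacian u x <= K2 * u x1 `^ s.
  move=> xx; apply: le_trans (fK _ (subt _ xx)) _.
  rewrite K2E -mulrA; apply: (ler_wpM2l K0).
  rewrite -powRM ?exprn_ge0 ?(ltW A0) ?ler0n //.
  apply: ge0_ler_powR (uA x xx); first by rewrite sE addr_ge0 // divr_ge0 // ltW.
    by rewrite nnegrE; apply: u0; case: (subs _ xx).
  by rewrite nnegrE mulr_ge0 ?exprn_ge0 ?ler0n // ltW.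
have fe : (\int[leb]_(x in ccube x1 (d / 2)) (- laplacian u x)%:E <= e%:E)%E.
  apply: le_trans He; apply: ge0_subset_integral subs.
  - exact: mQ.
  - exact: measurable_pcube.
  - apply/measurable_EFinP; apply: mf; first exact: measurable_pcube.
    by move=> x [].
  - by move=> x /sr; rewrite lee_fin; exact: f0'.
have uI : (\int[leb]_(x in ccube x1 (d / 2)) (u x)%:E <= (K1 * 16 * rr ^+ 2)%:E)%E.
  (* Points of the cube have norm at most [|x0| + rr = 3 rr < 4 rr]. *)
  have -> : K1 * 16 * rr ^+ 2 = K1 * (4 * rr) ^+ 2 by ring.
  apply: le_trans (HK1 (4 * rr) _ _); first last.
  - move=> x [xz xr]; apply: rq; split => //; apply: lt_le_trans s0r.
    by apply: lt_le_trans w0s; move: xr x0w; rewrite rrE; clra.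
  - by rewrite mulr_gt0.
  apply: ge0_subset_integral.
  - exact: mQ.
  - exact: measurable_pcube.
  - by apply/measurable_EFinP; exact: measurable_pcube_continuous.
  - by move=> x [xz _]; rewrite lee_fin; exact: u0.
  - move=> x /sub xx; split; first by case: (big _ xx).
    have := ler_normD (x - x0) x0; rewrite subrK rrE.
    by move: xx rr0; rewrite /ccube /=; clra.
pose tau := q * u x1 `^ (- (n%:R - 2)^-1).
have tau0 : 0 < tau by rewrite mulr_gt0 // powR_gt0.
have KA0 : 0 <= K2 * u x1 `^ s by exact: mulr_ge0 (powR_ge0 _ _).
have mfQ : measurable_fun (ccube x1 (d / 2)) (fun x => - laplacian u x).
  by apply: mf => // x /sub/big[].
have R2 := HD _ x1 (d / 2) _ e tau tau0 KA0 mfQ fQ fB fe.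
have rn0 : 0 < (d / 2) ^- n by rewrite invr_gt0 exprn_gt0.
have uE : u x1 <= C * (K2 * u x1 `^ s * (D * tau ^+ 2) + tau `^ (- (n%:R - 2)) * e +
    (d / 2) ^- n * (K1 * 16 * rr ^+ 2)).
  rewrite -lee_fin; apply: le_trans R1 _; rewrite EFinM.
  apply: lee_wpmul2l; first by rewrite lee_fin ltW.
  rewrite EFinD; apply: leeD R2 _; rewrite EFinM.
  by apply: lee_wpmul2l uI; rewrite lee_fin ltW.
have := @doubling_absorption R (n%:R - 2) (u x1) _ C D K2 q e
  ((d / 2) ^- n * (K1 * 16 * rr ^+ 2)) n2 A0 C0 D0 K20 _ qE eE _ uE.
rewrite sE => /(_ _ erefl) h; have {}h := h _.
have {}h : u x1 <= 2 * C * ((d / 2) ^- n * (K1 * 16 * rr ^+ 2)).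
  by apply: h; rewrite mulrC.
have dn : 0 <= d ^+ n by rewrite exprn_ge0 // ltW.
rewrite /W -/d; apply: le_trans (ler_wpM2l dn h) _.
rewrite exprMn exprVn le_eqVlt; apply/orP; left; apply/eqP.
have := lt0r_neq0 (exprn_gt0 n d0).
have := lt0r_neq0 (@exprn_gt0 R n 2 (ltr0n _ _)).
move: (d ^+ n) (2 ^+ n) => a b b0 a0; field.
by rewrite a0 b0.
Qed.

Lemma bigO_at0P (R : realType) (n : nat) (u v : 'rV[R]_n -> R) :
  bigO_at0 u v <-> exists2 k, 0 < k & exists2 s, 0 < s &
    forall x, pcube s x -> `|u x| <= k * `|v x|.
Proof.
rewrite /bigO_at0; split.
  move=> /eqO_exP[k k0 H]; exists k => //.
  move: H => /nbhs_ballP[s /= s0 Hs]; exists s => // x [x0 xs].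
  by apply: Hs => //=; rewrite mx_norm_ball /ball_ /= sub0r normrN.
move=> [k k0 [s s0 H]]; apply/eqO_exP; exists k => //.
apply/nbhs_ballP; exists s => //= x; rewrite mx_norm_ball /ball_ /= sub0r normrN.
by move=> xs x0; apply: H.
Qed.

Lemma harmonic_bound (R : realType) (n : nat) (alpha lambda sigma : R) (u : 'rV[R]_n -> R) :
  (3 <= n)%N -> 0 < alpha -> alpha < n%:R ->
  0 < lambda -> lambda < (n%:R - alpha) / (n%:R - 2) ->
  sigma = galpha n alpha lambda ->
  nonneg_solution alpha lambda sigma u -> harmonically_bounded lambda u.
Proof.
move=> n3 a0 an l0 la sE [u0 C2u Lu Hu].
have n3' : 3 <= n%:R :> R by rewrite ler_nat.
have n2 : 0 < n%:R - 2 :> R by rewrite subr_gt0 (lt_le_trans _ n3') // ltr_nat.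
have {}sE : sigma = n%:R / (n%:R - 2) by rewrite sE /galpha la.
have ln : lambda < n%:R / (n%:R - 2).
  apply: lt_le_trans la _; rewrite ler_pM2r ?invr_gt0 // gerBl ltW //.
rewrite /harmonically_bounded ln; apply/bigO_at0P.
have f0 x : x != 0 -> enorm x < 2 -> 0 <= - laplacian u x.
  by move=> x0 x2; have [] := Hu x x0 x2.
have lb : (n%:R - 2) * lambda + alpha < n%:R.
  by move: la; rewrite ltr_pdivlMr //; lra.
have [K [t t0 HK]] := riesz_conv_bounded n3 C2u u0 Lu f0 l0 a0 an lb.
pose t1 := Num.min t (2 * n%:R)^-1.
have n0 : (0 < n)%N by exact: leq_trans n3.
have t10 : 0 < t1 by rewrite lt_min t0 invr_gt0 mulr_gt0 // ltr0n.
have fK x : pcube t1 x -> - laplacian u x <= `|K| * u x `^ (n%:R / (n%:R - 2)).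
  move=> [x0]; rewrite lt_min => /andP[xt xr].
  have x2 : enorm x < 2 by exact: pcube_enorm_lt2 n0 (conj x0 xr).
  have [_] := Hu x x0 x2; rewrite sE -lee_fin => /le_trans; apply.
  rewrite EFinM; apply: lee_wpmul2r; first by rewrite lee_fin powR_ge0.
  by apply: le_trans (HK x xt) _; rewrite lee_fin ler_norm.
have [C [s s0 HC]] := superharmonic_doubling n3 C2u u0 f0 (normr_ge0 K) t10 fK.
have nR0 : 0 < n%:R :> R by rewrite ltr0n.
(* [n^(n-2)] converts the sup norm into the Euclidean one; [|C| + 1] is used since the sign of [C]
   is unknown. *)
exists ((`|C| + 1) * n%:R ^+ (n - 2)); first by rewrite mulr_gt0 ?exprn_gt0 // ltr_wpDl.
exists s => // x xs; have x0 : x != 0 by case: xs.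
have nx : 0 < `|x| by rewrite normr_gt0.
have ex : 0 < enorm x by exact: lt_le_trans nx (norm_le_enorm x).
have ep : 0 < enorm x ^+ (n - 2) by rewrite exprn_gt0.
rewrite (ger0_norm (u0 _ x0)) [X in _ * X]ger0_norm ?invr_ge0 ?(ltW ep) //.
rewrite ler_pdivlMr //.
apply: (@le_trans _ _ (u x * (n%:R * `|x|) ^+ (n - 2))).
  apply: (ler_wpM2l (u0 _ x0)).
  apply: lerXn2r; rewrite ?nnegrE; [exact: ltW| |exact: enorm_le_norm].
  exact: mulr_ge0.
rewrite exprMn mulrCA mulrC ler_pM2r ?exprn_gt0 //.
apply: le_trans (HC x xs) _.
by apply: le_trans (ler_norm C) _; rewrite lerDl.
Qed.

(** * Gluing bumps *)

(** On the Euclidean ball of radius [2] this is the paraboloid [16 - |x|^2], with Laplacian [- 2 n]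
    and values at least [12]. The cutoff, where superharmonicity fails, acts only outside that ball
    and provides integrability. *)
Definition background {R : realType} {n : nat} (x : 'rV[R]_n) : R :=
  pcut (sq x * 16^-1) * (16 - sq x).

Section Background.
Context {R : realType} {n : nat}.
Local Notation V := ('rV[R]_n).

Lemma background_bnd (x : V) : 0 <= background x <= 16.
Proof.
have /andP[p0 p1] := pcut_bnd (sq x * 16^-1).
have s0 := sq_ge0 x; rewrite /background; have [h|h] := leP (sq x) 16.
  have h0 : 0 <= 16 - sq x by rewrite subr_ge0.
  rewrite mulr_ge0 //=; apply: (@le_trans _ _ (16 - sq x)).
    by rewrite ler_piMl.
  by rewrite gerBl.
have [|-> _ _] := @pcut_eq0 R (sq x * 16^-1); last by rewrite mul0r lexx ler0n.
by rewrite ler_pdivlMr // mul1r ltW.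
Qed.

Lemma background_out (x : V) : 4 <= `|x| -> background x = 0.
Proof.
move=> x4; rewrite /background; have [|-> _ _] := @pcut_eq0 R (sq x * 16^-1); last by rewrite mul0r.
rewrite ler_pdivlMr // mul1r; apply: le_trans (norm_le_sq x).
by rewrite (_ : 16 = 4 ^+ 2) ?ler_pXn2r ?nnegrE //; ring.
Qed.

Lemma enorm_lt2_sq (x : V) : enorm x < 2 -> sq x < 4.
Proof.
move=> x2; have := sqr_sqrtr (sq_ge0 x); rewrite -enormE => <-.
rewrite (_ : 4 = 2 ^+ 2); last by ring.
by rewrite ltr_pXn2r // nnegrE ?enormE ?sqrtr_ge0.
Qed.

Lemma background_ge (x : V) : enorm x < 2 -> 12 <= background x.
Proof.
move=> /enorm_lt2_sq x4; rewrite /background.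
have [|-> _ _] := @pcut_eq1 R (sq x * 16^-1); first by rewrite ler_pdivrMr //; lra.
by rewrite mul1r; lra.
Qed.

Lemma background_C2 (L : R) : Ck 2 setT (fun x : V => L * background x) /\
  forall x : V, enorm x < 2 -> - laplacian (fun x => L * background x) x = 2 * n%:R * L.
Proof.
have h16 : 0 <= 16^-1 :> R by rewrite invr_ge0 ler0n.
have H := C2on_mul (C2on_rescale h16 (@C2on_pcut R))
  (@C2on_affine R [set s | 0 <= s] (16 * L) (- L)).
have E : (fun x : V => L * background x) =
    (fun x => pcut (sq (x - 0) * 16^-1) * (16 * L + - L * sq (x - 0))).
  by apply/funext => x; rewrite subr0 /background; ring.
split; first by rewrite E; exact: (Ck2_radial 0 H).
move=> x /enorm_lt2_sq x4; rewrite E (laplacian_radial 0 H) subr0.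
have [|-> -> ->] := @pcut_eq1 R (sq x * 16^-1); first by rewrite ler_pdivrMr //; lra.
by ring.
Qed.

End Background.

Section RieszConv.
Context {R : realType} {n : nat}.
Local Notation V := ('rV[R]_n).
Variables (alpha lambda : R).
Hypotheses (a0 : 0 < alpha) (l0 : 0 < lambda).

Lemma measurable_riesz_integrand (w : V -> R) (x : V) : measurable_fun setT w ->
  measurable_fun setT (fun y => (w y `^ lambda * enorm (x - y) `^ (- alpha))%:E).
Proof.
move=> mw; apply/measurable_EFinP/measurable_funM; last exact: measurable_enorm_powR.
exact: (measurableT_comp (measurable_powR lambda)).
Qed.

Lemma riesz_convE (w : V -> R) (x : V) : measurable_fun setT w ->
  riesz_conv alpha lambda w x =
  (\int[leb]_y (w y `^ lambda * enorm (x - y) `^ (- alpha))%:E)%E.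
Proof.
move=> mw; rewrite /riesz_conv integral_rVE //; first exact: measurable_riesz_integrand.
by move=> y; rewrite lee_fin mulr_ge0 ?powR_ge0.
Qed.

Lemma riesz_conv_le (w1 w2 : V -> R) (x : V) : measurable_fun setT w1 ->
  measurable_fun setT w2 -> (forall y, 0 <= w1 y) -> (forall y, w1 y <= w2 y) ->
  (riesz_conv alpha lambda w1 x <= riesz_conv alpha lambda w2 x)%E.
Proof.
move=> m1 m2 w0 w12; rewrite (riesz_convE x m1) (riesz_convE x m2).
apply: ge0_le_integral.
- exact: measurableT.
- by move=> y _; rewrite lee_fin mulr_ge0 ?powR_ge0.
- exact: measurable_riesz_integrand.
- exact: measurable_riesz_integrand.
- move=> y _; rewrite lee_fin; apply: ler_wpM2r; first exact: powR_ge0.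
  by apply: (ge0_ler_powR (ltW l0)) (w12 y); rewrite nnegrE // (le_trans (w0 y)).
Qed.

Lemma integral_riesz_ge_cube (w : V -> R) (c x : V) (r m t : R) : (0 < n)%N ->
  measurable_fun setT w -> 0 < r -> 0 <= m ->
  (forall y, cube c r y -> m <= w y) ->
  (forall y, cube c r y -> enorm (x - y) <= t) ->
  ((m `^ lambda * t `^ (- alpha) * (2 * r) ^+ n)%:E <=
    \int[leb]_(y in cube c r) (w y `^ lambda * enorm (x - y) `^ (- alpha))%:E)%E.
Proof.
move=> n0 mw r0 m0 wm et.
have mF := @measurable_riesz_integrand w x mw.
have F0 y : (0 <= (w y `^ lambda * enorm (x - y) `^ (- alpha))%:E)%E.
  by rewrite lee_fin mulr_ge0 ?powR_ge0.
have mc := measurable_cube c r.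
rewrite -(integral_cst_cube c _ r0).
have g0 : 0 <= m `^ lambda * t `^ (- alpha) by rewrite mulr_ge0 ?powR_ge0.
(* The point [y = x] is removed on both sides, because the kernel has the value [0] there. *)
rewrite (@ge0_integralD1 R n _ x (fun=> (m `^ lambda * t `^ (- alpha))%:E) n0 mc
  (measurable_cst _) (fun _ _ => g0)).
rewrite (@ge0_integralD1 R n _ x _ n0 mc (measurable_funTS mF) (fun y _ => F0 y)).
have mcx : measurable (cube c r `\` [set x]).
  by apply: measurableD => //; exact: measurable_set1_rV.
apply: ge0_le_integral.
- exact: mcx.
- by move=> y _; exact: g0.
- exact: measurable_cst.
- exact: measurable_funTS.
move=> y [yc yx]; rewrite lee_fin; apply: ler_pM; rewrite ?powR_ge0 //.
  apply: (ge0_ler_powR (ltW l0)) (wm y yc); rewrite nnegrE //.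
  exact: le_trans (wm y yc).
apply: powR_le; [|exact: et|by rewrite oppr_le0 ltW].
apply: lt_le_trans (norm_le_enorm _); rewrite normr_gt0 subr_eq0.
by apply/eqP => xy; apply: yx.
Qed.

Lemma riesz_conv_ge_integral (w : V -> R) (x : V) (A : set V) : measurable A ->
  measurable_fun setT w ->
  (\int[leb]_(y in A) (w y `^ lambda * enorm (x - y) `^ (- alpha))%:E <=
    riesz_conv alpha lambda w x)%E.
Proof.
move=> mA mw; rewrite (riesz_convE x mw); apply: ge0_subset_integral.
- exact: mA.
- exact: measurableT.
- exact: measurable_riesz_integrand.
- by move=> y _; rewrite lee_fin mulr_ge0 ?powR_ge0.
- by [].
Qed.

Lemma riesz_conv_ge_cube (w : V -> R) (c x : V) (r m t : R) : (0 < n)%N ->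
  measurable_fun setT w -> 0 < r -> 0 <= m ->
  (forall y, cube c r y -> m <= w y) ->
  (forall y, cube c r y -> enorm (x - y) <= t) ->
  ((m `^ lambda * t `^ (- alpha) * (2 * r) ^+ n)%:E <= riesz_conv alpha lambda w x)%E.
Proof.
move=> n0 mw r0 m0 wm et; apply: le_trans (integral_riesz_ge_cube n0 mw r0 m0 wm et) _.
exact: riesz_conv_ge_integral (measurable_cube _ _) mw.
Qed.

End RieszConv.

Lemma epsilon_sum_half (R : realType) :
  (\big[+%E/0%E]_(0 <= i <oo) (1 / (2 ^ i.+1)%:R : R)%:E <= 1%:E)%E.
Proof.
have H := @epsilon_trick R (fun=> 0%E) 1 xpredT (fun _ => lexx _) ler01.
rewrite (eq_eseriesr (g := fun i => (1 / (2 ^ i.+1)%:R)%:E)) in H; last first.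
  by move=> i _; rewrite add0e.
by apply: le_trans H _; rewrite eseries0 // add0e.
Qed.

Section DisjointSum.
Context {R : realType} {n : nat}.
Local Notation V := ('rV[R]_n).
Variables (p : nat -> R) (c : nat -> V) (b : nat -> V -> R).
Hypothesis p0 : forall j, 0 < p j.
Hypothesis p_half : forall i j, (i < j)%N -> p j <= p i / 2.
Hypothesis c_norm : forall j, `|c j| = p j.
Hypothesis c_sep : forall i j, `|c i - c j| = `|p i - p j|.
Hypothesis b0 : forall j x, 0 <= b j x.
Hypothesis b_out : forall j x, p j / 4 <= `|x - c j| -> b j x = 0.

Let ball j : set V := [set x | `|x - c j| < p j / 4].

(* At most one term [b j x] is nonzero; when there is none, [xget] returns [0], and
   [b 0 x] vanishes as well. *)
Definition disjoint_sum (x : V) : R := b (xget 0%N [set j | ball j x]) x.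

Let ball_bnd j x : ball j x -> p j * (3 / 4) < `|x| < p j * (5 / 4).
Proof.
rewrite /ball /= => xj; have := ler_normD (x - c j) (c j); rewrite subrK c_norm.
have := lerB_dist (c j) (c j - x); rewrite subKr c_norm distrC.
by move: xj => xj h1 h2; apply/andP; split; lra.
Qed.

(** For [i < j] the distance is at least [3/4 p_i - 5/4 p_j >= p_i / 8], while [|x| < 5/4 p_i];
    hence the factor [10]. *)
Let separated i j x y : ball i x -> ball j y -> i != j ->
  `|x| <= 10 * `|x - y| /\ `|y| <= 10 * `|x - y|.
Proof.
wlog ij : i j x y / (i < j)%N.
  move=> H xi yj; rewrite neq_ltn => /orP[ij|ji].
    by apply: (H i j) => //; rewrite neq_ltn ij.
  rewrite distrC; have [] := H j i y x ji yj xi => //.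
  by rewrite neq_ltn ji.
move=> xi yj _; have /andP[_ x5] := ball_bnd xi; have /andP[_ y5] := ball_bnd yj.
have h := p_half ij; have pi := p0 i; have pj := p0 j.
have := ler_normD (c i - x) (x - y + (y - c j)).
have -> : c i - x + (x - y + (y - c j)) = c i - c j.
  by rewrite !addrA !subrK.
have := ler_normD (x - y) (y - c j).
rewrite c_sep [`|c i - x|]distrC (ger0_norm (_ : 0 <= p i - p j)); last by lra.
move: xi yj; rewrite /ball /=; split; lra.
Qed.

Let ball_uniq i j x : ball i x -> ball j x -> i = j.
Proof.
move=> xi xj; apply/eqP/negPn/negP => /(separated xi xj)[].
have /andP[h _] := ball_bnd xi; rewrite subrr normr0 mulr0 => h' _.
have := p0 i; lra.
Qed.

Let sum_ball j x : ball j x -> disjoint_sum x = b j x.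
Proof.
move=> xj; rewrite /disjoint_sum.
have := @xgetPex _ 0%N [set j | ball j x] (ex_intro _ j xj).
by move=> /= /(ball_uniq xj) <-.
Qed.

Let sum_out x : (forall j, ~ ball j x) -> disjoint_sum x = 0.
Proof. by move=> h; apply: b_out; rewrite leNgt; apply/negP/h. Qed.

Lemma disjoint_sum_ge j x : b j x <= disjoint_sum x.
Proof.
have [h|h] := ltP `|x - c j| (p j / 4); first by rewrite (sum_ball h).
by rewrite (b_out h); exact: b0.
Qed.

(** Two points within [|x0| / 32] of [x0] are less than [|x0| / 16] apart, too close by [separated]
    to lie in different balls. Balls accumulate only at [0]. If none is met, any index serves, since
    both sides vanish. *)
Lemma disjoint_sum_local (x0 : V) : x0 != 0 ->
  exists j, \forall x \near x0, disjoint_sum x = b j x.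
Proof.
move=> x00; have nx0 : 0 < `|x0| by rewrite normr_gt0.
have d0 : 0 < `|x0| / 32 by rewrite divr_gt0.
have nb (P : V -> Prop) : (forall x, `|x - x0| < `|x0| / 32 -> P x) ->
    \forall x \near x0, P x.
  move=> h; apply/nbhs_ballP; exists (`|x0| / 32) => //= x.
  by rewrite mx_norm_ball /ball_ /= distrC => /h.
have [[j [z [zx zj]]]|none] := pselect (exists j z, `|z - x0| < `|x0| / 32 /\ ball j z).
  exists j; apply: nb => x xx.
  have [[i xi]|nx] := pselect (exists i, ball i x); last first.
    rewrite sum_out; last by move=> i xi; apply: nx; exists i.
    by rewrite b_out // leNgt; apply/negP => h; apply: nx; exists j.
  have [->|ij] := eqVneq j i; first exact: sum_ball.
  have [_ h] := separated zj xi ij.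
  have := ler_normD (z - x0) (x0 - x); rewrite addrA subrK [`|x0 - x|]distrC.
  have := lerB_dist x0 (x0 - x); rewrite subKr [`|x0 - x|]distrC.
  lra.
exists 0%N; apply: nb => x xx; rewrite sum_out.
  by rewrite b_out // leNgt; apply/negP => h; apply: none; exists 0%N, x.
by move=> i xi; apply: none; exists i, x.
Qed.

Lemma disjoint_sum_ge0 x : 0 <= disjoint_sum x.
Proof. exact: le_trans (b0 0%N x) (disjoint_sum_ge 0%N x). Qed.

(** At each point the sum equals a single term, so its power is at most the series of the powers,
    also when [l < 1]. *)
Lemma integral_disjoint_sum (l : R) : 0 < l ->
  (forall j, measurable_fun setT (b j)) -> measurable_fun setT disjoint_sum ->
  (forall j, (\int[leb]_x (b j x `^ l)%:E <= (1 / (2 ^ j.+1)%:R)%:E)%E) ->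
  (\int[leb]_x (disjoint_sum x `^ l)%:E <= 1%:E)%E.
Proof.
move=> l0 mb ms Hb.
have mbl j : measurable_fun setT (fun x => (b j x `^ l)%:E).
  by apply/measurable_EFinP; exact: (measurableT_comp (measurable_powR l)).
have bl0 j x : (0 <= (b j x `^ l)%:E)%E by rewrite lee_fin powR_ge0.
apply: le_trans (@epsilon_sum_half R).
apply: (@le_trans _ _ (\big[+%E/0%E]_(0 <= j <oo) (\int[leb]_x (b j x `^ l)%:E))%E); last first.
  by apply: lee_nneseries => // j _ _; apply: integral_ge0.
rewrite -integral_nneseries //; apply: ge0_le_integral => //.
- by move=> x _; rewrite lee_fin powR_ge0.
- by apply/measurable_EFinP; exact: (measurableT_comp (measurable_powR l)).
- by apply: ge0_emeasurable_sum.
move=> x _; set j := xget 0%N [set j | ball j x].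
apply: le_trans (nneseries_lim_ge j.+1 _); last by [].
rewrite big_nat_recr //= -[leLHS]add0e; apply: leeD; last exact: lexx.
by apply: sume_ge0.
Qed.

End DisjointSum.

(** The interface between the construction of bumps and their gluing. A bump need only satisfy the
    differential inequality with its own convolution, which is at most that of the sum. The factor
    [1/2], the additive [1] and the lower bound [-1] leave errors that the background absorbs. *)
Definition has_bumps {R : realType} (n : nat) (alpha lambda sigma : R) : Prop :=
  forall (rho delta A : R) (c : 'rV[R]_n), 0 < rho -> rho <= 1 -> 0 < delta ->
  exists b : 'rV[R]_n -> R,
  [/\ Ck 2 setT b, forall x, 0 <= b x, forall x, rho <= `|x - c| -> b x = 0 & A <= b c] /\
  [/\ forall x, - 1 <= - laplacian b x, (\int[leb]_x (b x `^ lambda)%:E <= delta%:E)%E &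
    forall x, ((- laplacian b x)%:E <=
      2^-1%:E * (riesz_conv alpha lambda b x * (b x `^ sigma)%:E) + 1%:E)%E].

(** Used with [s = lambda + sigma - 1]: the right-hand side of the differential inequality has
    degree [lambda + sigma > 1], so multiplying the background by a large [L] favours it over the
    Laplacian. *)
Lemma large_scale (R : realType) (q s : R) : 0 <= q -> 0 < s ->
  exists2 L, 1 <= L & q <= (12 * L) `^ s.
Proof.
move=> q0 s0; exists ((1 + q) `^ s^-1).
  rewrite -[leLHS](powRr0 (1 + q)); apply: ler_powR; first by rewrite lerDl.
  by rewrite invr_ge0 ltW.
apply: (@le_trans _ _ (((1 + q) `^ s^-1) `^ s)).
  by rewrite -powRrM mulVf ?gt_eqF // powRr1 ?lerDr ?ler01 // addr_ge0.
apply: (ge0_ler_powR (ltW s0)); rewrite ?nnegrE ?powR_ge0 ?mulr_ge0 ?powR_ge0 //.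
by rewrite ler_peMl ?powR_ge0 // ler1n.
Qed.

(** [P] and [X] are the right-hand sides for the glued solution and for one bump. Half of [P] pays
    for the bump, the other half for the Laplacian [b] of the background and the additive [1]. *)
Lemma lee_half_half (R : realType) (P X : \bar R) (a b : R) : (0 <= P)%E ->
  (X <= P)%E -> ((2 * b + 2)%:E <= P)%E -> (a%:E <= 2^-1%:E * X + 1%:E)%E ->
  ((b + a)%:E <= P)%E.
Proof.
move=> P0 XP bP aX.
have : (a%:E <= 2^-1%:E * P + 1%:E)%E.
  by apply: le_trans aX _; apply: leeD => //; exact: lee_wpmul2l.
case: P P0 bP XP => [p| |] // p0 bp _; last by rewrite leey.
by rewrite -EFinM -EFinD !lee_fin; move: bp; rewrite lee_fin; lra.
Qed.

Lemma no_pointwise_bound (R : realType) (n : nat) (alpha lambda sigma : R) : (3 <= n)%N ->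
  0 < alpha -> 0 < lambda -> 0 <= sigma -> 1 < lambda + sigma ->
  has_bumps n alpha lambda sigma -> ~ has_pointwise_bound n alpha lambda sigma.
Proof.
move=> n3 a0 l0 s0 ls HB [phi [_ phi0 H]].
have n0 : (0 < n)%N by exact: leq_trans n3.
have nR0 : 0 < n%:R :> R by rewrite ltr0n.
have n1 : 1 <= n%:R :> R by rewrite ler1n.
pose e : 'rV[R]_n := delta_mx 0 (Ordinal n0).
pose p (j : nat) : R := 2^-1 ^+ j.+1.
have h0 : 0 < 2^-1 :> R by rewrite invr_gt0.
have h1 : 2^-1 < 1 :> R by rewrite invf_lt1 // ltr1n.
have p0 j : 0 < p j by rewrite exprn_gt0.
have p1 j : p j < 1 by rewrite exprn_ilt1 // ltW.
have p_half i j : (i < j)%N -> p j <= p i / 2.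
  by move=> ij; rewrite /p -exprSr ler_wiXn2l // ltW.
pose c j := p j *: e.
have c_norm j : `|c j| = p j by rewrite normrZ normr_delta_mx mulr1 gtr0_norm.
have c_sep i j : `|c i - c j| = `|p i - p j|.
  by rewrite -scalerBl normrZ normr_delta_mx mulr1.
have c_enorm j : enorm (c j) = p j by rewrite enorm_scale_delta // ltW.
(* The heights [(j + 1) phi (p j)] outgrow every multiple of [phi], and the masses [2^-(j+1)] have
   sum [1]. *)
have hb j : exists b : 'rV[R]_n -> R,
    [/\ Ck 2 setT b, forall x, 0 <= b x,
      forall x, p j / 4 <= `|x - c j| -> b x = 0 & j.+1%:R * phi (p j) <= b (c j)] /\
    [/\ forall x, - 1 <= - laplacian b x,
      (\int[leb]_x (b x `^ lambda)%:E <= (1 / (2 ^ j.+1)%:R)%:E)%E &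
      forall x, ((- laplacian b x)%:E <=
      2^-1%:E * (riesz_conv alpha lambda b x * (b x `^ sigma)%:E) + 1%:E)%E].
  apply: HB.
  - by rewrite divr_gt0.
  - by have := p1 j; lra.
  - by rewrite divr_gt0 // ltr0n expn_gt0.
have [b Hb] := choice hb.
clearbody c.
have Cb j : Ck 2 setT (b j) by have [[]] := Hb j.
have b0 j x : 0 <= b j x by have [[]] := Hb j.
have b_out j x : p j / 4 <= `|x - c j| -> b j x = 0.
  by have [[_ _ h _] _] := Hb j; exact: h.
have cb j x : {for x, continuous (b j)} by have /Ck2P[h _] := Cb j; exact: h.
have mb j : measurable_fun setT (b j) by apply: continuous_measurable_rV => x; exact: cb.
pose S := disjoint_sum p c b.
have Sloc (x : 'rV[R]_n) : x != 0 -> exists j, \forall y \near x, S y = b j y.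
  exact: disjoint_sum_local.
have S0 x : 0 <= S x by exact: disjoint_sum_ge0.
have Sge j x : b j x <= S x by exact: disjoint_sum_ge.
have mS : measurable_fun setT S.
  apply: measurable_continuous_neq0 => x x0; have [j h] := Sloc x x0.
  exact: near_eq_continuous h (cb j x).
have IS : (\int[leb]_x (S x `^ lambda)%:E <= 1%:E)%E.
  by apply: integral_disjoint_sum => // j; have [_ []] := Hb j.
clearbody S.
(* A lower bound for the convolution of the indicator of the cube of radius [1/n] about [0], at
   points of Euclidean norm less than [2]: distances are at most [3 n], and the volume is [(2/n)^n].
   This cube lies where the background is at least [12 L]. *)
pose k := (3 * n%:R) `^ (- alpha) * (2 * n%:R^-1) ^+ n.
have k0 : 0 < k by rewrite mulr_gt0 ?powR_gt0 ?exprn_gt0 ?mulr_gt0 ?invr_gt0.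
(* For this [q], [12 L k q = 4 n L + 2 L], which is at least twice the Laplacian [2 n L] of the
   background plus [2]. *)
have q0 : 0 <= (2 * n%:R + 1) / (6 * k) by rewrite divr_ge0 ?addr_ge0 ?mulr_ge0 // ltW.
have ls0 : 0 < lambda + sigma - 1 by rewrite subr_gt0.
have [L L1 HL] := large_scale q0 ls0.
have L0 : 0 < L by exact: lt_le_trans L1.
pose B x := L * @background R n x.
have CB : Ck 2 setT B by case: (@background_C2 R n L).
have LB (x : 'rV[R]_n) : enorm x < 2 -> - laplacian B x = 2 * n%:R * L.
  by case: (@background_C2 R n L) => _; exact.
have B0 x : 0 <= B x.
  by have /andP[h _] := background_bnd x; exact: mulr_ge0 (ltW L0) h.
have BL (x : 'rV[R]_n) : enorm x < 2 -> 12 * L <= B x.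
  by move=> /background_ge h; rewrite mulrC ler_pM2l.
have mB : measurable_fun setT B.
  by apply: continuous_measurable_rV => x; have /Ck2P[h _] := CB; exact: h.
have BM x : B x <= L * 16 * \1_(cube 0 4) x.
  rewrite indicE; have [x4|x4] := leP 4 `|x|.
    rewrite /B (background_out x4) mulr0 mulr_ge0 //.
    by rewrite mulr_ge0 // ltW.
  rewrite mem_set ?mulr1 /B; last by rewrite /cube /= subr0.
  by have /andP[_ h] := background_bnd x; rewrite ler_pM2l.
clearbody B.
pose u x := B x + S x.
have uE (x : 'rV[R]_n) : x != 0 -> exists j, \forall y \near x, u y = B y + b j y.
  by move=> /Sloc[j h]; exists j; apply: filterS h => y; rewrite /u => ->.
have CBb j := Ck2_add CB (Cb j).
have u_ge0 x : 0 <= u x by exact: addr_ge0.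
have mu : measurable_fun setT u by exact: measurable_funD.
have uB x : B x <= u x by rewrite lerDl.
have ub j x : b j x <= u x by apply: le_trans (Sge j x) _; rewrite lerDr.
have uBS x : u x = B x + S x by [].
clearbody u.
have sol : nonneg_solution alpha lambda sigma u.
  split.
  - by [].
  - apply: Ck2_local => x /uE[j h]; exists (fun y => B y + b j y); last exact: h.
    by case: (CBb j).
  - rewrite /in_Llambda integral_rVE; first last.
    + by move=> x; rewrite lee_fin powR_ge0.
    + apply/measurable_EFinP; apply: (measurableT_comp (measurable_powR lambda)).
      exact: measurableT_comp.
    (* For every [lambda > 0], [(B + S)^lambda] is at most [(2 B)^lambda + (2 S)^lambda], by
       comparison with twice the larger term; [G] bounds the first. *)
    pose G x := (2 * (L * 16)) `^ lambda * \1_(cube (0 : 'rV[R]_n) 4) x.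
    apply: (@le_lt_trans _ _ (\int[leb]_x ((G x)%:E + (2 `^ lambda)%:E * (S x `^ lambda)%:E))%E).
      apply: ge0_le_integral.
      + exact: measurableT.
      + by move=> x _; rewrite lee_fin powR_ge0.
      + apply/measurable_EFinP; apply: (measurableT_comp (measurable_powR lambda)).
        exact: measurableT_comp.
      + apply: emeasurable_funD.
          apply/measurable_EFinP; apply: measurable_funM => //.
          exact: measurable_indic (measurable_cube _ _).
        apply: measurable_funeM; apply/measurable_EFinP.
        exact: (measurableT_comp (measurable_powR lambda)).
      + move=> x _; rewrite -EFinM -EFinD lee_fin ger0_norm //.
        have pl y : 0 <= y -> (2 * y) `^ lambda = 2 `^ lambda * y `^ lambda.
          by move=> y0; rewrite powRM.
        have [h|h] := leP (B x) (S x).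
          apply: (@le_trans _ _ ((2 * S x) `^ lambda)).
            apply: (ge0_ler_powR (ltW l0)); rewrite ?nnegrE ?mulr_ge0 //.
            by rewrite uBS mulr_natl mulr2n lerD2r.
          rewrite pl // lerDr /G mulr_ge0 ?powR_ge0 // indicE; exact: ler0n.
        apply: (@le_trans _ _ ((2 * B x) `^ lambda)).
          apply: (ge0_ler_powR (ltW l0)); rewrite ?nnegrE ?mulr_ge0 //.
          by rewrite uBS mulr_natl mulr2n lerD2l ltW.
        rewrite -[leLHS]addr0; apply: lerD; last by rewrite mulr_ge0 ?powR_ge0.
        have := BM x; rewrite /G indicE; case: (x \in _) => /=.
          rewrite !mulr1 => h'; apply: (ge0_ler_powR (ltW l0)).
          * by rewrite nnegrE mulr_ge0.
          * by rewrite nnegrE !mulr_ge0 // ltW.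
          * by rewrite ler_pM2l.
        rewrite !mulr0 => h'; have -> : B x = 0 by apply/eqP; rewrite eq_le h' B0.
        by rewrite mulr0 powR0 // gt_eqF.
    have mSl : measurable_fun setT (fun x => (S x `^ lambda)%:E).
      by apply/measurable_EFinP; exact: (measurableT_comp (measurable_powR lambda)).
    rewrite ge0_integralD; first last.
    + exact: measurable_funeM.
    + by move=> x _; rewrite -EFinM lee_fin mulr_ge0 ?powR_ge0.
    + apply/measurable_EFinP; apply: measurable_funM; first exact: measurable_cst.
      exact: measurable_indic (measurable_cube _ _).
    + by move=> x _; rewrite lee_fin mulr_ge0 ?powR_ge0 // indicE ler0n.
    + exact: measurableT.
    rewrite ge0_integralZl_EFin; first last.
    + exact: powR_ge0.
    + exact: mSl.
    + by move=> x _; rewrite lee_fin powR_ge0.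
    + exact: measurableT.
    apply: (@le_lt_trans _ _ (((2 * (L * 16)) `^ lambda * (2 * 4) ^+ n)%:E +
        (2 `^ lambda)%:E * 1%:E)%E); last by rewrite -EFinM -EFinD ltry.
    apply: leeD.
      rewrite -(@integral_cst_cube R n 0 ((2 * (L * 16)) `^ lambda) 4) //.
      rewrite [leRHS]integral_mkcond le_eqVlt; apply/orP; left; apply/eqP.
      apply: eq_integral => x _; rewrite patchE /G indicE.
      by case: (x \in _); rewrite ?mulr1 ?mulr0.
    by apply: lee_wpmul2l IS; rewrite lee_fin powR_ge0.
  - move=> x x0 x2; have [j hj] := uE x x0.
    have [_ Lap] := CBb j.
    have -> : - laplacian u x = 2 * n%:R * L + - laplacian (b j) x.
      have E := etrans (laplacian_near_eq hj) (Lap x).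
      have := LB x x2; rewrite E; move: (laplacian B x) (laplacian (b j) x) => lB lb <-.
      exact: opprD.
    have [_ [h1' _ h2]] := Hb j; split.
      have := h1' x; have : 1 <= n%:R * L by exact: mulr_ege1.
      by rewrite -mulrA; lra.
    have bsig : b j x `^ sigma <= u x `^ sigma.
      by apply: (ge0_ler_powR s0) (ub j x); rewrite nnegrE.
    have cbu : (riesz_conv alpha lambda (b j) x <= riesz_conv alpha lambda u x)%E.
      exact: riesz_conv_le.
    have cB : (((12 * L) `^ lambda * (3 * n%:R) `^ (- alpha) * (2 * n%:R^-1) ^+ n)%:E <=
        riesz_conv alpha lambda u x)%E.
      apply: (@riesz_conv_ge_cube R n alpha lambda a0 l0 u 0) => //.
      + by rewrite invr_gt0.
      + by rewrite mulr_ge0 // ltW.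
      + move=> y; rewrite /cube /= subr0 => yr; apply: le_trans (uB y).
        apply: BL; apply: le_lt_trans (enorm_le_norm y) _.
        apply: (@lt_trans _ _ 1); last by rewrite ltr1n.
        by rewrite mulrC -ltr_pdivlMr // div1r.
      + move=> y; rewrite /cube /= subr0 => yr.
        apply: le_trans (enorm_le_norm _) _; rewrite mulrC ler_pM2r //.
        apply: le_trans (ler_normB _ _) _.
        have := norm_le_enorm x; move: x2 yr.
        have : n%:R^-1 <= 1 :> R by rewrite invf_le1.
        lra.
    have cu0 : (0 <= riesz_conv alpha lambda u x)%E.
      apply: le_trans cB; rewrite lee_fin !mulr_ge0 ?powR_ge0 // exprn_ge0 // mulr_ge0 //.
    have cb0 : (0 <= riesz_conv alpha lambda (b j) x)%E.
      rewrite riesz_convE //; apply: integral_ge0 => y _.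
      by rewrite lee_fin mulr_ge0 ?powR_ge0.
    have us0 : (0 <= (u x `^ sigma)%:E)%E by rewrite lee_fin; exact: powR_ge0.
    apply: (lee_half_half _ _ _ (h2 x)).
    + exact: (mule_ge0 cu0 us0).
    + by apply: (lee_pmul cb0 _ cbu); rewrite lee_fin //; exact: powR_ge0.
    + have L12 : 0 < 12 * L by rewrite mulr_gt0.
      have uL : (12 * L) `^ sigma <= u x `^ sigma.
        apply: (ge0_ler_powR s0); rewrite ?nnegrE ?(ltW L12) //.
        exact: le_trans (BL x x2) (uB x).
      apply: (@le_trans _ _ (((12 * L) `^ lambda * k)%:E * ((12 * L) `^ sigma)%:E)%E).
        rewrite -EFinM lee_fin.
        have -> : (12 * L) `^ lambda * k * (12 * L) `^ sigma =
            12 * L * k * (12 * L) `^ (lambda + sigma - 1).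
          have LD w v : (12 * L) `^ w * (12 * L) `^ v = (12 * L) `^ (w + v).
            by rewrite powRD // (gt_eqF L12) implybT.
          have LE : (12 * L) `^ (lambda + sigma) = 12 * L * (12 * L) `^ (lambda + sigma - 1).
            rewrite -[X in _ = X * _](powRr1 (ltW L12)) LD.
            by congr (_ `^ _); rewrite addrCA subrr addr0.
          by rewrite mulrAC LD LE mulrAC.
        apply: (@le_trans _ _ (12 * L * k * ((2 * n%:R + 1) / (6 * k)))).
          rewrite (_ : 12 * L * k * _ = 2 * (2 * n%:R * L) + 2 * L).
            by rewrite lerD2l ler_peMr.
          by field; rewrite gt_eqF.
        by apply: ler_wpM2l HL; rewrite mulr_ge0 // ltW.
      apply: lee_pmul.
      * rewrite lee_fin; exact: (mulr_ge0 (powR_ge0 _ _) (ltW k0)).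
      * rewrite lee_fin; exact: powR_ge0.
      * by move: cB; rewrite -mulrA.
      * by rewrite lee_fin; exact: uL.
have /bigO_at0P[K K0 [s ss0 Hs]] := H u sol.
have := @cvg_geometric R 1 2^-1.
rewrite ger0_norm ?invr_ge0 // => /(_ h1) hc.
have [N _ HN] := cvgr_lt _ hc _ ss0.
(* [j >= N] brings the centre within distance [s] of [0], and [j + 1 > K] contradicts the supposed
   bound there. *)
pose j := maxn N (Num.trunc K).+1.
have pjs : p j < s.
  apply: le_lt_trans (HN j (leq_maxl _ _)); rewrite /geometric /= mul1r.
  by rewrite /p exprS ler_piMl ?exprn_ge0 // ltW.
have cj0 : c j != 0 by rewrite -normr_eq0 c_norm gt_eqF.
have := Hs (c j) (conj cj0 _); rewrite c_norm c_enorm => /(_ pjs).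
have php : 0 < phi (p j) by apply: phi0; rewrite p0 p1.
rewrite !ger0_norm ?(ltW php) // => hu.
have [[_ _ _ hA] _] := Hb j.
have := le_trans hA (le_trans (ub j (c j)) hu).
rewrite ler_pM2r // leNgt => /negP; apply.
apply: lt_le_trans (truncnS_gt K) _.
rewrite ler_nat; apply: leq_trans (leqnSn _); exact: leq_maxr.
Qed.

(** * Bumps *)

(** For [k = (n - 2) / 2] the height is [eps r^(2-n)], and outside the core of radius [r], before
    the cutoff, the bump behaves like [eps |x - c|^(2-n)]: [eps] controls the far field, [r] the
    height. *)
Definition bump {R : realType} {n : nat} (k eps r rho : R) (c x : 'rV[R]_n) : R :=
  eps * (pcut (sq (x - c) * rho ^- 2) * (r ^+ 2 + sq (x - c)) `^ (- k)).

Section Bump.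
Context {R : realType} {n : nat}.
Local Notation V := ('rV[R]_n).

Lemma bump_eq (k eps r rho : R) (c x : V) : 0 < rho -> sq (x - c) <= rho ^+ 2 / 4 ->
  bump k eps r rho c x = eps * (r ^+ 2 + sq (x - c)) `^ (- k).
Proof.
move=> rho0 h; rewrite /bump.
have [|-> _ _] := @pcut_eq1 R (sq (x - c) * rho ^- 2); last by rewrite mul1r.
by rewrite ler_pdivrMr ?exprn_gt0 // mulrC mulrA mulr1.
Qed.

Lemma bump_out (k eps r rho : R) (c x : V) : 0 < rho -> rho <= `|x - c| ->
  bump k eps r rho c x = 0.
Proof.
move=> rho0 h; rewrite /bump.
have [|-> _ _] := @pcut_eq0 R (sq (x - c) * rho ^- 2); last by rewrite mul0r mulr0.
rewrite ler_pdivlMr ?exprn_gt0 // mul1r; apply: le_trans (norm_le_sq _).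
by rewrite ler_pXn2r // nnegrE // ltW.
Qed.

Lemma bump_le (k eps r rho : R) (c x : V) : 0 < eps ->
  0 <= bump k eps r rho c x <= eps * (r ^+ 2 + sq (x - c)) `^ (- k).
Proof.
move=> e0; rewrite /bump; have /andP[p0 p1] := pcut_bnd (sq (x - c) * rho ^- 2).
have h := powR_ge0 (r ^+ 2 + sq (x - c)) (- k).
apply/andP; split; first exact: (mulr_ge0 (ltW e0) (mulr_ge0 p0 h)).
rewrite (ler_pM2l e0) -[leRHS]mul1r; exact: (ler_wpM2r h p1).
Qed.

Lemma bump_center (k eps r rho : R) (c : V) : 0 < rho ->
  bump k eps r rho c c = eps * (r ^+ 2) `^ (- k).
Proof.
move=> rho0; rewrite bump_eq // subrr sq_eq0 ?addr0 //.
by rewrite divr_ge0 // exprn_ge0 // ltW.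
Qed.

Lemma bump_laplacian (k : R) : (3 <= n)%N -> k = (n%:R - 2) / 2 ->
  exists2 C : R, 0 < C & forall (eps r rho : R) (c : V), 0 < eps -> 0 < r -> 0 < rho ->
  Ck 2 setT (bump k eps r rho c) /\ forall x,
  - (C * eps * rho ^- n) <= - laplacian (bump k eps r rho c) x <=
    C * eps * (rho ^- n + r ^+ 2 * (r ^+ 2 + sq (x - c)) `^ (- k - 1 - 1)).
Proof.
move=> n3 kE; have n3' : 3 <= n%:R :> R by rewrite ler_nat.
have k0 : 0 < k by rewrite kE; lra.
have [C0 C00 HC] := @bubble_profile R n k n3 kE.
pose D := 2 * n%:R * k; have D0 : 0 < D by rewrite !mulr_gt0 // ltr0n; exact: leq_trans n3.
exists (C0 + D); first exact: addr_gt0.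
move=> eps r rho c e0 r0 rho0; have [b1 [b2 [Hb Eb]]] := HC r rho r0 rho0.
have H := C2on_scale 0 eps Hb.
have E : bump k eps r rho c = (fun x => 0 + eps *
    (pcut (sq (x - c) * rho ^- 2) * (r ^+ 2 + sq (x - c)) `^ (- k))).
  by apply/funext => x; rewrite add0r.
split; first by rewrite E; exact: (Ck2_radial c H).
move=> x; have -> : laplacian (bump k eps r rho c) x = eps * rlap n b1 b2 (sq (x - c)).
  by rewrite E (laplacian_radial c H) rlapE; ring.
have := Eb _ (sq_ge0 (x - c)); rewrite (powR_sqr_Nk kE rho0).
have rn0 : 0 < rho ^- n by rewrite invr_gt0 exprn_gt0.
set P := pcut _ * _ => h; have {}h : `|rlap n b1 b2 (sq (x - c)) + P| <= C0 * rho ^- n.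
  apply: le_trans h _; case: ifP => _; first exact: lexx.
  exact: (mulr_ge0 (ltW C00) (ltW rn0)).
pose Q := r ^+ 2 * (r ^+ 2 + sq (x - c)) `^ (- k - 1 - 1); rewrite -/Q.
have Q0 : 0 <= Q by exact: (mulr_ge0 (exprn_ge0 2 (ltW r0)) (powR_ge0 _ _)).
have /andP[P0 PQ] : 0 <= P <= D * Q.
  rewrite /P -(mulrA D); have /andP[p0 p1] := pcut_bnd (sq (x - c) * rho ^- 2).
  have DQ := mulr_ge0 (ltW D0) Q0; rewrite -/Q.
  apply/andP; split; first exact: (mulr_ge0 p0 DQ).
  by rewrite -[leRHS]mul1r; exact: (ler_wpM2r DQ p1).
move: h; rewrite ler_norml => /andP[h1 h2].
have g1 := mulr_ge0 (ltW C00) Q0; have g2 := mulr_ge0 (ltW D0) (ltW rn0).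
clearbody P Q D; clear HC Hb Eb H E.
have lo : - ((C0 + D) * rho ^- n) <= - rlap n b1 b2 (sq (x - c)).
  by rewrite mulrDl; move: h1 h2 P0 PQ g1 g2; move: (C0 * rho ^- n) (D * rho ^- n); clra.
have up : - rlap n b1 b2 (sq (x - c)) <= (C0 + D) * (rho ^- n + Q).
  rewrite mulrDl !mulrDr; move: h1 h2 P0 PQ g1 g2.
  by move: (C0 * rho ^- n) (D * rho ^- n) (C0 * Q) (D * Q); clra.
move: (rho ^- n) (rlap n b1 b2 (sq (x - c))) (C0 + D) lo up => w v B lo up.
have -> : - (B * eps * w) = eps * - (B * w) by ring.
have -> : B * eps * (w + Q) = eps * (B * (w + Q)) by ring.
by rewrite -[X in _ <= X <= _]mulrN !(ler_pM2l e0) lo up.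
Qed.

(** The power [- k l] of [r^2 + s] splits into [q / 2 - k l], bounded by the same power of [r^2],
    and [- q / 2], bounded by the integrable [|x - c|^(-q)]. The parameter [q] covers both regimes:
    [2 k l] in the critical case, slightly below [n] in the steep one. *)
Lemma integral_bump (k l q : R) : (0 < n)%N -> 0 < l -> 0 < q -> q < n%:R ->
  q <= 2 * (k * l) -> exists2 C : R, 0 < C &
  forall (eps r rho : R) (c : V), 0 < eps -> 0 < r -> 0 < rho -> rho <= 1 ->
  measurable_fun setT (bump k eps r rho c) ->
  (\int[leb]_x (bump k eps r rho c x `^ l)%:E <=
    (C * eps `^ l * (r ^+ 2) `^ (q / 2 - k * l))%:E)%E.
Proof.
move=> n0 l0 q0 qn qkl; have [C C0 HC] := @integral_norm_powR R n _ n0 q0 qn.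
exists C => // eps r rho c e0 r0 rho0 rho1 mb.
have r2 : 0 < r ^+ 2 by rewrite exprn_gt0.
pose M := eps `^ l * (r ^+ 2) `^ (q / 2 - k * l).
have M0 : 0 <= M by exact: (mulr_ge0 (powR_ge0 _ _) (powR_ge0 _ _)).
have mbl : measurable_fun setT (fun x => (bump k eps r rho c x `^ l)%:E).
  by apply/measurable_EFinP; exact: (measurableT_comp (measurable_powR l)).
have bl0 x : (0 <= (bump k eps r rho c x `^ l)%:E)%E by rewrite lee_fin powR_ge0.
have mC := measurable_cube c rho.
have -> : (\int[leb]_x (bump k eps r rho c x `^ l)%:E =
    \int[leb]_(x in cube c rho) (bump k eps r rho c x `^ l)%:E)%E.
  rewrite [RHS]integral_mkcond; apply: eq_integral => x _; rewrite patchE.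
  case: ifPn => //; rewrite notin_setE /cube /= => /negP; rewrite -leNgt => h.
  by rewrite (bump_out _ _ _ rho0 h) powR0 // gt_eqF.
rewrite (@ge0_integralD1 R n _ c _ n0 mC (measurable_funTS mbl) (fun x _ => bl0 x)).
have mCc : measurable (cube c rho `\` [set c]).
  by apply: measurableD => //; exact: measurable_set1_rV.
have mk D : measurable_fun D (fun x : V => (`|x - c| `^ (- q))%:E).
  by apply/measurable_EFinP; apply: measurable_funTS; exact: measurable_norm_powR.
apply: (@le_trans _ _ (\int[leb]_(x in cube c rho `\` [set c])
    (M%:E * (`|x - c| `^ (- q))%:E))%E).
  apply: ge0_le_integral.
  - exact: mCc.
  - by move=> x _; exact: bl0.
  - exact: measurable_funTS.
  - exact: measurable_funeM.
  - move=> x [_ /eqP xc]; rewrite -EFinM lee_fin.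
    have /andP[b0 b1] := bump_le k r rho c x e0.
    have s0 : 0 < sq (x - c) by exact: sq_sub_gt0.
    have rs : 0 < r ^+ 2 + sq (x - c) by exact: addr_gt0.
    apply: (@le_trans _ _ ((eps * (r ^+ 2 + sq (x - c)) `^ (- k)) `^ l)).
      apply: (ge0_ler_powR (ltW l0)) b1; rewrite nnegrE //.
      exact: (mulr_ge0 (ltW e0) (powR_ge0 _ _)).
    rewrite powRM ?(ltW e0) ?powR_ge0 // /M -mulrA; apply: ler_wpM2l; first exact: powR_ge0.
    rewrite -powRrM mulNr.
    have -> : (r ^+ 2 + sq (x - c)) `^ (- (k * l)) =
        (r ^+ 2 + sq (x - c)) `^ (q / 2 - k * l) * (r ^+ 2 + sq (x - c)) `^ (- (q / 2)).
      rewrite -powRD; last by rewrite (gt_eqF rs) implybT.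
      by congr (_ `^ _); ring.
    apply: ler_pM; rewrite ?powR_ge0 //.
      apply: powR_le => //; first by rewrite lerDl ltW.
      by move: qkl; lra.
    apply: (@le_trans _ _ (sq (x - c) `^ (- (q / 2)))).
      by apply: powR_le => //; [rewrite lerDr ltW|rewrite oppr_le0 divr_ge0 // ltW].
    have -> : q = 2 * (q / 2) by field.
    have -> : 2 * (q / 2) / 2 = q / 2 by field.
    by apply: powR_sqr_norm; [rewrite divr_gt0|rewrite subr_eq0].
rewrite (ge0_integralZl_EFin leb mCc); first last.
- exact: M0.
- exact: mk.
- by move=> x _; rewrite lee_fin powR_ge0.
have -> : C * eps `^ l * (r ^+ 2) `^ (q / 2 - k * l) = M * C by rewrite /M; ring.
rewrite [X in (_ <= X)%E]EFinM; apply: lee_wpmul2l; first by rewrite lee_fin.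
apply: le_trans (_ : _ <= (C * rho `^ (n%:R - q))%:E)%E _.
  apply: le_trans (HC c rho rho0); apply: ge0_subset_integral.
  - exact: mCc.
  - exact: mC.
  - exact: mk.
  - by move=> x _; rewrite lee_fin powR_ge0.
  - by move=> x [].
rewrite lee_fin ler_piMr ?(ltW C0) //.
have nq : 0 <= n%:R - q by rewrite subr_ge0 ltW.
move: (n%:R - q) nq => w nq.
have -> : 1 = 1 `^ w :> R by rewrite powR1.
by apply: (ge0_ler_powR nq) => //; rewrite nnegrE ltW.
Qed.

End Bump.

Local Opaque bump.

(** * Choice of the parameters of the bumps *)

Lemma powR_small (R : realType) (e d : R) : 0 < e -> 0 < d ->
  exists2 r0, 0 < r0 & forall r, 0 < r -> r <= r0 -> r `^ e <= d.
Proof.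
move=> e0 d0; exists (d `^ e^-1); first by rewrite powR_gt0.
move=> r r0 rd; apply: (@le_trans _ _ ((d `^ e^-1) `^ e)).
  by apply: (ge0_ler_powR (ltW e0)) rd; rewrite nnegrE ?powR_ge0 // ltW.
by rewrite -powRrM mulVf ?gt_eqF // powRr1 // ltW.
Qed.

Lemma sq_sub_le (R : realType) (n : nat) (rho : R) (x c : 'rV[R]_n) : (0 < n)%N ->
  0 < rho -> `|x - c| <= rho / (2 * n%:R) -> sq (x - c) <= rho ^+ 2 / 4.
Proof.
move=> n0 rho0 h; have nR0 : 0 < n%:R :> R by rewrite ltr0n.
have n1 : 1 <= n%:R :> R by rewrite ler1n.
apply: le_trans (sq_le_norm _) _.
have h2 : `|x - c| ^+ 2 <= (rho / (2 * n%:R)) ^+ 2.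
  by apply: lerXn2r => //; rewrite nnegrE // divr_ge0 ?mulr_ge0 // ltW.
apply: (@le_trans _ _ (n%:R * (rho / (2 * n%:R)) ^+ 2)); first by rewrite ler_pM2l.
have -> : n%:R * (rho / (2 * n%:R)) ^+ 2 = (rho ^+ 2 / 4) / n%:R.
  by field; rewrite gt_eqF.
rewrite ler_pdivrMr // ler_peMr //.
by rewrite divr_ge0 // exprn_ge0 // ltW.
Qed.

(** The bump has height [r^(-m)], and [t] plays the role of the distance, with [t >= r]. The
    left-hand side decays like [t^(-n-2)], the right-hand side like [t^(-a)], so [t = r] is the
    worst case, where the inequality becomes the last hypothesis. *)
Lemma steep_bump_arith (R : realType) (n k a l m C c r t : R) : k = (n - 2) / 2 ->
  0 < r -> r <= t -> 0 < C -> a <= n + 2 -> 0 <= c ->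
  C * r `^ (m * (l - 1) - (n + 2 - a)) <= 2^-1 * c ->
  C * (r `^ (2 * k - m) * (r ^+ 2 * (t ^+ 2) `^ (- k - 1 - 1))) <=
  2^-1 * ((r `^ (2 * k - m) * (r ^+ 2) `^ (- k)) `^ l * (c * t `^ (- a) * r `^ n)).
Proof.
move=> kE r0 rt C0 an c0 H; have t0 := lt_le_trans r0 rt.
have D (s x y : R) : 0 < s -> s `^ x * s `^ y = s `^ (x + y).
  by move=> s0; rewrite powRD // (gt_eqF s0) implybT.
have S (s x : R) : 0 < s -> (s ^+ 2) `^ x = s `^ (2 * x).
  by move=> s0; rewrite -powR_mulrn ?(ltW s0) // -powRrM.
rewrite !S // D // (_ : 2 * k - m + 2 * - k = - m); last by ring.
have -> : r ^+ 2 = r `^ 2 by rewrite -[2]/(2%:R) powR_mulrn // ltW.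
have -> : 2 * (- k - 1 - 1) = - a + - (n + 2 - a) by rewrite kE; field.
have -> : C * (r `^ (2 * k - m) * (r `^ 2 * t `^ (- a + - (n + 2 - a)))) =
    C * (r `^ (2 * k - m) * r `^ 2 * t `^ (- a + - (n + 2 - a))) by ring.
rewrite D // -(D t) // -powRrM (_ : 2 * k - m + 2 = n - m); last by rewrite kE; field.
have h : t `^ (- (n + 2 - a)) <= r `^ (- (n + 2 - a)).
  by apply: powR_le => //; rewrite oppr_le0 subr_ge0.
have P0 : 0 <= C * (r `^ (n - m) * t `^ (- a)).
  exact: (mulr_ge0 (ltW C0) (mulr_ge0 (powR_ge0 _ _) (powR_ge0 _ _))).
apply: (@le_trans _ _ (C * (r `^ (n - m) * t `^ (- a)) * r `^ (- (n + 2 - a)))).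
  by move: (ler_wpM2l P0 h); rewrite -!mulrA.
have -> : C * (r `^ (n - m) * t `^ (- a)) * r `^ (- (n + 2 - a)) =
    C * r `^ (m * (l - 1) - (n + 2 - a)) * (r `^ (- m * l) * t `^ (- a) * r `^ n).
  have -> : C * r `^ (m * (l - 1) - (n + 2 - a)) * (r `^ (- m * l) * t `^ (- a) * r `^ n) =
    C * t `^ (- a) * (r `^ (m * (l - 1) - (n + 2 - a)) * r `^ (- m * l) * r `^ n) by ring.
  have -> : C * (r `^ (n - m) * t `^ (- a)) * r `^ (- (n + 2 - a)) =
    C * t `^ (- a) * (r `^ (n - m) * r `^ (- (n + 2 - a))) by ring.
  by rewrite !D //; congr (_ * _ `^ _); ring.
have -> : 2^-1 * (r `^ (- m * l) * (c * t `^ (- a) * r `^ n)) =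
    2^-1 * c * (r `^ (- m * l) * t `^ (- a) * r `^ n) by ring.
apply: (ler_wpM2r _ H).
exact: (mulr_ge0 (mulr_ge0 (powR_ge0 _ _) (powR_ge0 _ _)) (powR_ge0 _ _)).
Qed.

Lemma riesz_conv_bump_core (R : realType) (n : nat) (a l k : R) : (0 < n)%N ->
  0 < a -> 0 < l -> 0 < k -> exists2 C : R, 0 < C &
  forall (eps r rho t : R) (c x : 'rV[R]_n), 0 < eps -> 0 < r -> 0 < rho ->
  r <= rho / (2 * n%:R) -> `|x - c| <= t -> r <= t ->
  measurable_fun setT (bump k eps r rho c) ->
  (((eps * (r ^+ 2) `^ (- k)) `^ l * (C * t `^ (- a) * r `^ n%:R))%:E <=
    riesz_conv a l (bump k eps r rho c) x)%E.
Proof.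
move=> n0 a0 l0 k0; have nR0 : 0 < n%:R :> R by rewrite ltr0n.
have m0 : 0 < n%:R + 1 :> R by rewrite addr_gt0.
exists (((n%:R + 1) `^ (- k)) `^ l * (2 * n%:R) `^ (- a) * 2 ^+ n).
  by rewrite !mulr_gt0 ?powR_gt0 ?exprn_gt0 // mulr_gt0.
move=> eps r rho t c x e0 r0 rho0 rr xt rt mb.
have t0 : 0 < t := lt_le_trans r0 rt.
have r2 : 0 < r ^+ 2 by rewrite exprn_gt0.
have b0 (y : 'rV[R]_n) : cube c r y ->
    eps * ((n%:R + 1) * r ^+ 2) `^ (- k) <= bump k eps r rho c y.
  rewrite /cube /= => yr.
  rewrite bump_eq //; last first.
    by apply: sq_sub_le => //; exact: le_trans (ltW yr) rr.
  rewrite ler_pM2l //; apply: powR_le.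
  - by apply: ltr_wpDr r2; exact: sq_ge0.
  - rewrite mulrDl mul1r addrC lerD2r; apply: le_trans (sq_le_norm _) _.
    by rewrite ler_pM2l //; apply: lerXn2r; rewrite ?nnegrE ?(ltW r0) ?(ltW yr).
  - by rewrite oppr_le0 ltW.
have et (y : 'rV[R]_n) : cube c r y -> enorm (x - y) <= 2 * n%:R * t.
  rewrite /cube /= => yr; apply: le_trans (enorm_le_norm _) _.
  rewrite [2 * _]mulrC -mulrA ler_pM2l // mulr_natl mulr2n.
  have -> : x - y = (x - c) - (y - c) by rewrite opprB addrA subrK.
  apply: le_trans (ler_normB _ _) _; apply: lerD xt _.
  exact: le_trans (ltW yr) rt.
have m0' : 0 <= eps * ((n%:R + 1) * r ^+ 2) `^ (- k).
  exact: (mulr_ge0 (ltW e0) (powR_ge0 _ _)).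
have := @riesz_conv_ge_cube R n a l a0 l0 _ c x r _ _ n0 mb r0 m0' b0 et.
apply: le_trans; rewrite lee_fin le_eqVlt; apply/orP; left; apply/eqP.
have k1 := powR_ge0 (n%:R + 1 : R) (- k); have k2 := powR_ge0 (r ^+ 2) (- k).
have -> : eps * ((n%:R + 1) * r ^+ 2) `^ (- k) =
    (eps * (r ^+ 2) `^ (- k)) * (n%:R + 1) `^ (- k).
  by rewrite powRM ?(ltW m0) ?(ltW r2) //; ring.
have ek := mulr_ge0 (ltW e0) k2.
have n20 : 0 <= 2 * n%:R :> R by rewrite mulr_ge0.
rewrite (powRM l ek k1) (powRM (- a) n20 (ltW t0)) (powR_mulrn n (ltW r0)) exprMn.
move: ((eps * _) `^ l) (((n%:R + 1) `^ (- k)) `^ l) ((2 * n%:R) `^ (- a)) (t `^ (- a)).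
by move: (2 ^+ n) (r ^+ n) => *; ring.
Qed.

Lemma has_bumps_steep (R : realType) (n : nat) (alpha lambda : R) : (3 <= n)%N ->
  2 < alpha -> alpha < n%:R -> n%:R / (alpha - 2) < lambda ->
  has_bumps n alpha lambda 0.
Proof.
move=> n3 a2 an la; have n0 : (0 < n)%N by exact: leq_trans n3.
have nR0 : 0 < n%:R :> R by rewrite ltr0n.
have n3' : 3 <= n%:R :> R by rewrite ler_nat.
pose k : R := (n%:R - 2) / 2.
have k0 : 0 < k by rewrite divr_gt0 //; move: n3'; clra.
have a20 : 0 < alpha - 2 by rewrite subr_gt0.
have a0 : 0 < alpha by move: a2; clra.
have lN : n%:R < lambda * (alpha - 2) by rewrite -ltr_pdivrMr.
have l1 : 1 < lambda.
  apply: lt_trans la; rewrite ltr_pdivlMr // mul1r; move: an; clra.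
have l0 : 0 < lambda by move: l1; clra.
have l10 : 0 < lambda - 1 by rewrite subr_gt0.
have na : 0 < n%:R + 2 - alpha by move: an; clra.
(* [m > lo] makes the convolution dominate the Laplacian as [r] tends to [0]; [m < hi] makes the
   mass, of order [r^(n - m lambda)] for the core, vanish. The inequality [lo < hi] is the
   hypothesis [n < lambda (alpha - 2)]. *)
pose lo := (n%:R + 2 - alpha) / (lambda - 1); pose hi := n%:R / lambda.
have lohi : lo < hi.
  rewrite /lo /hi ltr_pdivrMr // mulrAC ltr_pdivlMr //.
  by move: lN; rewrite mulrC; lra.
pose m := (lo + hi) / 2.
have mlo : lo < m by rewrite /m; lra.
have mhi : m < hi by rewrite /m; lra.
have m0 : 0 < m by apply: lt_trans mlo; rewrite divr_gt0.
have ml : m * lambda < n%:R by rewrite -ltr_pdivlMr.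
have mlo' : n%:R + 2 - alpha < m * (lambda - 1) by rewrite -ltr_pdivrMr.
have hik : hi < 2 * k.
  rewrite /hi ltr_pdivrMr // (_ : 2 * k = n%:R - 2); last by rewrite /k; field.
  by apply: lt_trans lN _; rewrite mulrC ltr_pM2r //; move: an; clra.
have mk : m < 2 * k by exact: lt_trans mhi hik.
(* The bound of [integral_bump] is a multiple of [r^(q - m lambda)]: [q] must lie strictly between
   [m lambda] and [n]. *)
pose q := (m * lambda + n%:R) / 2.
have q1 : m * lambda < q by rewrite /q; move: ml; clra.
have q2 : q < n%:R by rewrite /q; move: ml; clra.
have q0 : 0 < q by apply: lt_trans q1; rewrite mulr_gt0.
have qkl : q <= 2 * (k * lambda).
  apply: (le_trans (ltW q2)); rewrite mulrA.
  by rewrite -ler_pdivrMr //; exact: ltW hik.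
have [C C0 HC] := @bump_laplacian R n k n3 erefl.
have [Ci Ci0 HCi] := @integral_bump R n k lambda q n0 l0 q0 q2 qkl.
have [Cc Cc0 HCc] := @riesz_conv_bump_core R n alpha lambda k n0 a0 l0 k0.
move=> rho delta A c rho0 rho1 d0.
clearbody m q lo hi.
have p1 : 0 < 2 * k - m by rewrite subr_gt0.
have p2 : 0 < q - m * lambda by rewrite subr_gt0.
have p3 : 0 < m * (lambda - 1) - (n%:R + 2 - alpha) by rewrite subr_gt0.
have rn0 : 0 < rho ^+ n by rewrite exprn_gt0.
have d1 : 0 < rho ^+ n / C by rewrite divr_gt0.
have d2 : 0 < delta / Ci by rewrite divr_gt0.
have d3 : 0 < (2^-1 * Cc) / C by rewrite divr_gt0 // mulr_gt0 // invr_gt0.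
have d4 : 0 < (`|A| + 1)^-1 by rewrite invr_gt0 ltr_wpDl.
have [r1 r10 H1] := powR_small p1 d1; have [r2 r20 H2] := powR_small p2 d2.
have [r3 r30 H3] := powR_small p3 d3; have [r4 r40 H4] := powR_small m0 d4.
have d5 : 0 < rho / (2 * n%:R) by rewrite divr_gt0 // mulr_gt0.
(* The core must fit in the plateau of the cutoff; [r1] controls the cutoff error, [r2] the mass,
   [r3] the comparison of Laplacian and convolution, [r4] the height. *)
pose r := Num.min (rho / (2 * n%:R)) (Num.min (Num.min r1 r2) (Num.min r3 r4)).
have r0 : 0 < r by rewrite !lt_min d5 r10 r20 r30 r40.
have /and4P[rr rr1 rr2 /andP[rr3 rr4]] : [&& r <= rho / (2 * n%:R), r <= r1, r <= r2 &
    (r <= r3) && (r <= r4)].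
  have := lexx r; rewrite {2}/r !le_min => /andP[-> /andP[/andP[-> ->] /andP[-> ->]]].
  by [].
have {H1}h1 := H1 r r0 rr1; have {H2}h2 := H2 r r0 rr2.
have {H3}h3 := H3 r r0 rr3; have {H4}h4 := H4 r r0 rr4.
clearbody r; clear r1 r2 r3 r4 r10 r20 r30 r40 rr1 rr2 rr3 rr4.
pose eps := r `^ (2 * k - m); have e0 : 0 < eps by rewrite powR_gt0.
have [Cb Hb] := HC eps r rho c e0 r0 rho0.
have mb : measurable_fun setT (bump k eps r rho c).
  by apply: continuous_measurable_rV => x; have /Ck2P[h _] := Cb; exact: h.
have rD x y : r `^ x * r `^ y = r `^ (x + y) by rewrite powRD // (gt_eqF r0) implybT.
have rS x : (r ^+ 2) `^ x = r `^ (2 * x).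
  by rewrite -powR_mulrn ?(ltW r0) // -powRrM.
have err : C * eps * rho ^- n <= 1.
  by move: h1; rewrite ler_pdivlMr // mulrC ler_pdivrMr // mul1r.
exists (bump k eps r rho c); split; split.
- exact: Cb.
- by move=> x; have /andP[h _] := bump_le k r rho c x e0.
- by move=> x; exact: bump_out.
- rewrite bump_center // rS rD (_ : 2 * k - m + 2 * - k = - m); last by ring.
  rewrite powRN; apply: (@le_trans _ _ (`|A| + 1)).
    by apply: le_trans (ler_norm A) _; rewrite lerDl.
  by rewrite -[leLHS]invrK lef_pV2 // posrE ?powR_gt0.
- move=> x; have /andP[h _] := Hb x; apply: le_trans h; rewrite lerN2; exact: err.
- apply: le_trans (HCi eps r rho c e0 r0 rho0 rho1 mb) _.
  rewrite lee_fin rS -powRrM -mulrA rD.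
  rewrite (_ : (2 * k - m) * lambda + 2 * (q / 2 - k * lambda) = q - m * lambda); last by field.
  by rewrite mulrC -ler_pdivlMr.
- move=> x; rewrite powRr0 mule1.
  pose T := r ^+ 2 + sq (x - c); pose t := Num.sqrt T.
  have T0 : 0 <= T by rewrite addr_ge0 ?sq_ge0 // exprn_ge0 // ltW.
  have tE : t ^+ 2 = T by rewrite sqr_sqrtr.
  have t0 : 0 <= t by exact: sqrtr_ge0.
  have rt : r <= t.
    by rewrite -(ler_pXn2r (isT : (0 < 2)%N)) ?nnegrE ?(ltW r0) // tE lerDl sq_ge0.
  have xt : `|x - c| <= t.
    rewrite -(ler_pXn2r (isT : (0 < 2)%N)) ?nnegrE // tE.
    by apply: le_trans (norm_le_sq _) _; rewrite lerDr exprn_ge0 // ltW.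
  have hc := HCc eps r rho t c x e0 r0 rho0 rr xt rt mb.
  have /andP[_ hl] := Hb x.
  have h3' : C * r `^ (m * (lambda - 1) - (n%:R + 2 - alpha)) <= 2^-1 * Cc.
    by rewrite mulrC -ler_pdivlMr.
  have na' : alpha <= n%:R + 2 by rewrite -subr_ge0 ltW.
  have ar := steep_bump_arith (erefl k) r0 rt C0 na' (ltW Cc0) h3'.
  rewrite tE -/eps in ar; rewrite -/T in hl.
  apply: (@le_trans _ _ (2^-1 * ((eps * (r ^+ 2) `^ (- k)) `^ lambda *
      (Cc * t `^ (- alpha) * r `^ n%:R)) + 1)%:E).
    rewrite lee_fin; apply: le_trans hl _; rewrite mulrDr addrC; apply: lerD; last exact: err.
    by rewrite -mulrA; exact: ar.
  rewrite EFinD EFinM; apply: leeD; last exact: lexx.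
  by apply: lee_wpmul2l hc; rewrite lee_fin invr_ge0.
Qed.

(* Each of the dyadic annuli [2^-(i+1) s <= |y - c| < 2^-i s] contributes the same amount. *)
Lemma riesz_conv_bump_shells (R : realType) (n : nat) (a l k : R) : (0 < n)%N ->
  0 < a -> 0 < l -> 0 < k -> 2 * k * l + a = n%:R -> exists2 C : R, 0 < C &
  forall (eps r rho : R) (c x : 'rV[R]_n) (K : nat), 0 < eps -> 0 < r -> 0 < rho ->
  r <= rho / (2 * n%:R) * 2^-1 ^+ K -> `|x - c| <= rho / (2 * n%:R) * 2^-1 ^+ K ->
  measurable_fun setT (bump k eps r rho c) ->
  ((eps `^ l * (C * K%:R))%:E <= riesz_conv a l (bump k eps r rho c) x)%E.
Proof.
move=> n0 a0 l0 k0 nE; have nR0 : 0 < n%:R :> R by rewrite ltr0n.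
have m0 : 0 < n%:R + 1 :> R by rewrite addr_gt0.
pose C := ((n%:R + 1) `^ (- k)) `^ l * (2 * n%:R) `^ (- a) * (4^-1 ^+ n : R).
have C0 : 0 < C.
  by rewrite !mulr_gt0 ?powR_gt0 ?exprn_gt0 ?invr_gt0 // mulr_gt0.
exists C => // eps r rho c x K e0 r0 rho0 rK xK mb.
pose s := rho / (2 * n%:R); have s0 : 0 < s by rewrite divr_gt0 // mulr_gt0.
rewrite -/s in rK xK.
have h0 : 0 < 2^-1 :> R by rewrite invr_gt0.
have h1 : 2^-1 <= 1 :> R by rewrite invf_le1 // ler1n.
pose t (i : nat) := s * 2^-1 ^+ i.
have t0 i : 0 < t i by rewrite mulr_gt0 // exprn_gt0.
have tS i : t i.+1 = t i / 2 by rewrite /t exprSr mulrA.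
have ts i : t i <= s by rewrite ler_piMr ?(ltW s0) // exprn_ile1 // ltW.
pose e : 'rV[R]_n := delta_mx 0 (Ordinal n0).
(* A cube of radius [t i / 8] centred at distance [3/4 t i] lies between distances [5/8 t i] and
   [7/8 t i], inside the annulus, and has an explicit volume. *)
pose d i : 'rV[R]_n := c + (3 / 4 * t i) *: e.
pose Q i := cube (d i) (t i / 8).
have Qb i y : Q i y -> t i / 2 <= `|y - c| /\ `|y - c| < t i.
  rewrite /Q /cube /=; have de : `|(3 / 4 * t i) *: e| = 3 / 4 * t i.
    by rewrite normrZ normr_delta_mx mulr1 ger0_norm // mulr_ge0 // ltW.
  have -> : y - d i = (y - c) - (3 / 4 * t i) *: e by rewrite /d opprD addrA.
  move: (y - c) => z zi; have := ler_normD (z - (3 / 4 * t i) *: e) ((3 / 4 * t i) *: e).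
  rewrite subrK de; have := ler_normB z (z - (3 / 4 * t i) *: e).
  rewrite subKr de; move: zi (t0 i); move: (`|z - (3 / 4 * t i) *: e|) (`|z|) => w v.
  by move: (t i); clear; intros; split; lra.
pose g y := (bump k eps r rho c y `^ l * enorm (x - y) `^ (- a))%:E.
have mg : measurable_fun setT g by exact: measurable_riesz_integrand.
have g0 y : (0 <= g y)%E.
  by rewrite lee_fin; exact: (mulr_ge0 (powR_ge0 _ _) (powR_ge0 _ _)).
have gQ i : (i < K)%N -> ((eps `^ l * C)%:E <= \int[leb]_(y in Q i) g y)%E.
  move=> iK; have Kt : s * 2^-1 ^+ K <= t i.
    by rewrite ler_pM2l //; apply: ler_wiXn2l; rewrite ?(ltW h0) // ltnW.
  have t20 : 0 < t i ^+ 2 by rewrite exprn_gt0.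
  have r20 : 0 < r ^+ 2 by rewrite exprn_gt0.
  have bt y : Q i y -> eps * ((n%:R + 1) * t i ^+ 2) `^ (- k) <= bump k eps r rho c y.
    move=> /Qb[_ yt]; rewrite bump_eq //; last first.
      by apply: sq_sub_le => //; apply: le_trans (ltW yt) (ts i).
    rewrite ler_pM2l //; apply: powR_le.
    - by apply: ltr_wpDr r20; exact: sq_ge0.
    - rewrite mulrDl mul1r addrC; apply: lerD.
        apply: le_trans (sq_le_norm _) _; rewrite ler_pM2l //.
        by apply: lerXn2r; rewrite ?nnegrE ?(ltW yt) // ltW.
      by apply: lerXn2r; rewrite ?nnegrE ?(ltW r0) ?(ltW (t0 i)) // (le_trans rK).
    - by rewrite oppr_le0 ltW.
  have et y : Q i y -> enorm (x - y) <= 2 * n%:R * t i.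
    move=> /Qb[_ yt]; apply: le_trans (enorm_le_norm _) _.
    rewrite [2 * _]mulrC -mulrA ler_pM2l // mulr_natl mulr2n.
    have -> : x - y = (x - c) - (y - c) by rewrite opprB addrA subrK.
    apply: le_trans (ler_normB _ _) _; apply: lerD (ltW yt).
    exact: le_trans xK Kt.
  have b0 : 0 <= eps * ((n%:R + 1) * t i ^+ 2) `^ (- k).
    exact: (mulr_ge0 (ltW e0) (powR_ge0 _ _)).
  have t80 : 0 < t i / 8 by rewrite divr_gt0.
  apply: le_trans (@integral_riesz_ge_cube R n a l a0 l0 _ (d i) x _ _ _ n0 mb t80 b0 bt et).
  rewrite lee_fin le_eqVlt; apply/orP; left; apply/eqP.
  have n20 : 0 <= 2 * n%:R :> R by rewrite mulr_ge0.
  rewrite (powRM (- a) n20 (ltW (t0 i))) (powRM l (ltW e0) (powR_ge0 _ _)).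
  rewrite (powRM (- k) (ltW m0) (ltW t20)) (powRM l (powR_ge0 _ _) (powR_ge0 _ _)).
  (* Since [2 k l + a = n], all powers of [t i] cancel. *)
  have -> : ((t i ^+ 2) `^ (- k)) `^ l = t i `^ (- n%:R) * t i `^ a.
    rewrite -powRD; last by rewrite (gt_eqF (t0 i)) implybT.
    rewrite -powR_mulrn ?(ltW (t0 i)) // -!powRrM; congr (_ `^ _).
    by rewrite -nE; ring.
  have -> : 2 * (t i / 8) = t i * 4^-1 by field.
  have E1 : t i `^ a * t i `^ (- a) = 1.
    by rewrite -powRD ?subrr ?powRr0 // (gt_eqF (t0 i)) implybT.
  have E2 : t i `^ (- n%:R) * t i ^+ n = 1.
    rewrite -powR_mulrn ?(ltW (t0 i)) // -powRD ?addNr ?powRr0 //.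
    by rewrite (gt_eqF (t0 i)) implybT.
  rewrite exprMn /C; move: E1 E2.
  move: ((((n%:R + 1) `^ (- k)) `^ l)) ((2 * n%:R) `^ (- a)) (4^-1 ^+ n) (eps `^ l).
  move: (t i `^ a) (t i `^ (- a)) (t i `^ (- n%:R)) (t i ^+ n) => u1 u2 u3 u4 v1 v2 v3 v4 E1 E2.
  rewrite -[LHS]mulr1 -[LHS]mulr1 -{1}E1 -E2; ring.
pose A i : set 'rV[R]_n := [set y | t i <= `|y - c|].
have mA i : measurable (A i) by exact: measurable_set_ge (@norm_continuous_shift R n c).
have mQ i : measurable (Q i) by exact: measurable_cube.
have step j : (j <= K)%N -> ((eps `^ l * (C * j%:R))%:E <= \int[leb]_(y in A j) g y)%E.
  elim: j => [_|j IH jK].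
    by rewrite !mulr0; apply: integral_ge0 => y _; exact: g0.
  have sub : A j `|` Q j `<=` A j.+1.
    move=> y [yA|/Qb[h _]]; rewrite /A /= tS //.
    apply: le_trans yA; rewrite ler_pdivrMr // ler_peMr ?ler1n //; exact: ltW.
  have disj : [disjoint A j & Q j]%classic.
    apply/disj_setPS => y [yA /Qb[_ h]]; move: yA; rewrite /A /= leNgt h.
    by [].
  apply: (@le_trans _ _ (\int[leb]_(y in A j `|` Q j) g y)%E); last first.
    apply: ge0_subset_integral sub => //; first exact: measurableU.
    exact: measurable_funTS.
  rewrite ge0_integral_setU //; last exact: measurable_funTS.
  rewrite -natr1 mulrDr mulr1 mulrDr EFinD.
  by apply: leeD; [exact: IH (ltnW jK)|exact: gQ].
apply: le_trans (step K (leqnn K)) _.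
exact: riesz_conv_ge_integral (mA K) mb.
Qed.

(** The identity [k sigma = k + 1] makes the power [sigma] of the bump decay at the rate of the
    bound for its Laplacian, so only a constant has to be gained. The order of choices matters:
    [eps] fixes the cutoff error and the mass, the number [K] of scales then gains the constant, and
    [r] comes last. *)
Lemma has_bumps_critical (R : realType) (n : nat) (alpha : R) : (3 <= n)%N ->
  0 < alpha -> alpha < n%:R ->
  has_bumps n alpha ((n%:R - alpha) / (n%:R - 2)) (n%:R / (n%:R - 2)).
Proof.
move=> n3 a0 an; have n0 : (0 < n)%N by exact: leq_trans n3.
have nR0 : 0 < n%:R :> R by rewrite ltr0n.
have n3' : 3 <= n%:R :> R by rewrite ler_nat.
have n2 : 0 < n%:R - 2 :> R by move: n3'; clra.
pose k : R := (n%:R - 2) / 2.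
have k0 : 0 < k by rewrite divr_gt0.
set l := (n%:R - alpha) / (n%:R - 2); set sg := n%:R / (n%:R - 2).
have l0 : 0 < l by rewrite divr_gt0 // subr_gt0.
have sg0 : 0 < sg by rewrite divr_gt0.
have klE : 2 * k * l + alpha = n%:R by rewrite /k /l; field; rewrite gt_eqF.
have ksE : k * sg = k + 1 by rewrite /k /sg; field; rewrite gt_eqF.
have q0 : 0 < 2 * (k * l) by exact: (mulr_gt0 (ltr0n _ 2) (mulr_gt0 k0 l0)).
have qn : 2 * (k * l) < n%:R by rewrite mulrA -klE ltrDl.
have [C C0 HC] := @bump_laplacian R n k n3 erefl.
have [Ci Ci0 HCi] := @integral_bump R n k l _ n0 l0 q0 qn (lexx _).
have [Cc Cc0 HCc] := @riesz_conv_bump_shells R n alpha l k n0 a0 l0 k0 klE.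
clearbody l sg.
move=> rho delta A c rho0 rho1 d0.
have rn0 : 0 < rho ^+ n by rewrite exprn_gt0.
have d1 : 0 < rho ^+ n / (2 * C) by rewrite divr_gt0 // mulr_gt0.
have d2 : 0 < delta / Ci by rewrite divr_gt0.
have [e1 e10 H1] := powR_small l0 d2.
(* The first bound keeps the cutoff error at most [1/2]. The second keeps the mass at most [delta];
   that mass is bounded by [Ci eps^l], independently of [r]. *)
pose eps := Num.min (rho ^+ n / (2 * C)) e1.
have e0 : 0 < eps by rewrite lt_min d1.
have ee1 : eps <= rho ^+ n / (2 * C) by rewrite ge_min lexx.
have {H1}ee2 : eps `^ l <= delta / Ci by apply: H1 => //; rewrite ge_min lexx orbT.
clearbody eps; clear e1 e10.
have err : C * eps * rho ^- n <= 1 / 2.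
  rewrite ler_pdivrMr //; move: ee1; rewrite ler_pdivlMr ?mulr_gt0 //; move: C0; clra.
have els : 0 < eps `^ l * eps `^ sg by rewrite mulr_gt0 ?powR_gt0.
(* Enough scales for the lower bound [Cc K eps^l] of the convolution to exceed
   [2 C eps^(1 - sg)]. *)
pose K := (Num.trunc (2 * C * eps / (Cc * (eps `^ l * eps `^ sg)))).+1.
have HK : C * eps <= 2^-1 * (eps `^ l * (Cc * K%:R)) * eps `^ sg.
  have := ltW (truncnS_gt (2 * C * eps / (Cc * (eps `^ l * eps `^ sg)))).
  rewrite -/K (ler_pdivrMr _ _ (mulr_gt0 Cc0 els)).
  have -> : 2^-1 * (eps `^ l * (Cc * K%:R)) * eps `^ sg =
    2^-1 * (K%:R * (Cc * (eps `^ l * eps `^ sg))) by ring.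
  by rewrite -mulrA; move: (C * eps) (K%:R * _); clra.
clearbody K.
pose t := rho / (2 * n%:R) * 2^-1 ^+ K.
have t0 : 0 < t by rewrite mulr_gt0 ?exprn_gt0 ?divr_gt0 ?mulr_gt0 ?invr_gt0.
have k20 : 0 < 2 * k by rewrite mulr_gt0.
have two0 : 0 < 2 :> R by [].
have A10 : 0 < `|A| + 1 by rewrite ltr_wpDl.
have d3 : 0 < eps / (`|A| + 1) by rewrite divr_gt0.
have T0 : 0 < (t ^+ 2) `^ (- k - 1 - 1) by rewrite powR_gt0 // exprn_gt0.
have d4 : 0 < (1 / 2) / (C * eps * (t ^+ 2) `^ (- k - 1 - 1)).
  by rewrite divr_gt0 ?divr_gt0 // !mulr_gt0.
have [r1 r10 H1] := powR_small k20 d3; have [r2 r20 H2] := powR_small two0 d4.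
(* Below [t] there is room for [K] scales outside the core; [r1] makes the height at least [A], and
   [r2] makes the main part of the Laplacian at most [1/2] beyond distance [t]. *)
pose r := Num.min t (Num.min r1 r2).
have r0 : 0 < r by rewrite !lt_min t0 r10 r20.
have rt : r <= t by rewrite ge_min lexx.
have {H1}h1 : r `^ (2 * k) <= eps / (`|A| + 1).
  by apply: H1 => //; rewrite !ge_min lexx orbT.
have {H2}h2 : C * eps * (r ^+ 2 * (t ^+ 2) `^ (- k - 1 - 1)) <= 1 / 2.
  have := H2 r r0; rewrite !ge_min lexx !orbT => /(_ isT).
  rewrite -[X in r `^ X]/(2%:R) powR_mulrn ?(ltW r0) //.
  rewrite (ler_pdivlMr _ _ (mulr_gt0 (mulr_gt0 C0 e0) T0)).
  by rewrite mulrCA.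
clearbody r; clear r1 r2 r10 r20.
have r2 : 0 < r ^+ 2 by rewrite exprn_gt0.
have [Cb Hb] := HC eps r rho c e0 r0 rho0.
have mb : measurable_fun setT (bump k eps r rho c).
  by apply: continuous_measurable_rV => x; have /Ck2P[h _] := Cb; exact: h.
exists (bump k eps r rho c); split; split.
- exact: Cb.
- by move=> x; have /andP[h _] := bump_le k r rho c x e0.
- by move=> x; exact: bump_out.
- rewrite bump_center // -powR_mulrn ?(ltW r0) // -powRrM mulrN powRN.
  rewrite ler_pdivlMr ?powR_gt0 //; move: h1; rewrite ler_pdivlMr //.
  apply: le_trans; rewrite mulrC; apply: ler_wpM2l; first exact: powR_ge0.
  by apply: le_trans (ler_norm A) _; rewrite lerDl.
- move=> x; have /andP[h _] := Hb x; apply: le_trans h; rewrite lerN2.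
  apply: le_trans err _; rewrite ler_pdivrMr // mul1r ler1n //.
- apply: le_trans (HCi eps r rho c e0 r0 rho0 rho1 mb) _.
  rewrite lee_fin (_ : 2 * (k * l) / 2 - k * l = 0); last by field.
  by rewrite powRr0 mulr1 mulrC -ler_pdivlMr.
- move=> x; have /andP[_ hl] := Hb x.
  set T := r ^+ 2 + sq (x - c) in hl.
  have T0' : 0 < T by apply: ltr_wpDr r2; exact: sq_ge0.
  (* Within distance [t] the convolution over the [K] scales dominates; beyond it, half for the main
     term and half for the cutoff error add up to the allowed [1]. *)
  have [xt|xt] := leP `|x - c| t.
    have hc := HCc eps r rho c x K e0 r0 rho0 rt xt mb.
    have bx : bump k eps r rho c x = eps * T `^ (- k).
      rewrite bump_eq //; apply: sq_sub_le => //; apply: le_trans xt _.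
      rewrite ler_piMr ?divr_ge0 ?mulr_ge0 ?(ltW rho0) ?(ltW nR0) //.
      by rewrite exprn_ile1 ?invr_ge0 // invf_le1 // ler1n.
    have bs : bump k eps r rho c x `^ sg = eps `^ sg * T `^ (- k - 1).
      rewrite bx (powRM sg (ltW e0) (powR_ge0 _ _)) -powRrM mulNr ksE.
      by rewrite opprD.
    have up : r ^+ 2 * T `^ (- k - 1 - 1) <= T `^ (- k - 1).
      have -> : T `^ (- k - 1) = T * T `^ (- k - 1 - 1).
        by rewrite [in RHS](powRB1 _ T0') mulrCA divff ?mulr1 // gt_eqF.
      apply: ler_wpM2r; first exact: powR_ge0.
      by rewrite /T lerDl sq_ge0.
    have P0 : 0 <= T `^ (- k - 1) by exact: powR_ge0.
    apply: (@le_trans _ _ (2^-1 * ((eps `^ l * (Cc * K%:R)) *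
        bump k eps r rho c x `^ sg) + 1)%:E).
      rewrite lee_fin; apply: le_trans hl _; rewrite mulrDr addrC; apply: lerD.
        apply: (@le_trans _ _ (C * eps * T `^ (- k - 1))).
          by apply: ler_wpM2l up; exact: (mulr_ge0 (ltW C0) (ltW e0)).
        rewrite bs !mulrA; apply: (ler_wpM2r P0); rewrite -!mulrA.
        by move: HK; rewrite -!mulrA.
      by apply: le_trans err _; rewrite ler_pdivrMr // mul1r ler1n.
    rewrite EFinD [X in (X + _ <= _)%E]EFinM [X in ((_ * X) + _ <= _)%E]EFinM.
    apply: leeD; last exact: lexx.
    apply: lee_wpmul2l; first by rewrite lee_fin invr_ge0.
    by apply: lee_wpmul2r hc; rewrite lee_fin powR_ge0.
  apply: (@le_trans _ _ 1%:E).
    rewrite lee_fin; apply: le_trans hl _; rewrite mulrDr.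
    have tT : t ^+ 2 <= T.
      apply: (@le_trans _ _ (`|x - c| ^+ 2)).
        by apply: lerXn2r; rewrite ?nnegrE ?(ltW t0) // ltW.
      by apply: le_trans (norm_le_sq _) _; rewrite lerDr ltW.
    have : C * eps * (r ^+ 2 * T `^ (- k - 1 - 1)) <= 1 / 2.
      apply: le_trans h2; apply: ler_wpM2l; first exact: (mulr_ge0 (ltW C0) (ltW e0)).
      apply: ler_wpM2l; first exact: ltW.
      by apply: powR_le => //; [rewrite exprn_gt0|move: k0; clra].
    by move: err; move: (C * eps * rho ^- n) (C * eps * _); clra.
  rewrite -[leLHS]add0e; apply: leeD; last exact: lexx.
  rewrite mule_ge0 // mule_ge0 //; last by rewrite lee_fin powR_ge0.
  rewrite riesz_convE //; apply: integral_ge0 => y _.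
  by rewrite lee_fin; exact: (mulr_ge0 (powR_ge0 _ _) (powR_ge0 _ _)).
Qed.

Local Close Scope classical_set_scope.

Theorem theorem1p3 (R : realType) (n : nat) (alpha : R) :
  (3 <= n)%N -> 0 < alpha -> alpha < n%:R ->
  [/\ forall lambda sigma : R,
        0 < lambda -> lambda < (n%:R - alpha) / (n%:R - 2) ->
        sigma = galpha n alpha lambda ->
        forall u : 'rV[R]_n -> R, nonneg_solution alpha lambda sigma u ->
          harmonically_bounded lambda u,
      forall lambda sigma : R,
        lambda = (n%:R - alpha) / (n%:R - 2) ->
        sigma = galpha n alpha lambda ->
        ~ has_pointwise_bound n alpha lambda sigma
    & forall lambda sigma : R,
        2 < alpha -> n%:R / (alpha - 2) < lambda ->
        sigma = galpha n alpha lambda ->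
        ~ has_pointwise_bound n alpha lambda sigma].
Proof.
move=> n3 a0 an; have n3' : 3 <= n%:R :> R by rewrite ler_nat.
have n2 : 0 < n%:R - 2 :> R by lra.
have na : 0 < n%:R - alpha by rewrite subr_gt0.
split=> [lambda sigma l0 la sE u|lambda sigma lE sE|lambda sigma a2 la sE].
- exact: harmonic_bound.
- have l0 : 0 < lambda by rewrite lE divr_gt0.
  (* At its left end the second branch of [galpha] takes the value of the first. *)
  have {}sE : sigma = n%:R / (n%:R - 2).
    rewrite sE /galpha lE ltxx ifT; last by rewrite ltr_pM2r ?invr_gt0 // gtrBl.
    by field; rewrite gt_eqF.
  have s1 : 1 < sigma by rewrite sE ltr_pdivlMr // mul1r gtrBl.
  apply: no_pointwise_bound => //; [lra|lra|].
  by rewrite lE sE; exact: has_bumps_critical.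
have a20 : 0 < alpha - 2 by rewrite subr_gt0.
have l1 : 1 < lambda by apply: lt_trans la; rewrite ltr_pdivlMr // mul1r; lra.
have nl : n%:R / (n%:R - 2) < lambda.
  apply: lt_trans la; rewrite ltr_pM2l; last by lra.
  by rewrite ltf_pV2 // ltrD2r.
(* [nl] selects the last branch of [galpha], and [lambda > n / (alpha - 2)] makes the affine term in
   its maximum negative. *)
have {}sE : sigma = 0.
  rewrite sE /galpha !ifF; last first.
  - by apply/negbTE; rewrite -leNgt; apply: le_trans (ltW nl); rewrite ler_pM2r ?invr_gt0 // gerBl ltW.
  - by apply/negbTE; rewrite -leNgt ltW.
  apply/max_idPl; rewrite subr_le0 mulrAC ler_pdivlMr; last by lra.
  by rewrite mul1r ltW // mulrC -ltr_pdivrMr.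
rewrite sE; apply: no_pointwise_bound => //; [lra|lra|].
exact: has_bumps_steep.
Qed.
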